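(* Consider the Hawkes$/M/\infty$ queue with background intensity $\lambda_\infty>0$, mark $B$, and exponential service requirements $J$, $\mathscr J(u):=\mathbb{P}(J>u)=e^{-\mu u}$, $\mu>0$. Assume that the first two moments $b_1:=\mathbb{E}B$ and $b_2:=\mathbb{E}B^2$ of $B$ are finite, and that the excitation function is $h(u)=e^{-ru}$, $u\geqslant0$, with $r>0$. Let $\rho:=b_1\int_0^\infty h(u)\,\mathrm du=b_1/r$ and let $N$ be the stationary number of customers. As $\rho\uparrow1$, $$(1-\rho)N\ \stackrel{d}{\to}\ \Gamma\left(\frac{2r\lambda_\infty}{b_2},\frac{2r\mu}{b_2}\right).$$
   Context: Hawkes$/M/\infty$ queue: $B$ is a random variable with $\mathbb{P}(B>0)=1$ and $B_1,B_2,\dots$ are i.i.d. copies of $B$. The arrival process $(M(t))_{t\geqslant0}$ is a Hawkes process: a counting process with arrival epochs $t_1<t_2<\cdots$ and associated filtration $\mathscr{F}(t)$ such that, as $\Delta t\downarrow0$, $\mathbb{P}(M(t+\Delta t)-M(t)=1\mid\mathscr{F}(t))=\Lambda(t)\Delta t+o(\Delta t)$, the conditional probability of more than one arrival is $o(\Delta t)$, and that of no arrival is $1-\Lambda(t)\Delta t+o(\Delta t)$, where $\Lambda(t)=\lambda_\infty+\sum_{t_i<t}B_ih(t-t_i)$. Each arrival is a customer taken into service immediately; service requirements are i.i.d. exponential with rate $\mu$, independent of everything else. $N(t)$ is the number of customers in the system at time $t$, with $N(0)=0$; for $\rho<1$ (stability), the stationary number $N=N(\infty)$ is distributed as the limit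 of $N(t)$ as $t\to\infty$. $\Gamma(\alpha_1,\alpha_2)$ denotes the Gamma distribution with shape parameter $\alpha_1$ and rate parameter $\alpha_2$; $\stackrel{d}{\to}$ is convergence in distribution. *)

(* Defs.v *)
From HB Require Import structures.
From mathcomp Require Import all_boot all_order all_algebra.
From mathcomp Require Import all_classical all_reals all_analysis.

Set Implicit Arguments.
Unset Strict Implicit.
Unset Printing Implicit Defensive.

Import Order.TTheory GRing.Theory Num.Theory.
Import numFieldNormedType.Exports.

Local Open Scope classical_set_scope.
Local Open Scope ring_scope.

Section sigma_algebras.
Context (d : measure_display) (T : measurableType d) (R : realType).
Variable P : probability T R.

Definition sigma_gen (I : Type) (D : set I) (X : I -> T -> R) : set (set T) :=
  <<s \bigcup_(i in D) preimage_set_system setT (X i) measurable >>.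

Definition mutually_independent (I : choiceType) (G : I -> set (set T)) : Prop :=
  forall (s : seq I) (A : I -> set T), uniq s ->
    (forall i, i \in s -> G i (A i)) ->
    P (\bigcap_(i in [set` s]) A i) = \big[mule/1%E]_(i <- s) P (A i).

(* p is a version of the conditional probability P(E | G). *)
Definition is_cond_prob (G : set (set T)) (E : set T) (p : T -> R) : Prop :=
  [/\ forall U, measurable U -> G (p @^-1` U),
      P.-integrable setT (EFin \o p) &
      forall A, G A -> (\int[P]_(w in A) (p w)%:E = P (A `&` E))%E].

(* P(E t D | F t) = a t D + o(D) as D decreases to 0.  The random remainder
   is o(D) in L^1(P), uniformly for t in bounded intervals.  Uniformity in t
   matters: a remainder that is o(D) for each t separately would not exclude
   additional arrivals at deterministic times. *)
Definition cond_prob_expansion (F : R -> set (set T)) (E : R -> R -> set T)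
    (a : R -> R -> T -> R) : Prop :=
  exists p : R -> R -> T -> R,
    (forall t D, 0 <= t -> 0 < D -> is_cond_prob (F t) (E t D) (p t D)) /\
    (forall S eps, 0 < eps -> \forall D \near 0^'+, forall t, 0 <= t <= S ->
      (\int[P]_w (`|p t D w - a t D w|)%:E <= (eps * D)%:E)%E).

End sigma_algebras.

Section hawkes.
Context (d : measure_display) (T : measurableType d) (R : realType).

(* Arrivals are numbered from 0: [tau 0 < tau 1 < ...] are the epochs, [B i] is
   the mark and [J i] the service requirement of the arrival at [tau i], and
   [M t] is the number of arrivals in [0, t]. *)

Definition hawkes_intensity (lambda : R) (h : R -> R) (M : R -> T -> nat)
    (tau B : nat -> T -> R) (t : R) (w : T) : R :=
  lambda + \sum_(i < M t w | tau i w < t) B i w * h (t - tau i w).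

(* The history at time t: the arrivals up to t, with their marks. *)
Definition hawkes_filtration (M : R -> T -> nat) (B : nat -> T -> R) (t : R) :
    set (set T) :=
  <<s (\bigcup_(s in `[0, t]) preimage_set_system setT (M s) measurable) `|`
      (\bigcup_i preimage_set_system setT
                   (fun w => if (i < M t w)%N then B i w else 0) measurable) >>.

Definition number_in_system (M : R -> T -> nat) (tau J : nat -> T -> R)
    (t : R) (w : T) : nat :=
  (\sum_(i < M t w) (t < tau i w + J i w)%R)%N.

Variable P : probability T R.

(* The Hawkes/G/oo queue with background intensity [lambda], mark law [nu],
   excitation function [h] and service survival function [sf], empty at time 0.
   [hq_mark_past] says that each mark is drawn independently of the
   history strictly before it and of its own arrival epoch. *)
Record hawkes_queue (lambda : R) (nu : probability R R) (h sf : R -> R) := {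
  hq_count : R -> T -> nat ;
  hq_epoch : nat -> {RV P >-> R} ;
  hq_mark : nat -> {RV P >-> R} ;
  hq_service : nat -> {RV P >-> R} ;
  hq_epoch_gt0 : forall w, 0 < hq_epoch 0%N w ;
  hq_epoch_lt : forall i w, hq_epoch i w < hq_epoch i.+1 w ;
  hq_countP : forall t w i, 0 <= t ->
    (i < hq_count t w)%N = (hq_epoch i w <= t) ;
  hq_mark_law : forall i U, measurable U -> distribution P (hq_mark i) U = nu U ;
  hq_mark_indep :
    mutually_independent P (fun i => sigma_gen [set i] hq_mark) ;
  hq_mark_past : forall i (A C : set T),
    sigma_gen [set i] hq_mark A ->
    <<s sigma_gen [set j | (j <= i)%N] hq_epoch `|`
        sigma_gen [set j | (j < i)%N] hq_mark >> C ->
    P (A `&` C) = (P A * P C)%E ;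
  hq_one_arrival : cond_prob_expansion P
    (hawkes_filtration hq_count hq_mark)
    (fun t D => [set w | hq_count (t + D) w = (hq_count t w).+1])
    (fun t D w =>
       hawkes_intensity lambda h hq_count hq_epoch hq_mark t w * D) ;
  hq_several_arrivals : cond_prob_expansion P
    (hawkes_filtration hq_count hq_mark)
    (fun t D => [set w | ((hq_count t w).+1 < hq_count (t + D) w)%N])
    (fun _ _ _ => 0) ;
  hq_no_arrival : cond_prob_expansion P
    (hawkes_filtration hq_count hq_mark)
    (fun t D => [set w | hq_count (t + D) w = hq_count t w])
    (fun t D w =>
       1 - hawkes_intensity lambda h hq_count hq_epoch hq_mark t w * D) ;
  hq_service_law : forall i u, 0 <= u ->
    P [set w | u < hq_service i w] = (sf u)%:E ;
  (* [None] stands for the arrival process and its marks *)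
  hq_service_indep : mutually_independent P (fun k : option nat =>
    if k is Some i then sigma_gen [set i] hq_service
    else <<s sigma_gen setT hq_epoch `|` sigma_gen setT hq_mark >>)
}.

End hawkes.

Section distributions.
Context (R : realType).
Let leb := @lebesgue_measure R.

(* Convergence in distribution along the filter F, for laws on R given as set
   functions: convergence of the distribution functions at the continuity points
   of the limit. *)
Definition cvg_in_distribution (I : Type) (F : set_system I)
    (nu_ : I -> set R -> \bar R) (nu : set R -> \bar R) : Prop :=
  forall x : R, {for x, continuous (fun y : R => nu `]-oo, y]%classic)} ->
    nu_ i `]-oo, x]%classic @[i --> F] --> nu `]-oo, x]%classic.

Definition exp_decay (a u : R) : R := expR (- (a * u)).

Definition mark_mean (nu : probability R R) : R := \int[nu]_x x.

Definition mark_moment2 (nu : probability R R) : R := \int[nu]_x (x ^+ 2).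

Definition branching_ratio (nu : probability R R) (h : R -> R) : R :=
  mark_mean nu * \int[leb]_(u in `[0, +oo[) h u.

Definition Gamma_fun (a : R) : R :=
  \int[leb]_(x in `]0, +oo[) (x `^ (a - 1) * expR (- x)).

(* shape a, rate b *)
Definition gamma_pdf (a b x : R) : R :=
  if 0 < x then b `^ a / Gamma_fun a * x `^ (a - 1) * expR (- (b * x)) else 0.

Definition gamma_law (a b : R) (A : set R) : \bar R :=
  (\int[leb]_(x in A) (gamma_pdf a b x)%:E)%E.

(* The law of [N] is the limit law, as t -> +oo, of the number in system. *)
Definition is_stationary_number (d : measure_display) (T : measurableType d)
    (P : probability T R) (lambda : R) (nu : probability R R) (h sf : R -> R)
    (Q : hawkes_queue P lambda nu h sf)
    (e : measure_display) (S : measurableType e) (P' : probability S R)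
    (N : {RV P' >-> R}) : Prop :=
  cvg_in_distribution (pinfty_nbhs R)
    (fun t => pushforward P (fun w =>
       (number_in_system (hq_count Q) (hq_epoch Q) (hq_service Q) t w)%:R : R))
    (distribution P' N).

End distributions.

(* Main.v *)
Require Import Defs.
From HB Require Import structures.
From mathcomp Require Import all_boot all_order all_algebra.
From mathcomp Require Import all_classical all_reals all_analysis.
From mathcomp Require Import measurable_realfun ring lra.

Set Implicit Arguments.
Unset Strict Implicit.
Unset Printing Implicit Defensive.

Import Order.TTheory GRing.Theory Num.Theory.
Import numFieldNormedType.Exports.

Local Open Scope classical_set_scope.
Local Open Scope ring_scope.

(* Proof idea.  Let X_t be the excitation present at time t, so that the
   intensity is lambda + X_t up to a null set, let H be a horizon and
   zeta = 1 - z.  Conditionally on the arrivals, E z^N(H) is the expectation of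
   the product of g(t_i) = 1 - zeta e^(-mu (H - t_i)) over the epochs t_i <= H.
   For smooth functions al and C with C' = al' - a al and al(H) = C(H) = 0, the
   functional
     Z_t = exp (- lambda C(t) - al(t) X_t) * prod_(t_i <= t) g(t_i)
   has drift (g phi(al) - 1 - al' + a al) E [Z_t (lambda + X_t)], where phi is
   the Laplace transform of the mark law.  If the first factor has a constant
   sign, then E Z_H = E z^N(H) and E Z_0 = exp (- lambda C(0)) are comparable.
   No differential equation has to be solved: expanding phi to second order,
   al(t) = y(H - t) - q e^(-mu (H - t)) has the required sign, where y is the
   explicit solution of y' = - delta y - kappa y^2, y(0) = q, delta = a - b1;
   suitable kappa on either side of b2 / 2 and q near zeta / mu give a lower and
   an upper bound.  With z = e^(-theta (1 - rho)), letting H and then n tend to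
   infinity, both bounds tend to (1 + b2 theta / (2 r mu))^(-2 r lambda / b2),
   the Laplace transform of the Gamma law at theta.  For integer theta this is
   the convergence of the expectations of polynomials in e^(-(1 - rho) N), and
   Bernstein polynomials turn it into convergence of distribution functions. *)

(** * Expectations *)

(** Only means over short time intervals are compared. The arrivals are known through expansions
    whose remainders are o(D) in mean, uniformly in t, so over an interval of length D the mean E Z
    grows by D psi E[Z (lambda + X)] + o(D), and summing increments transfers the sign of psi to E
    Z_H - E Z_0. Only the mean of the intensity is controlled; quadratic errors are therefore
    replaced by V min(1, D V), whose mean tends to 0 for integrable V. The form of al comes from a
    cancellation. Let e = e^(-mu (H - t)) and y = al + q e. If kappa is the quadratic coefficient of
    phi, the equation for y cancels all terms in al alone, up to order two. The rest carries the
    factor e, so its sign follows from one scalar inequality between q and zeta, close to comparing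
    mu q with zeta because delta, zeta and q tend to 0. In the limit of the exponent only ln (1 +
    kappa q / delta) / kappa survives, with q / delta tending to theta / (mu r). This logarithm
    turns the exponential into a power, hence the Gamma law. *)

Section expectation.
Context d (T : measurableType d) (R : realType) (P : probability T R).
Implicit Types X Y Z : T -> R.

Definition Ex X : R := \int[P]_w X w.

Definition Li X : Prop := P.-integrable setT (EFin \o X).

Lemma Li_meas X : Li X -> measurable_fun setT X.
Proof. by move=> /measurable_int/measurable_EFinP. Qed.

Lemma Li_bounded X (c : R) :
  measurable_fun setT X -> (forall w, `|X w| <= c) -> Li X.
Proof.
move=> mX bX; apply: measurable_bounded_integrable => //.
  by rewrite [X in (X < _)%E](_ : _ = 1%E) ?ltry//; exact: probability_setT.
exists c; split; first exact: num_real.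
by move=> x cx w _ /=; apply: le_trans (bX w) (ltW cx).
Qed.

Lemma Li_dom X Y : measurable_fun setT X -> Li Y ->
  (forall w, `|X w| <= Y w) -> Li X.
Proof.
move=> mX iY XY; apply: (le_integrable _ _ _ iY) => //.
  exact/measurable_EFinP.
by move=> w _ /=; rewrite lee_fin; apply: le_trans (XY w) (ler_norm _).
Qed.

Lemma Li_cst (c : R) : Li (fun=> c).
Proof. exact: finite_measure_integrable_cst. Qed.

Lemma LiD X Y : Li X -> Li Y -> Li (fun w => X w + Y w).
Proof. by move=> iX iY; exact: (integrableD _ iX iY). Qed.

Lemma LiB X Y : Li X -> Li Y -> Li (fun w => X w - Y w).
Proof. by move=> iX iY; exact: (integrableB _ iX iY). Qed.

Lemma LiZ (c : R) X : Li X -> Li (fun w => c * X w).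
Proof. by move=> iX; exact: (integrableZl _ _ iX). Qed.

Lemma Li_norm X : Li X -> Li (fun w => `|X w|).
Proof. by move=> iX; exact: (integrable_norm iX). Qed.

Lemma LiM X Y (c : R) : measurable_fun setT Y -> (forall w, `|Y w| <= c) ->
  Li X -> Li (fun w => X w * Y w).
Proof.
move=> mY bY iX; apply: (@Li_dom _ (fun w => c * `|X w|)).
- by apply: measurable_funM => //; exact: Li_meas.
- by apply: LiZ; exact: Li_norm.
- by move=> w; rewrite normrM mulrC ler_wpM2r.
Qed.

Lemma Li_sum n (X : nat -> T -> R) : (forall i, Li (X i)) ->
  Li (fun w => \sum_(i < n) X i w).
Proof.
move=> iX; elim: n => [|n IHn].
  by under [X in Li X]eq_fun do rewrite big_ord0; exact: Li_cst.
by under [X in Li X]eq_fun do rewrite big_ord_recr/=; exact: LiD.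
Qed.

Lemma ExE X : Li X -> (Ex X)%:E = (\int[P]_w (X w)%:E)%E.
Proof. by move=> iX; rewrite /Ex /Rintegral fineK// integrable_fin_num. Qed.

Lemma eq_Ex X Y : (forall w, X w = Y w) -> Ex X = Ex Y.
Proof. by move=> XY; apply: eq_Rintegral => w _. Qed.

Lemma ExD X Y : Li X -> Li Y -> Ex (fun w => X w + Y w) = Ex X + Ex Y.
Proof. by move=> iX iY; exact: RintegralD. Qed.

Lemma ExB X Y : Li X -> Li Y -> Ex (fun w => X w - Y w) = Ex X - Ex Y.
Proof. by move=> iX iY; exact: RintegralB. Qed.

Lemma ExZ (c : R) X : Li X -> Ex (fun w => c * X w) = c * Ex X.
Proof. by move=> iX; exact: RintegralZl. Qed.

Lemma Ex_cst (c : R) : Ex (fun=> c) = c.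
Proof.
rewrite /Ex Rintegral_cst// [X in fine X](_ : _ = 1%E) ?mulr1//.
exact: probability_setT.
Qed.

Lemma Ex_sum n (X : nat -> T -> R) : (forall i, Li (X i)) ->
  Ex (fun w => \sum_(i < n) X i w) = \sum_(i < n) Ex (X i).
Proof.
move=> iX; elim: n => [|n IHn].
  rewrite big_ord0 -[RHS](Ex_cst 0); apply: eq_Ex => w.
  by rewrite big_ord0.
rewrite big_ord_recr/= -IHn -ExD//; last exact: Li_sum.
by apply: eq_Ex => w; rewrite big_ord_recr.
Qed.

Lemma le_Ex X Y : Li X -> Li Y -> (forall w, X w <= Y w) -> Ex X <= Ex Y.
Proof. by move=> iX iY XY; apply: le_Rintegral => // w _. Qed.

Lemma Ex_ge0 X : (forall w, 0 <= X w) -> 0 <= Ex X.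
Proof. by move=> X0; apply: Rintegral_ge0. Qed.

Lemma ler_norm_Ex X : Li X -> `|Ex X| <= Ex (fun w => `|X w|).
Proof. by move=> iX; exact: le_normr_Rintegral. Qed.

(** Measurability of [Y] is a premise because almost sure equality does not give it when [P] is not
    complete. *)
Lemma Ex_ae X Y : Li X -> measurable_fun setT Y ->
  {ae P, forall w, X w = Y w} -> Li Y /\ Ex X = Ex Y.
Proof.
move=> iX mY XY.
have aeE : ae_eq P setT (EFin \o X) (EFin \o Y).
  by apply: filterS XY => w e _; rewrite /= e.
have mYE : measurable_fun setT (EFin \o Y) by exact/measurable_EFinP.
have mXE : measurable_fun setT (EFin \o X) by exact: measurable_int iX.
have iXY : (\int[P]_w `|(EFin \o X) w| = \int[P]_w `|(EFin \o Y) w|)%E.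
  apply: ae_eq_integral => //; [exact: measurableT_comp|exact: measurableT_comp|].
  by apply: filterS aeE => w e _; rewrite e.
split.
  apply/integrableP; split => //.
  by rewrite -iXY; case/integrableP : iX.
by rewrite /Ex /Rintegral; congr fine; exact: ae_eq_integral.
Qed.

Lemma Ex_indic A : measurable A -> Ex (\1_A) = fine (P A).
Proof. by move=> mA; rewrite /Ex /Rintegral integral_indic// setIT. Qed.

Lemma Li_indic A : measurable A -> Li (\1_A).
Proof. by move=> mA; exact: integrable_indic. Qed.

Lemma Ex_dct (X : nat -> T -> R) Y V : (forall k, measurable_fun setT (X k)) ->
  measurable_fun setT Y -> Li V -> (forall k w, `|X k w| <= V w) ->
  (forall w, X k w @[k --> \oo] --> Y w) -> Ex (X k) @[k --> \oo] --> Ex Y.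
Proof.
move=> mX mY iV XV XY.
have iY : Li Y.
  apply: Li_dom iV _ => // w.
  have cvgn : `|X k w| @[k --> \oo] --> `|Y w| by apply: cvg_norm; exact: XY.
  rewrite -(cvg_lim _ cvgn)//; apply: limr_le; first by apply/cvg_ex; eexists; exact: cvgn.
  by apply: nearW => k.
suff : (Ex (X k))%:E @[k --> \oo] --> (Ex Y)%:E by move=> /fine_cvgP[].
rewrite (ExE iY).
have -> : (fun k => (Ex (X k))%:E) = (fun k => \int[P]_w (EFin \o X k) w)%E.
  by apply/funext => k /=; apply: ExE; exact: Li_dom (mX k) iV (XV k).
apply: (@dominated_cvg _ _ _ P setT measurableT (fun k => EFin \o X k)
  (EFin \o Y) (EFin \o V)) => //.
- by move=> k; exact/measurable_EFinP.
- by move=> w _; apply: cvg_EFin; [exact: nearW|exact: XY].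
- by move=> k w _; rewrite /= lee_fin.
Qed.

End expectation.

(** * Layer-cake approximation and independence *)

Section layer_cake.
Variable R : realType.

(** On [0, 1] this is y rounded down to a multiple of 1/k, written through superlevel conditions:
    identities known for events then extend to functions with values in [0, 1]. *)
Definition layer (k : nat) (y : R) : R :=
  \sum_(j < k) k%:R^-1 * (j.+1%:R <= k%:R * y)%R%:R.

Lemma layer_count (k : nat) (x : R) : 0 <= x ->
  \sum_(j < k) (j.+1%:R <= x)%R%:R <= x /\
  (x < k%:R -> x - 1 <= \sum_(j < k) (j.+1%:R <= x)%R%:R) /\
  (k%:R <= x -> \sum_(j < k) (j.+1%:R <= x)%R%:R = k%:R :> R).
Proof.
move=> x0; elim: k => [|k [IH1 [IH2 IH3]]].
  by rewrite big_ord0; split=> //; split=> //; rewrite ltNge x0.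
rewrite big_ord_recr/=; have [kx|kx] := leP k.+1%:R x.
  have kx' : k%:R <= x by apply: le_trans kx; rewrite ler_nat.
  rewrite (IH3 kx') natr1; split=> //; split=> //.
rewrite addr0; split=> //; split=> // _.
have [xk|xk] := ltP x k%:R; first exact: IH2.
by rewrite (IH3 xk); move: kx; rewrite -natr1; lra.
Qed.

Lemma layer_approx (k : nat) (y : R) : (0 < k)%N -> 0 <= y <= 1 ->
  `|y - layer k y| <= k%:R^-1.
Proof.
move=> k0 /andP[y0 y1]; have k0' : 0 < k%:R :> R by rewrite ltr0n.
have ky0 : 0 <= k%:R * y by rewrite mulr_ge0// ltW.
have [L1 [L2 L3]] := layer_count k ky0.
rewrite /layer -mulr_sumr; set s := \sum_(_ < _) _ in L1 L2 L3 *.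
have -> : y - k%:R^-1 * s = k%:R^-1 * (k%:R * y - s).
  by field; rewrite gt_eqF.
rewrite normrM ger0_norm ?invr_ge0 ?ler0n// ler_piMr ?invr_ge0 ?ler0n//.
have [ky|ky] := ltP (k%:R * y) k%:R.
  by have := L2 ky; rewrite ler_norml; lra.
have e : k%:R * y = k%:R.
  by apply/eqP; rewrite eq_le ky ler_piMr// ltW.
by rewrite (L3 ky) e subrr normr0.
Qed.

Context d (T : measurableType d) (P : probability T R).
Local Notation Ex := (Ex P).
Local Notation Li := (Li P).

Lemma measurable_superlevel (Y : T -> R) (c : R) : measurable_fun setT Y ->
  measurable [set w | c <= Y w].
Proof.
move=> mY; rewrite -[X in measurable X]setTI.
have := mY measurableT `[c, +oo[%classic (measurable_itv _).
by congr (measurable _); apply/seteqP; split=> w /=; rewrite in_itv/= andbT.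
Qed.

Lemma layerE (k : nat) (Y : T -> R) (w : T) : (0 < k)%N ->
  layer k (Y w) =
  \sum_(j < k) k%:R^-1 * \1_[set w | j.+1%:R / k%:R <= Y w] w.
Proof.
move=> k0; apply: eq_bigr => j _; rewrite indicE; congr (_ * _%:R).
rewrite mulrC -ler_pdivrMr ?ltr0n//.
by case: (boolP (_ <= _)) => h; [rewrite mem_set | rewrite memNset//; exact/negP].
Qed.

(** The weight [p] may be signed and unbounded. With [p] one factor and [K] its mean this gives
    product formulas; with [p] the defect of a conditional probability and [K = 0] it passes from
    events of the history to history-measurable functions. *)
Lemma Ex_layer (p Y : T -> R) (K : R) : Li p -> measurable_fun setT Y ->
  (forall w, 0 <= Y w <= 1) ->
  (forall c, Ex (fun w => p w * \1_[set w | c <= Y w] w) =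
             K * Ex (\1_[set w | c <= Y w])) ->
  Ex (fun w => p w * Y w) = K * Ex Y.
Proof.
move=> ip mY Y01 H.
have mS c : measurable [set w | c <= Y w] by exact: measurable_superlevel.
have iS c : Li (\1_[set w | c <= Y w]) by exact: Li_indic.
have ipS c : Li (fun w => p w * \1_[set w | c <= Y w] w).
  apply: (@LiM _ _ _ _ _ _ 1) => // w.
  by rewrite indicE; case: (_ \in _); rewrite ?normr1 ?normr0.
have Y1 w : `|Y w| <= 1 by have /andP[? ?] := Y01 w; rewrite ger0_norm.
have iY : Li Y by apply: Li_bounded mY Y1.
have ipY : Li (fun w => p w * Y w) by exact: LiM mY Y1 ip.
(* [Y] and its layer differ by at most 1/k, so the two sides move by at most E|p| / k and |K| /
   k. *)
pose c : R := Ex (fun w => `|p w|) + `|K|.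
have c0 : 0 <= c by rewrite addr_ge0// Ex_ge0.
have key k : (0 < k)%N -> `|Ex (fun w => p w * Y w) - K * Ex Y| <= c / k%:R.
  move=> k0; have lL : forall w, `|Y w - layer k (Y w)| <= k%:R^-1.
    by move=> w; exact: layer_approx.
  pose S j := [set w | j.+1%:R / k%:R <= Y w].
  pose L (w : T) : R := \sum_(j < k) k%:R^-1 * \1_(S j) w.
  have LE w : layer k (Y w) = L w by exact: layerE.
  have iL : Li L by apply: (@Li_sum _ _ _ _ _ (fun j w => k%:R^-1 * \1_(S j) w)) => j; apply: LiZ; exact: iS.
  have EL : Ex (fun w => p w * L w) = K * Ex L.
    transitivity (Ex (fun w => \sum_(j < k) k%:R^-1 * (p w * \1_(S j) w))).
      by apply: eq_Ex => w; rewrite /L mulr_sumr; apply: eq_bigr => j _; ring.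
    rewrite (@Ex_sum _ _ _ _ _ (fun j w => k%:R^-1 * (p w * \1_(S j) w))); last first.
      by move=> j; apply: LiZ; exact: ipS.
    rewrite (@Ex_sum _ _ _ _ _ (fun j w => k%:R^-1 * \1_(S j) w)); last first.
      by move=> j; apply: LiZ; exact: iS.
    rewrite mulr_sumr; apply: eq_bigr => j _.
    rewrite ExZ; last exact: ipS.
    by rewrite ExZ; [rewrite H; ring|exact: iS].
  have iYL : Li (fun w => Y w - L w) by exact: LiB.
  have bYL w : `|Y w - L w| <= k%:R^-1 by rewrite -LE.
  have ipYL : Li (fun w => p w * (Y w - L w)).
    by apply: LiM ip => //; exact: Li_meas iYL.
  have ipL : Li (fun w => p w * L w).
    have -> : (fun w => p w * L w) = (fun w => p w * Y w - p w * (Y w - L w)).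
      by apply/funext => w; ring.
    exact: LiB.
  have -> : Ex (fun w => p w * Y w) - K * Ex Y =
      Ex (fun w => p w * (Y w - L w)) - K * Ex (fun w => Y w - L w).
    rewrite ExB// mulrBr -EL opprB.
    have -> : Ex (fun w => p w * (Y w - L w)) =
        Ex (fun w => p w * Y w) - Ex (fun w => p w * L w).
      by rewrite -ExB//; apply: eq_Ex => w; ring.
    ring.
  apply: le_trans (ler_normB _ _) _; rewrite /c mulrDl lerD//.
    apply: le_trans (ler_norm_Ex ipYL) _.
    rewrite mulrC -ExZ//; last exact: Li_norm.
    apply: le_Ex; [exact: Li_norm|by apply: LiZ; exact: Li_norm|].
    by move=> w; rewrite normrM mulrC ler_wpM2r.
  rewrite normrM ler_wpM2l//; apply: le_trans (ler_norm_Ex iYL) _.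
  rewrite -[leRHS](Ex_cst P); apply: le_Ex => //; [exact: Li_norm|exact: Li_cst].
apply/eqP; rewrite -subr_eq0 -normr_le0; apply/ler_addgt0Pl => e e0.
rewrite addr0.
pose k := (Num.truncn (c / e)).+1.
have kb : c / e < k%:R by rewrite /k; apply: truncnS_gt; rewrite divr_ge0// ltW.
apply: le_trans (key k isT) _.
rewrite ler_pdivrMr ?ltr0n//; move: kb; rewrite ltr_pdivrMr// => /ltW.
by rewrite mulrC.
Qed.

Lemma Ex_mul_indep (X Y : T -> R) :
  measurable_fun setT X -> measurable_fun setT Y ->
  (forall w, 0 <= X w <= 1) -> (forall w, 0 <= Y w <= 1) ->
  (forall c c' : R, P ([set w | (c <= X w)%R] `&` [set w | (c' <= Y w)%R]) =
     P [set w | (c <= X w)%R] * P [set w | (c' <= Y w)%R])%E ->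
  Ex (fun w => X w * Y w) = Ex X * Ex Y.
Proof.
move=> mX mY X01 Y01 H.
have ind A : measurable A -> forall w : T, `|\1_A w : R| <= 1.
  by move=> mA w; rewrite indicE; case: (_ \in _); rewrite ?normr1 ?normr0.
have iX : Li X.
  by apply: (@Li_bounded _ _ _ _ _ 1) => // w; have /andP[? ?] := X01 w; rewrite ger0_norm.
apply: Ex_layer => // c.
have mc : measurable [set w | c <= Y w] by exact: measurable_superlevel.
transitivity (Ex (fun w => \1_[set w | c <= Y w] w * X w)).
  by apply: eq_Ex => w; rewrite mulrC.
rewrite mulrC; apply: Ex_layer => // [|c']; first exact: Li_indic.
have mc' : measurable [set w | c' <= X w] by exact: measurable_superlevel.
transitivity (Ex (\1_([set w | c' <= X w] `&` [set w | c <= Y w]))).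
  by apply: eq_Ex => w; rewrite indicI/= mulrC.
rewrite !Ex_indic//; last exact: measurableI.
by rewrite H fineM ?fin_num_measure// mulrC.
Qed.

End layer_cake.

(** Stands in for a second moment: an error of size D V min(1, D V) is o(D) in mean as soon as [V]
    is integrable. Dominated convergence is applied along D = 1/(k+1); monotonicity in D covers all
    smaller values. *)
Lemma Ex_mul_min (R : realType) d (T : measurableType d) (P : probability T R)
    (V : T -> R) (e : R) : Li P V -> (forall w, 0 <= V w) -> 0 < e ->
  exists2 D0 : R, 0 < D0 & forall D, 0 < D <= D0 ->
    Ex P (fun w => V w * Num.min 1 (D * V w)) <= e.
Proof.
move=> iV V0 e0; have mV := Li_meas iV.
have mM (D : R) : measurable_fun setT (fun w => Num.min 1 (D * V w)).
  by apply: measurable_minr => //; exact: measurable_funM.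
have M1 (D : R) w : 0 <= D -> `|Num.min 1 (D * V w)| <= 1.
  move=> D0; rewrite ger0_norm ?ge_min ?lexx//.
  by rewrite le_min ler01 mulr_ge0.
have cv : Ex P (fun w => V w * Num.min 1 (k.+1%:R^-1 * V w)) @[k --> \oo] --> Ex P (fun=> 0).
  apply: (@Ex_dct _ _ _ _ (fun k w => V w * Num.min 1 (k.+1%:R^-1 * V w)) _ V) => //.
  - by move=> k; apply: measurable_funM.
  - move=> k w; rewrite normrM (ger0_norm (V0 w)) ler_piMr//.
    by apply: M1; rewrite invr_ge0.
  - move=> w; apply: (@squeeze_cvgr _ _ _ _ (fun=> 0) (fun k => V w * (k.+1%:R^-1 * V w))).
    + apply: nearW => k; rewrite mulr_ge0//=; last by rewrite le_min ler01 mulr_ge0.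
      by rewrite ler_wpM2l// ge_min lexx orbT.
    + exact: cvg_cst.
    + have -> : (fun k : nat => V w * (k.+1%:R^-1 * V w)) = (fun k => (V w * V w) * k.+1%:R^-1).
        by apply/funext => k; ring.
      rewrite -[X in _ --> X](mulr0 (V w * V w)).
      by apply: cvgM; [exact: cvg_cst|exact: cvg_harmonic].
rewrite Ex_cst in cv.
have [k _ /(_ k (leqnn k)) hk] := cvgr_lt _ cv _ e0.
exists k.+1%:R^-1; first by rewrite invr_gt0.
move=> D /andP[D0 Dk]; apply: le_trans (ltW hk); apply: le_Ex.
- by apply: LiM (mM D) _ iV => // w; apply: M1; exact: ltW.
- by apply: LiM (mM _) _ iV => // w; apply: M1; rewrite invr_ge0.
- move=> w; rewrite ler_wpM2l// le_min ge_min lexx/= ge_min.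
  by rewrite ler_wpM2r ?orbT.
Qed.

(** * Arrival process *)

Section random_products.
Context d (T : measurableType d) (R : realType).
Variable m : T -> nat.
Hypothesis mm : forall i, measurable [set w | (i < m w)%N].

Lemma big_ord_guard (A : Type) (idx : A) (op : Monoid.law idx) (n k : nat)
    (F : nat -> A) : (n <= k)%N ->
  \big[op/idx]_(i < k) (if (i < n)%N then F i else idx) =
  \big[op/idx]_(i < n) F i.
Proof. move=> nk. rewrite (@big_ord_widen _ _ _ n k F nk). rewrite [RHS]big_mkcond. by []. Qed.

Lemma measurable_guard (F G : T -> R) i : measurable_fun setT F ->
  measurable_fun setT G ->
  measurable_fun setT (fun w => if (i < m w)%N then F w else G w).
Proof.
move=> mF mG; apply: measurable_fun_ifT => //.
apply: (@measurable_fun_bool _ _ _ _ true) => //; rewrite setTI.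
by rewrite [X in measurable X](_ : _ = [set w | (i < m w)%N]).
Qed.

(** For each outcome the product guarded by [i < m w] is constant in k from [m w] on, so a product
    with a random number of factors is a pointwise limit of products with a fixed number. *)
Lemma measurable_rand_prod (F : nat -> T -> R) :
  (forall i, measurable_fun setT (fun w => if (i < m w)%N then F i w else 1)) ->
  measurable_fun setT (fun w => \prod_(i < m w) F i w).
Proof.
move=> mF.
apply: (@measurable_fun_cvg _ _ _ _
  (fun k w => \prod_(i < k) (if (i < m w)%N then F i w else 1))) => [k|w _].
  elim: k => [|k IHk].
    by rewrite (_ : (fun=> _) = cst 1)//; apply/funext => w; rewrite big_ord0.
  rewrite (_ : (fun=> _) = fun w => \prod_(i < k) (if (i < m w)%N then F i w else 1)
    * (if (k < m w)%N then F k w else 1)); first exact: measurable_funM.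
  by apply/funext => w; rewrite big_ord_recr.
apply: cvg_near_cst; exists (m w) => // k /= mk.
by rewrite (big_ord_guard _ (fun i => F i w)).
Qed.

Lemma measurable_rand_sum (F : nat -> T -> R) :
  (forall i, measurable_fun setT (fun w => if (i < m w)%N then F i w else 0)) ->
  measurable_fun setT (fun w => \sum_(i < m w) F i w).
Proof.
move=> mF.
apply: (@measurable_fun_cvg _ _ _ _
  (fun k w => \sum_(i < k) (if (i < m w)%N then F i w else 0))) => [k|w _].
  elim: k => [|k IHk].
    by rewrite (_ : (fun=> _) = cst 0)//; apply/funext => w; rewrite big_ord0.
  rewrite (_ : (fun=> _) = fun w => \sum_(i < k) (if (i < m w)%N then F i w else 0)
    + (if (k < m w)%N then F k w else 0)); first exact: measurable_funD.
  by apply/funext => w; rewrite big_ord_recr.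
apply: cvg_near_cst; exists (m w) => // k /= mk.
by rewrite (big_ord_guard _ (fun i => F i w)).
Qed.

Lemma measurable_ray (f : T -> R) :
  (forall c, measurable [set w | f w <= c]) -> measurable_fun setT f.
Proof.
move=> H; apply: (measurability _ (RGenOInfty.measurableE R)) => //.
move=> _ [_ [c ->] <-]; rewrite setTI.
rewrite (_ : _ @^-1` _ = ~` [set w | f w <= c]); first exact: measurableC.
by apply/seteqP; split => w /=; rewrite in_itv/= andbT ltNge => /negP.
Qed.

End random_products.

(** The measurable structure is changed on the domain, so that the closure properties of measurable
    functions apply to sub-sigma-algebras given by generators. *)
Definition sigma_measurable (T : pointedType) (R : realType) (G : set (set T)) (f : T -> R) :=
  measurable_fun (setT : set (g_sigma_algebraType G)) f.

Lemma sigma_measurable_fun d (T : measurableType d) (R : realType)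
    (G : set (set T)) (f : T -> R) :
  G `<=` measurable -> sigma_measurable G f -> measurable_fun setT f.
Proof.
move=> sG mf _ U mU; have := mf measurableT U mU; rewrite !setTI => h.
have := @smallest_sub _ (sigma_algebra setT) G measurable.
by apply => //; exact: sigma_algebra_measurable.
Qed.

Section queue.
Context d (T : measurableType d) (R : realType) (P : probability T R).
Variables (lambda a : R) (nu : probability R R) (sf : R -> R).
Variable Q : hawkes_queue P lambda nu (exp_decay a) sf.

Local Notation M := (hq_count Q).
Local Notation tau := (hq_epoch Q).
Local Notation B := (hq_mark Q).
Local Notation J := (hq_service Q).

(* Marks are positive only almost surely; truncation makes this hold everywhere. *)
Definition pmark i w : R := Num.max 0 (B i w).

(* The intensity is lambda + mass unless t is an epoch, which is a null event. *)
Definition mass t w : R :=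
  \sum_(i < M t w) pmark i w * expR (- (a * (t - tau i w))).

Definition gprod (g : R -> R) t w : R := \prod_(i < M t w) g (tau i w).

Lemma pmark_ge0 i w : 0 <= pmark i w.
Proof. by rewrite le_max lexx. Qed.

Lemma mass_ge0 t w : 0 <= mass t w.
Proof. by apply: sumr_ge0 => i _; rewrite mulr_ge0 ?pmark_ge0 ?expR_ge0. Qed.

Lemma epoch_gt0 i w : 0 < tau i w.
Proof.
elim: i => [|i IHi]; first exact: hq_epoch_gt0.
by apply: lt_trans IHi _; exact: hq_epoch_lt.
Qed.

Lemma countE t w i : 0 <= t -> (i < M t w)%N = (tau i w <= t).
Proof. exact: hq_countP. Qed.

Lemma count_le s t w : 0 <= s -> s <= t -> (M s w <= M t w)%N.
Proof.
move=> s0 st; rewrite leqNgt; apply/negP => h.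
have : (M t w < M t w)%N.
  by rewrite countE ?(le_trans s0)// (le_trans _ st)// -countE.
by rewrite ltnn.
Qed.

Lemma count0 w : M 0 w = 0%N.
Proof.
apply/eqP; rewrite -leqn0 leqNgt countE//; apply/negP => h.
by have := lt_le_trans (epoch_gt0 0 w) h; rewrite ltxx.
Qed.

Lemma eq_count t w k : 0 <= t -> (M t w == k) =
  ((k == 0%N) || (tau k.-1 w <= t)) && (t < tau k w).
Proof.
move=> t0; rewrite eqn_leq andbC leqNgt -(negbK (t < _)) -leNgt -!countE// -leqNgt.
by congr (_ && _); [case: k => //= k; rewrite countE|rewrite -leqNgt].
Qed.

Lemma measurable_count_lt t i : 0 <= t -> measurable [set w | (i < M t w)%N].
Proof.
move=> t0; have := @measurable_funPT _ _ _ _ (tau i) measurableT `]-oo, t]%classic (measurable_itv _).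
rewrite setTI; congr measurable; apply/seteqP; split => w /=; by rewrite in_itv/= countE.
Qed.

(** The generators of [hawkes_filtration] before closure, the form that [sigma_measurable] takes. *)
Definition history (t : R) : set (set T) :=
  (\bigcup_(s in `[0, t]) preimage_set_system setT (M s) measurable) `|`
  (\bigcup_i preimage_set_system setT
     (fun w => if (i < M t w)%N then B i w else 0) measurable).

Lemma measurable_mark i : measurable_fun setT (B i).
Proof. exact: measurable_funPT. Qed.

Lemma measurable_epoch i : measurable_fun setT (tau i).
Proof. exact: measurable_funPT. Qed.

Lemma measurable_count t : 0 <= t -> measurable_fun setT (M t).
Proof.
move=> t0; apply: (measurability _ NGenCInfty.measurableE) => //.
move=> _ [_ [k ->] <-]; rewrite setTI.
case: k => [|k].
  by rewrite (_ : _ @^-1` _ = setT)//; apply/seteqP; split => w //= _; rewrite in_itv.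
rewrite (_ : _ @^-1` _ = [set w | (k < M t w)%N]); first exact: measurable_count_lt.
by apply/seteqP; split => w /=; rewrite in_itv/= andbT leEnat.
Qed.

Lemma history_sub t : 0 <= t -> history t `<=` measurable.
Proof.
move=> t0 A [[s /= s0]|[i _]] [U mU <-].
  by apply: measurable_count => //; move: s0; rewrite in_itv/= => /andP[].
suff : measurable_fun setT (fun w => if (i < M t w)%N then B i w else 0) by apply.
apply: measurable_guard => [j||]; [exact: measurable_count_lt|exact: measurable_mark|].
exact: measurable_cst.
Qed.

Lemma history_count_lt s t i : 0 <= s -> s <= t -> <<s history t >> [set w | (i < M s w)%N].
Proof.
move=> s0 st; apply: sub_sigma_algebra; left; exists s; first by rewrite /= in_itv/= s0.
by exists [set k | (i < k)%N] => //; rewrite setTI.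
Qed.

Lemma history_mark t i : sigma_measurable (history t) (fun w => if (i < M t w)%N then B i w else 0).
Proof.
move=> _ U mU; apply: sub_sigma_algebra; right; exists i => //.
by exists U.
Qed.

(** The filtration is generated by counts and marks; an epoch is recovered from the earlier counts,
    since tau_i <= s means i < M s. *)
Lemma history_epoch t i : 0 <= t ->
  sigma_measurable (history t) (fun w => if (i < M t w)%N then tau i w else 0).
Proof.
move=> t0; apply: measurable_ray => c.
have H s : 0 <= s -> s <= t ->
    @measurable _ (g_sigma_algebraType (history t)) [set w | (i < M s w)%N].
  by move=> s0 st; exact: history_count_lt.
have [c0|c0] := leP 0 c; last first.
  rewrite (_ : [set w | _] = set0); first exact: measurable0.
  apply/seteqP; split => w //=; case: ifP => _; last by rewrite leNgt c0.
  by rewrite leNgt (lt_trans c0)// epoch_gt0.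
(* For c >= 0 the default value 0 of an epoch later than t also satisfies the inequality, whence the
   complement. *)
rewrite (_ : [set w | _] = [set w | (i < M (Num.min c t) w)%N] `|` ~` [set w | (i < M t w)%N]).
  apply: measurableU; last by apply: measurableC; exact: H.
  by apply: H; rewrite ?le_min ?c0 ?t0 ?ge_min ?lexx ?orbT.
apply/seteqP; split => w /=.
  case: ifP => [it tc|it _]; last by right.
  by left; rewrite countE ?le_min ?c0 ?t0//= tc -countE.
move=> [|/negP/negbTE ->]; last by [].
rewrite countE ?le_min ?c0 ?t0// => /andP[tc tt].
by rewrite countE// tt.
Qed.

Lemma history_gprod g t : 0 <= t -> measurable_fun setT g ->
  sigma_measurable (history t) (gprod g t).
Proof.
move=> t0 mg.
have H j : @measurable _ (g_sigma_algebraType (history t)) [set w | (j < M t w)%N].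
  exact: history_count_lt.
apply: (@measurable_rand_prod _ (g_sigma_algebraType (history t)) R (M t)
  (fun i w => g (tau i w))) => i.
rewrite (_ : (fun w => _) = fun w => if (i < M t w)%N then
    g (if (i < M t w)%N then tau i w else 0) else 1); last first.
  by apply/funext => w; case: ifP.
apply: (measurable_guard H) => //; apply: measurableT_comp => //.
exact: history_epoch.
Qed.

Lemma history_mass t : 0 <= t -> sigma_measurable (history t) (mass t).
Proof.
move=> t0.
have H j : @measurable _ (g_sigma_algebraType (history t)) [set w | (j < M t w)%N].
  exact: history_count_lt.
apply: (@measurable_rand_sum _ (g_sigma_algebraType (history t)) R (M t)
  (fun i w => pmark i w * expR (- (a * (t - tau i w))))) => i.
rewrite (_ : (fun w => _) = fun w =>
    Num.max 0 (if (i < M t w)%N then B i w else 0) *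
    expR (- (a * (t - if (i < M t w)%N then tau i w else 0)))); last first.
  by apply/funext => w; case: ifP => _ //; rewrite maxxx mul0r.
apply: measurable_funM; first by apply: measurable_maxr => //; exact: history_mark.
apply: measurableT_comp; first exact: measurable_expR.
apply: measurableT_comp => //; apply: measurable_funM => //.
by apply: measurable_funB => //; exact: history_epoch.
Qed.

Lemma measurable_gprod g t : 0 <= t -> measurable_fun setT g ->
  measurable_fun setT (gprod g t).
Proof.
by move=> t0 mg; apply: (sigma_measurable_fun (history_sub t0)); exact: history_gprod.
Qed.

Lemma measurable_mass t : 0 <= t -> measurable_fun setT (mass t).
Proof.
by move=> t0; apply: (sigma_measurable_fun (history_sub t0)); exact: history_mass.
Qed.

End queue.

Lemma indic_bool (T : Type) (R : pzRingType) (b : T -> bool) w :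
  \1_[set x | b x] w = (b w)%:R :> R.
Proof. by rewrite indicE; congr (_%:R); congr nat_of_bool; apply/idP/idP; rewrite inE. Qed.

(** * Independence of the next mark from the past *)

Section marks.
Context d (T : measurableType d) (R : realType) (P : probability T R).
Variables (lambda a : R) (nu : probability R R) (sf : R -> R).
Variable Q : hawkes_queue P lambda nu (exp_decay a) sf.

Local Notation M := (hq_count Q).
Local Notation tau := (hq_epoch Q).
Local Notation B := (hq_mark Q).
Local Notation pmark := (pmark Q).

(** The generators of the sigma-algebra in [hq_mark_past]: the k-th epoch is included, the k-th mark
    is not. *)
Definition past (k : nat) : set (set T) :=
  sigma_gen [set j | (j <= k)%N] tau `|` sigma_gen [set j | (j < k)%N] B.

Lemma past_epoch k j : (j <= k)%N -> sigma_measurable (past k) (tau j).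
Proof.
move=> jk _ U mU; rewrite setTI; apply: sub_sigma_algebra; left.
by apply: sub_sigma_algebra; exists j => //; exists U => //; rewrite setTI.
Qed.

Lemma past_mark k j : (j < k)%N -> sigma_measurable (past k) (B j).
Proof.
move=> jk _ U mU; rewrite setTI; apply: sub_sigma_algebra; right.
by apply: sub_sigma_algebra; exists j => //; exists U => //; rewrite setTI.
Qed.

Lemma past_sub k : past k `<=` measurable.
Proof.
have sub (D : set nat) (X : nat -> {RV P >-> R}) : sigma_gen D X `<=` measurable.
  move=> A; apply: smallest_sub; first exact: sigma_algebra_measurable.
  by move=> C [i _ [U mU <-]]; exact: measurable_funPT.
by move=> A [|]; exact: sub.
Qed.

Lemma past_superlevel k (Y : T -> R) c : sigma_measurable (past k) Y ->
  <<s past k >> [set w | c <= Y w].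
Proof.
move=> mY; have := mY measurableT `[c, +oo[%classic (measurable_itv _).
rewrite setTI => h; congr (<<s _ >> _) : h.
by apply/seteqP; split=> w /=; rewrite in_itv/= andbT.
Qed.

Lemma mark_superlevel k (phi : R -> R) c : measurable_fun setT phi ->
  sigma_gen [set k] B [set w | c <= phi (pmark k w)].
Proof.
move=> mphi; apply: sub_sigma_algebra; exists k => //.
have mphi' : measurable_fun setT (fun x : R => phi (Num.max 0 x)).
  by apply: measurableT_comp => //; exact: measurable_maxr.
exists [set x : R | c <= phi (Num.max 0 x)]; first exact: measurable_superlevel.
by rewrite setTI.
Qed.

Lemma Ex_mark k (phi : R -> R) : measurable_fun setT phi ->
  (forall x, 0 <= phi x <= 1) ->
  Ex P (fun w => phi (pmark k w)) = Ex nu (fun x : R => phi (Num.max 0 x)).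
Proof.
move=> mphi phi01.
have mphi' : measurable_fun setT (fun x : R => phi (Num.max 0 x)).
  by apply: measurableT_comp => //; exact: measurable_maxr.
rewrite /Ex /Rintegral; congr fine.
rewrite (eq_measure_integral (distribution P (B k))); last first.
  by move=> A mA _; symmetry; exact: (hq_mark_law Q).
rewrite ge0_integral_distribution//; first exact/measurable_EFinP.
by move=> x; rewrite lee_fin; have /andP[] := phi01 (Num.max 0 x).
Qed.

Definition arrival_within (t D : R) : set T := [set w | (M t w < M (t + D) w)%N].

Lemma measurable_stop t D : 0 <= t -> 0 <= D -> measurable (arrival_within t D).
Proof.
move=> t0 D0; have tD : 0 <= t + D by rewrite addr_ge0.
rewrite -[arrival_within _ _]setTI.
exact: measurable_fun_ltn (measurable_count Q t0) (measurable_count Q tD) measurableT [set true] _.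
Qed.

Variables (c0 c1 : R) (g phi : R -> R) (t D : R).
Hypotheses (c00 : 0 <= c0) (c10 : 0 <= c1).
Hypotheses (mg : measurable_fun setT g) (g01 : forall x, 0 <= g x <= 1).
Hypotheses (mphi : measurable_fun setT phi) (phi01 : forall x, 0 <= phi x <= 1).
Hypotheses (t0 : 0 <= t) (D0 : 0 <= D).

(** The coefficients are free so that the functional at time t and its prolongation to t + D in the
    absence of arrivals are two instances of one formula. *)
Definition tilt (c0 c1 : R) (g : R -> R) (t : R) w : R :=
  expR (- (c0 + c1 * mass Q t w)) * gprod Q g t w.

Lemma gprod01 w : 0 <= gprod Q g t w <= 1.
Proof.
apply/andP; split; first by apply: prodr_ge0 => i _; have /andP[] := g01 (tau i w).
by apply: prodr_ile1 => i _; exact: g01.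
Qed.

Lemma tilt01 w : 0 <= tilt c0 c1 g t w <= 1.
Proof.
have /andP[p0 p1] := gprod01 w.
rewrite /tilt mulr_ge0 ?expR_ge0//= mulr_ile1 ?expR_ge0// -expR0 ler_expR oppr_le0.
by rewrite addr_ge0// mulr_ge0// mass_ge0.
Qed.

Lemma measurable_tilt : measurable_fun setT (tilt c0 c1 g t).
Proof.
apply: measurable_funM; last exact: measurable_gprod.
apply: measurableT_comp; first exact: measurable_expR.
apply: measurableT_comp => //; apply: measurable_funD => //.
by apply: measurable_funM => //; exact: measurable_mass.
Qed.

Lemma history_tilt : sigma_measurable (history Q t) (tilt c0 c1 g t).
Proof.
apply: measurable_funM; last exact: history_gprod.
apply: measurableT_comp; first exact: measurable_expR.
apply: measurableT_comp => //; apply: measurable_funD => //.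
by apply: measurable_funM => //; exact: history_mass.
Qed.

(** Fixing the number k of arrivals up to t gives the next mark the deterministic index k, the only
    kind of index that [hq_mark_past] speaks about. *)
Definition level_stop (k : nat) : set T := [set w | M t w == k] `&` arrival_within t D.

Lemma level_stopE k : level_stop k =
  [set w | (k == 0%N) || (tau k.-1 w <= t)] `&` [set w | t < tau k w] `&`
  [set w | tau k w <= t + D].
Proof.
have tD : 0 <= t + D by rewrite addr_ge0.
apply/seteqP; split => w; rewrite /level_stop /arrival_within /= => -[].
  by move=> e; have := e; rewrite eq_count// => /andP[-> ->]; rewrite (eqP e) countE.
move=> [h1 h2]; have e : M t w == k by rewrite eq_count// h1 h2.
by rewrite e (eqP e) countE.
Qed.

(** Agrees with [tilt] when exactly k arrivals have occurred, but involves only epochs and marks of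
    index below k; this makes it measurable for [past k], whereas [tilt] runs up to the random
    [M t w]. *)
Definition level_tilt (k : nat) w : R :=
  expR (- (c0 + c1 * \sum_(i < k) (pmark i w * expR (- (a * (t - tau i w)))))) *
  \prod_(i < k) g (tau i w).

(** By [level_stopE] only the epochs k - 1 and k matter. The inequality tau_k <= t + D is the reason
    why the past of a mark has to contain its own epoch. *)
Lemma past_level_stop k : <<s past k >> (level_stop k).
Proof.
have mt j (A : set R) : (j <= k)%N -> measurable A ->
    @measurable _ (g_sigma_algebraType (past k)) (tau j @^-1` A).
  by move=> jk mA; rewrite -[X in measurable X]setTI; exact: past_epoch.
rewrite level_stopE; apply: (@measurableI _ (g_sigma_algebraType (past k))).
  apply: (@measurableI _ (g_sigma_algebraType (past k))).
    case: k mt => [|k] mt.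
      have -> : [set w : T | (0 == 0)%N || (tau 0%N.-1 w <= t)] = setT by apply/seteqP; split.
      exact: (@measurableT _ (g_sigma_algebraType (past 0))).
    have := mt k `]-oo, t]%classic (leqnSn k) (measurable_itv _).
    by congr measurable; apply/seteqP; split => w /=; rewrite in_itv.
  have := mt k `]t, +oo[%classic (leqnn k) (measurable_itv _).
  by congr measurable; apply/seteqP; split => w /=; rewrite in_itv/= andbT.
have := mt k `]-oo, t + D]%classic (leqnn k) (measurable_itv _).
by congr measurable; apply/seteqP; split => w /=; rewrite in_itv.
Qed.

Lemma past_level_tilt k : sigma_measurable (past k) (fun w => level_tilt k w * \1_(level_stop k) w).
Proof.
apply: measurable_funM; last first.
  apply: (@measurable_indic _ (g_sigma_algebraType (past k))); exact: past_level_stop.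
apply: measurable_funM.
  apply: measurableT_comp; first exact: measurable_expR.
  apply: measurableT_comp => //; apply: measurable_funD => //.
  apply: measurable_funM => //.
  have : forall n, (n <= k)%N -> sigma_measurable (past k)
      (fun w => \sum_(i < n) (pmark i w * expR (- (a * (t - tau i w))))).
    elim=> [_|n IHn nk].
      rewrite [X in sigma_measurable _ X](_ : _ = cst 0); first exact: measurable_cst.
      by apply/funext => w; rewrite big_ord0.
    rewrite [X in sigma_measurable _ X](_ : _ = fun w => \sum_(i < n) (pmark i w * expR (- (a * (t - tau i w))))
      + (pmark n w * expR (- (a * (t - tau n w))))); last first.
      by apply/funext => w; rewrite big_ord_recr.
    apply: measurable_funD; first exact: IHn (ltnW nk).
    apply: measurable_funM; first by apply: measurable_maxr => //; exact: past_mark.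
    apply: measurableT_comp; first exact: measurable_expR.
    apply: measurableT_comp => //; apply: measurable_funM => //.
    by apply: measurable_funB => //; apply: past_epoch; exact: ltnW.
  exact.
have : forall n, (n <= k)%N -> sigma_measurable (past k) (fun w => \prod_(i < n) g (tau i w)).
  elim=> [_|n IHn nk].
    rewrite [X in sigma_measurable _ X](_ : _ = cst 1); first exact: measurable_cst.
      by apply/funext => w; rewrite big_ord0.
  rewrite [X in sigma_measurable _ X](_ : _ = fun w => \prod_(i < n) g (tau i w) * g (tau n w)); last first.
    by apply/funext => w; rewrite big_ord_recr.
  apply: measurable_funM; first exact: IHn (ltnW nk).
  by apply: measurableT_comp => //; apply: past_epoch; exact: ltnW.
exact.
Qed.

Lemma level_tiltE k w : level_tilt k w * \1_(level_stop k) w =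
  tilt c0 c1 g t w * \1_(level_stop k) w.
Proof.
rewrite indicE; case: (boolP (w \in _)) => [|_]; last by rewrite !mulr0.
by rewrite inE => -[/= /eqP e _]; rewrite /level_tilt /tilt /mass /gprod e.
Qed.

Lemma Ex_level k :
  Ex P (fun w => tilt c0 c1 g t w * \1_(level_stop k) w * phi (pmark k w)) =
  Ex P (fun w => tilt c0 c1 g t w * \1_(level_stop k) w) *
  Ex nu (fun x : R => phi (Num.max 0 x)).
Proof.
pose Y w := tilt c0 c1 g t w * \1_(level_stop k) w.
have mY : sigma_measurable (past k) Y.
  rewrite (_ : Y = fun w => level_tilt k w * \1_(level_stop k) w); first exact: past_level_tilt.
  by apply/funext => w; rewrite level_tiltE.
have Y01 w : 0 <= Y w <= 1.
  have /andP[u0 u1] := tilt01 w; rewrite /Y indicE.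
  by case: (_ \in _); rewrite ?mulr1 ?mulr0 ?u0 ?u1// lexx ler01.
rewrite -(Ex_mark k mphi phi01).
apply: (@Ex_mul_indep _ _ _ P Y (fun w => phi (pmark k w))) => //.
- exact: sigma_measurable_fun (@past_sub k) mY.
- by apply: measurableT_comp => //; apply: measurable_maxr => //; exact: measurable_mark.
- move=> c c'; rewrite setIC muleC.
  exact: (hq_mark_past (mark_superlevel c' mphi) (past_superlevel c mY)).
Qed.

Lemma sum_level n w :
  \sum_(k < n) tilt c0 c1 g t w * \1_(level_stop k) w * phi (pmark k w) =
  (M t w < n)%N%:R * (tilt c0 c1 g t w * \1_(arrival_within t D) w * phi (pmark (M t w) w)).
Proof.
elim: n => [|n IHn]; first by rewrite big_ord0 ltn0 mul0r.
rewrite big_ord_recr/= IHn ltnS [in RHS]leq_eqVlt.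
have -> : \1_(level_stop n) w = (M t w == n)%:R * \1_(arrival_within t D) w :> R.
  by rewrite /level_stop indicI/= indic_bool.
have [->|_] := eqVneq (M t w) n; first by rewrite ltnn /= ?mulr1n ?mulr0n; ring.
by rewrite /= ?mulr1n ?mulr0n; ring.
Qed.

(** The events [level_stop k] partition [arrival_within t D]; [Ex_level] is summed over k and the
    common factor, the mean of phi under the mark law, is taken out. *)
Lemma Ex_next_mark :
  Ex P (fun w => tilt c0 c1 g t w * \1_(arrival_within t D) w * phi (pmark (M t w) w)) =
  Ex P (fun w => tilt c0 c1 g t w * \1_(arrival_within t D) w) *
  Ex nu (fun x : R => phi (Num.max 0 x)).
Proof.
have mS : measurable (arrival_within t D) by exact: measurable_stop.
have mL k : measurable (level_stop k).
  apply: measurableI => //; rewrite (_ : [set w | _] = M t @^-1` [set k]).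
    by rewrite -[X in measurable X]setTI; exact: measurable_count.
  by apply/seteqP; split => w /= /eqP.
have ind01 (A : set T) w : 0 <= (\1_A w : R) <= 1.
  by rewrite indicE; case: (_ \in _); rewrite lexx ler01.
have mT := measurable_tilt.
have mB k : measurable_fun setT (fun w => phi (pmark k w)).
  by apply: measurableT_comp => //; apply: measurable_maxr => //; exact: measurable_mark.
pose F k w := tilt c0 c1 g t w * \1_(level_stop k) w.
have F01 k w : 0 <= F k w <= 1.
  have /andP[? ?] := tilt01 w; have /andP[? ?] := ind01 (level_stop k) w.
  by rewrite /F mulr_ge0// mulr_ile1.
have mF k : measurable_fun setT (F k) by exact: measurable_funM.
have iF k : Li P (F k).
  apply: (@Li_bounded _ _ _ _ _ 1) => // w.
  by have /andP[? ?] := F01 k w; rewrite ger0_norm.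
have iFB k : Li P (fun w => F k w * phi (pmark k w)).
  apply: (@LiM _ _ _ _ _ _ 1) => // w.
  by have /andP[? ?] := phi01 (pmark k w); rewrite ger0_norm.
(* The partial sum over k < n is the restriction to the event [M t w < n], so both series converge
   by dominated convergence. *)
have lim (h : nat -> T -> R) (H : T -> R) : (forall k, Li P (h k)) ->
    (forall n w, \sum_(k < n) h k w = (M t w < n)%N%:R * H w) ->
    (forall w, 0 <= H w <= 1) ->
    \sum_(k < n) Ex P (h k) @[n --> \oo] --> Ex P H.
  move=> ih hH H01.
  rewrite (_ : (fun n => _) = fun n => Ex P (fun w => (M t w < n)%N%:R * H w)); last first.
    apply/funext => n; rewrite -Ex_sum//; apply: eq_Ex => w; exact: hH.
  have mh n : measurable_fun setT (fun w => (M t w < n)%N%:R * H w).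
    apply: Li_meas; have := Li_sum n ih; congr (Li P _).
    by apply/funext => w; exact: hH.
  have cvH w : (M t w < n)%N%:R * H w @[n --> \oo] --> H w.
    by apply: cvg_near_cst; exists (M t w).+1 => // n /= ->; rewrite mul1r.
  apply: (@Ex_dct _ _ _ _ (fun n w => (M t w < n)%N%:R * H w) H (fun=> 1)) => //.
  - by apply: (@measurable_fun_cvg _ _ _ _ (fun n w => (M t w < n)%N%:R * H w)) => // w _.
  - exact: Li_cst.
  - move=> n w; have /andP[? ?] := H01 w.
    by case: (_ < _)%N; rewrite ?mul1r ?mul0r ?normr0 ?ler01// ger0_norm.
have L1 := lim (fun k w => F k w * phi (pmark k w)) _ iFB sum_level.
have sumF n w : \sum_(k < n) F k w = (M t w < n)%N%:R * (tilt c0 c1 g t w * \1_(arrival_within t D) w).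
  elim: n => [|n IHn]; first by rewrite big_ord0 ltn0 mul0r.
  rewrite big_ord_recr/= IHn ltnS [in RHS]leq_eqVlt /F.
  have -> : \1_(level_stop n) w = (M t w == n)%:R * \1_(arrival_within t D) w :> R.
    by rewrite /level_stop indicI/= indic_bool.
  have [->|_] := eqVneq (M t w) n; first by rewrite ltnn /= ?mulr1n ?mulr0n; ring.
  by rewrite /= ?mulr1n ?mulr0n; ring.
have TS01 w : 0 <= tilt c0 c1 g t w * \1_(arrival_within t D) w <= 1.
  have /andP[? ?] := tilt01 w; have /andP[? ?] := ind01 (arrival_within t D) w.
  by rewrite mulr_ge0// mulr_ile1.
have L2 := lim F _ iF sumF TS01.
have /L1 {}L1 : forall w, 0 <= tilt c0 c1 g t w * \1_(arrival_within t D) w * phi (pmark (M t w) w) <= 1.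
  move=> w; have /andP[? ?] := TS01 w; have /andP[? ?] := phi01 (pmark (M t w) w).
  by rewrite mulr_ge0// mulr_ile1.
have := cvgM L2 (cvg_cst (Ex nu (fun x : R => phi (Num.max 0 x)))).
rewrite (_ : _ \* _ = fun n => \sum_(k < n) Ex P (fun w => F k w * phi (pmark k w))).
  by move=> /(_ _ _) L3; rewrite -(cvg_lim (@Rhausdorff R) L1) -(cvg_lim (@Rhausdorff R) L3).
apply/funext => n /=.
by rewrite mulr_suml; apply: eq_bigr => k _; rewrite Ex_level.
Qed.

End marks.

(** * Intensity and probability of an arrival *)

Section intensity.
Context d (T : measurableType d) (R : realType) (P : probability T R).
Variables (lambda a : R) (nu : probability R R) (sf : R -> R).
Variable Q : hawkes_queue P lambda nu (exp_decay a) sf.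
Hypotheses (lambda0 : 0 <= lambda) (a0 : 0 <= a).
Hypothesis nu_gt0 : nu `]0, +oo[%classic = 1%E.

Local Notation M := (hq_count Q).
Local Notation tau := (hq_epoch Q).
Local Notation B := (hq_mark Q).
Local Notation pmark := (pmark Q).
Local Notation mass := (mass Q).
Local Notation arrival_within := (arrival_within Q).
Local Notation Lam := (hawkes_intensity lambda (exp_decay a) M tau B).

Definition pos_intensity t w : R :=
  lambda + \sum_(i < M t w | tau i w < t) pmark i w * exp_decay a (t - tau i w).

Lemma ae_mark : {ae P, forall w, forall i, B i w = pmark i w}.
Proof.
pose N i := B i @^-1` `]-oo, 0]%classic.
have mN i : measurable (N i).
  by rewrite -[N i]setTI; exact: measurable_mark.
have N0 i : P (N i) = 0%E.
  have -> : P (N i) = distribution P (B i) `]-oo, 0]%classic by [].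
  rewrite (hq_mark_law Q)//.
  have -> : `]-oo, 0]%classic = ~` `]0, +oo[%classic :> set R by rewrite setCitvr.
  by rewrite probability_setC// nu_gt0 subee.
apply: (@negligibleS _ _ _ _ (\bigcup_i N i)).
  move=> w /= /existsNP[i h]; exists i => //; rewrite /N /= in_itv/= leNgt.
  by apply/negP => B0; apply: h; rewrite /pmark max_r// ltW.
by apply: negligible_bigcup => i; apply/negligibleP; [exact: mN|exact: N0].
Qed.

Lemma measurable_intensity_gen (b : nat -> T -> R) t : 0 <= t ->
  (forall i, measurable_fun setT (b i)) ->
  measurable_fun setT (fun w => lambda +
    \sum_(i < M t w | tau i w < t) b i w * exp_decay a (t - tau i w)).
Proof.
move=> t0 mb; apply: measurable_funD => //.
rewrite (_ : (fun w => _) = fun w => \sum_(i < M t w)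
    (if tau i w < t then b i w * exp_decay a (t - tau i w) else 0)); last first.
  by apply/funext => w; rewrite big_mkcond.
apply: (@measurable_rand_sum _ T R (M t)
  (fun i w => if tau i w < t then b i w * exp_decay a (t - tau i w) else 0)) => i.
apply: measurable_guard => [j||]; [exact: measurable_count_lt| |exact: measurable_cst].
apply: measurable_fun_ifT => //.
  by apply: measurable_fun_ltr => //; exact: measurable_epoch.
rewrite /exp_decay.
apply: measurable_funM => //; apply: measurableT_comp; first exact: measurable_expR.
apply: measurableT_comp => //; apply: measurable_funM => //.
by apply: measurable_funB => //; exact: measurable_epoch.
Qed.

Lemma measurable_intensity t : 0 <= t -> measurable_fun setT (Lam t).
Proof. by move=> t0; apply: measurable_intensity_gen => // i; exact: measurable_mark. Qed.

Lemma measurable_pmark i : measurable_fun setT (pmark i).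
Proof. by apply: measurable_maxr => //; exact: measurable_mark. Qed.

Lemma measurable_pintensity t : 0 <= t -> measurable_fun setT (pos_intensity t).
Proof. by move=> t0; apply: measurable_intensity_gen => // i; exact: measurable_pmark. Qed.

Lemma ae_intensity t : {ae P, forall w, Lam t w = pos_intensity t w}.
Proof.
apply: filterS ae_mark => w h; congr (_ + _).
by apply: eq_bigr => i _; rewrite -h.
Qed.

(** Also the source of integrability: [p] is integrable and [p - b] has finite absolute mean for
    small D, hence [b] is integrable. For the no-arrival expansion this says that the intensity has
    a finite mean. *)
Lemma expansion_Ex (E : R -> R -> set T) (b : R -> R -> T -> R) (H eps : R) :
  cond_prob_expansion P (hawkes_filtration M B) E b ->
  (forall t D, 0 <= t -> 0 < D -> measurable_fun setT (b t D)) -> 0 < eps ->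
  exists p, (forall t D, 0 <= t -> 0 < D ->
      is_cond_prob P (hawkes_filtration M B t) (E t D) (p t D)) /\
    exists2 D0, 0 < D0 & forall D, 0 < D <= D0 -> forall t, 0 <= t <= H ->
    [/\ Li P (p t D), Li P (b t D) &
        Ex P (fun w => `|p t D w - b t D w|) <= eps * D].
Proof.
move=> [p [hp hpb]] mb e0; exists p; split=> //.
have [D1 /= D10 hD] := hpb H eps e0.
exists (D1 / 2); first by rewrite divr_gt0.
move=> D /andP[Dp DD] t /andP[t0 tH].
have [mp ip _] := hp t D t0 Dp.
have hE : (\int[P]_w (`|p t D w - b t D w|)%:E <= (eps * D)%:E)%E.
  apply: hD => //=; last by rewrite t0.
  by rewrite sub0r normrN gtr0_norm// (le_lt_trans DD)// gtr_pMr// invf_lt1 ?ltr1n.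
have mpb : measurable_fun setT (fun w => p t D w - b t D w).
  by apply: measurable_funB; [exact: Li_meas ip|exact: mb].
have ipb : Li P (fun w => p t D w - b t D w).
  apply/integrableP; split; first exact/measurable_EFinP.
  by apply: le_lt_trans hE _; rewrite ltry.
split=> //.
  have -> : b t D = fun w => p t D w - (p t D w - b t D w).
    by apply/funext => w; ring.
  exact: LiB.
by rewrite -lee_fin ExE//; exact: Li_norm.
Qed.

Lemma expansion_prob (E : R -> R -> set T) (b : R -> R -> T -> R) (H eps : R) :
  cond_prob_expansion P (hawkes_filtration M B) E b ->
  (forall t D, 0 <= t -> 0 < D -> measurable_fun setT (b t D)) ->
  (forall t D, 0 <= t -> 0 < D -> measurable (E t D)) -> 0 < eps ->
  exists2 D0, 0 < D0 & forall D, 0 < D <= D0 -> forall t, 0 <= t <= H ->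
    Li P (b t D) /\ forall U, sigma_measurable (history Q t) U -> (forall w, 0 <= U w <= 1) ->
      `|Ex P (fun w => U w * \1_(E t D) w) - Ex P (fun w => b t D w * U w)| <= eps * D.
Proof.
move=> hE mb mE e0; have [p [hp [D0 D00 hD]]] := expansion_Ex H hE mb e0.
exists D0 => // D DD t tH; have [ip ib hpb] := hD D DD t tH; split=> // U hU U01.
have t0 : 0 <= t by case/andP : tH.
have D1 : 0 < D by case/andP : DD.
have [_ _ hpA] := hp t D t0 D1.
have mU : measurable_fun setT U by exact: sigma_measurable_fun (history_sub t0) hU.
have U1 w : `|U w| <= 1 by have /andP[? ?] := U01 w; rewrite ger0_norm.
have mEt := mE t D t0 D1.
have ipE : Li P (fun w => p t D w - \1_(E t D) w) by apply: LiB => //; exact: Li_indic.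
(* The defect of the conditional probability has mean zero on every event of the history, in
   particular on the superlevel sets of [U]. *)
have e1 : Ex P (fun w => (p t D w - \1_(E t D) w) * U w) = 0 * Ex P U.
  apply: Ex_layer => // c; rewrite mul0r.
  set A := [set w | _].
  have mA : measurable A by exact: measurable_superlevel.
  have hA : <<s history Q t >> A.
    have := hU measurableT `[c, +oo[%classic (measurable_itv _).
    rewrite setTI => h; congr (<<s _ >> _) : h.
    by apply/seteqP; split=> w /=; rewrite in_itv/= andbT.
  have ipA : Li P (fun w => p t D w * \1_A w).
    apply: (@LiM _ _ _ _ _ _ 1) => // w.
    by rewrite indicE; case: (_ \in _); rewrite ?normr1 ?normr0.
  rewrite (@eq_Ex _ _ _ _ _ (fun w => p t D w * \1_A w - \1_(A `&` E t D) w)); last first.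
    by move=> w; rewrite mulrBl indicI/= (mulrC (\1_A w)).
  rewrite ExB//; last by apply: Li_indic; exact: measurableI.
  apply/eqP; rewrite subr_eq0 Ex_indic; last exact: measurableI.
  rewrite -(hpA _ hA) /Ex /Rintegral; apply/eqP; congr fine.
  rewrite [RHS]integral_mkcond; apply: eq_integral => w _.
  by rewrite patchE indicE; case: (_ \in _); rewrite ?mulr1 ?mulr0.
have iUE : Li P (fun w => U w * \1_(E t D) w).
  have -> : (fun w => U w * \1_(E t D) w) = (fun w => \1_(E t D) w * U w).
    by apply/funext => w; rewrite mulrC.
  by apply: LiM mU U1 _; exact: Li_indic.
have ipU := LiM mU U1 ip; have ibU := LiM mU U1 ib.
have -> : Ex P (fun w => U w * \1_(E t D) w) = Ex P (fun w => p t D w * U w).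
  apply/eqP; rewrite -subr_eq0 -ExB// -oppr_eq0; apply/eqP; rewrite -[RHS](mul0r (Ex P U)) -e1.
  rewrite -mulN1r -ExZ; last exact: LiB.
  by apply: eq_Ex => w; ring.
rewrite -ExB//; apply: le_trans (ler_norm_Ex (LiB ipU ibU)) _.
apply: le_trans hpb; apply: le_Ex.
- by apply: Li_norm; exact: LiB.
- by apply: Li_norm; exact: LiB.
- by move=> w; rewrite -mulrBl normrM ler_piMr.
Qed.

Definition still t D : set T := [set w | M (t + D) w = M t w].

Lemma measurable_still t D : 0 <= t -> 0 < D -> measurable (still t D).
Proof.
move=> t0 D0; have tD : 0 <= t + D by rewrite addr_ge0// ltW.
rewrite (_ : still t D = [set w | M (t + D) w == M t w]); last first.
  by apply/seteqP; split => w /eqP.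
rewrite -[X in measurable X]setTI.
exact: measurable_fun_eqn (measurable_count Q tD) (measurable_count Q t0) measurableT [set true] _.
Qed.

Lemma indic_stop t D w : 0 <= t -> 0 <= D -> \1_(arrival_within t D) w = 1 - \1_(still t D) w :> R.
Proof.
move=> t0 D0; rewrite indic_bool (_ : still t D = [set w | M (t + D) w == M t w]); last first.
  by apply/seteqP; split => x /eqP.
rewrite indic_bool.
have : (M t w <= M (t + D) w)%N by rewrite count_le// lerDl.
by rewrite leq_eqVlt eq_sym; case: eqVneq => [->|_ /= ->]; rewrite ?ltnn ?subrr ?subr0.
Qed.

Lemma measurable_rate t D : 0 <= t -> 0 < D ->
  measurable_fun setT (fun w => 1 - Lam t w * D).
Proof.
move=> t0 _; apply: measurable_funB => //; apply: measurable_funM => //.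
exact: measurable_intensity.
Qed.

Lemma Li_pintensity t : 0 <= t -> Li P (pos_intensity t).
Proof.
move=> t0.
have [p [_ [D0 D00 hD]]] := expansion_Ex t (hq_no_arrival Q) measurable_rate (@ltr01 R).
have DD : 0 < D0 <= D0 by rewrite D00 lexx.
have tt : 0 <= t <= t by rewrite t0 lexx.
have [_ ib _] := hD D0 DD t tt.
have iL : Li P (Lam t).
  have -> : Lam t = fun w => D0^-1 * (1 - (1 - Lam t w * D0)).
    by apply/funext => w; field; rewrite gt_eqF.
  by apply: LiZ; apply: LiB => //; exact: Li_cst.
by have [] := Ex_ae iL (measurable_pintensity t0) (ae_intensity t).
Qed.

(** The undiscounted marks dominate the intensity at all times up to [H] simultaneously. *)
Definition bound (H : R) w : R := lambda + \sum_(i < M H w) pmark i w.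

Lemma bound_ge0 H w : 0 <= bound H w.
Proof. by rewrite addr_ge0// sumr_ge0// => i _; exact: pmark_ge0. Qed.

Lemma sum_count_le (s t : R) w (F : nat -> R) : 0 <= s -> s <= t ->
  (forall i, 0 <= F i) -> \sum_(i < M s w) F i <= \sum_(i < M t w) F i.
Proof.
move=> s0 st F0; rewrite (big_ord_widen _ _ (count_le Q w s0 st)) big_mkcond.
by apply: ler_sum => i _; case: ifP.
Qed.

(** In the intensity at time H + 1 each mark that arrived by [H] still has weight at least e^(-a (H
    + 1)), so the sum of these marks is at most a constant times an integrable variable. The extra
    unit of time makes tau_i < H + 1 strict. *)
Lemma Li_bound H : 0 <= H -> Li P (bound H).
Proof.
move=> H0; have H1 : 0 <= H + 1 by rewrite addr_ge0.
pose c := expR (a * (H + 1)).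
apply: (@Li_dom _ _ _ _ _ (fun w => lambda + c * (pos_intensity (H + 1) w - lambda))).
- apply: measurable_funD => //.
  apply: (@measurable_rand_sum _ T R (M H) pmark) => i.
  apply: measurable_guard => [j||]; [exact: measurable_count_lt|exact: measurable_pmark|].
  exact: measurable_cst.
- apply: LiD; first exact: Li_cst.
  by apply: LiZ; apply: LiB; [exact: Li_pintensity|exact: Li_cst].
- move=> w; rewrite ger0_norm ?bound_ge0// lerD2l /pos_intensity addrC addKr mulr_sumr.
  have HH : H <= H + 1 by rewrite lerDl.
  rewrite (big_ord_widen _ (fun i => pmark i w) (count_le Q w H0 HH)).
  rewrite big_mkcond [leRHS]big_mkcond/=.
  apply: ler_sum => i _; rewrite countE//.
  have [iH|iH] := leP (tau i w) H; last first.
    by case: ifP => // _; rewrite !mulr_ge0 ?expR_ge0 ?pmark_ge0.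
  rewrite (le_lt_trans iH) ?ltrDl// /exp_decay mulrCA ler_peMr ?pmark_ge0//.
  rewrite -expRD (_ : _ + _ = a * tau i w); last by ring.
  by rewrite -[leLHS]expR0 ler_expR mulr_ge0// ltW// epoch_gt0.
Qed.

Lemma mass_le_bound H t w : 0 <= t -> t <= H -> lambda + mass t w <= bound H w.
Proof.
move=> t0 tH; rewrite lerD2l.
apply: le_trans (@sum_count_le t H w (fun i => pmark i w) t0 tH (fun i => pmark_ge0 Q i w)).
apply: ler_sum => i _; rewrite ler_piMr ?pmark_ge0// -expR0 ler_expR oppr_le0.
by rewrite mulr_ge0// subr_ge0 -countE.
Qed.

Lemma pintensity_le t w : pos_intensity t w <= lambda + mass t w.
Proof.
rewrite lerD2l big_mkcond; apply: ler_sum => i _; case: ifP => // _.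
by rewrite mulr_ge0 ?pmark_ge0 ?expR_ge0.
Qed.

Lemma Li_intensity t : 0 <= t -> Li P (Lam t) /\ Ex P (Lam t) = Ex P (pos_intensity t).
Proof.
move=> t0; have h : {ae P, forall w, pos_intensity t w = Lam t w}.
  by apply: filterS (ae_intensity t) => w ->.
by have [? ->] := Ex_ae (Li_pintensity t0) (measurable_intensity t0) h.
Qed.

(** The no-arrival expansion, tested with the constant 1 and tolerance 1. *)
Lemma stop_bound H : 0 <= H -> exists2 D0, 0 < D0 & forall D, 0 < D <= D0 ->
  forall t, 0 <= t <= H -> Ex P (\1_(arrival_within t D)) <= (1 + Ex P (bound H)) * D.
Proof.
move=> H0.
have [D0 D00 hD] := expansion_prob H (hq_no_arrival Q) measurable_rate measurable_still (@ltr01 R).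
exists D0 => // D DD t tH; have [ib hU] := hD D DD t tH.
have t0 : 0 <= t by case/andP : tH.
have D1 : 0 < D by case/andP : DD.
have /hU : sigma_measurable (history Q t) (fun=> 1 : R) by exact: measurable_cst.
move=> /(_ (fun=> _)).
have -> : Ex P (fun w => 1 * \1_[set w0 | M (t + D) w0 = M t w0] w) = 1 - Ex P (\1_(arrival_within t D)).
  rewrite (@eq_Ex _ _ _ _ _ (fun w => 1 - \1_(arrival_within t D) w)); last first.
    by move=> w; rewrite indic_stop// ?ltW//; rewrite /still; ring.
  rewrite ExB; [by rewrite Ex_cst|exact: Li_cst|].
  by apply: Li_indic; apply: measurable_stop => //; exact: ltW.
have [iL eL] := Li_intensity t0.
have -> : Ex P (fun w => (1 - Lam t w * D) * 1) = 1 - D * Ex P (Lam t).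
  rewrite (@eq_Ex _ _ _ _ _ (fun w => 1 - D * Lam t w)); last by move=> w; ring.
  by rewrite ExB; [rewrite Ex_cst ExZ|exact: Li_cst|exact: LiZ].
rewrite ler01 lexx => /(_ isT); rewrite ler_norml => /andP[h _].
have : Ex P (Lam t) <= Ex P (bound H).
  rewrite eL; apply: le_Ex; [exact: Li_pintensity|exact: Li_bound|] => w.
  apply: le_trans (pintensity_le t w) _; apply: mass_le_bound => //.
  by case/andP : tH.
move=> /(ler_wpM2l (ltW D1)); move: h; rewrite mulrDl !mul1r (mulrC _ D); lra.
Qed.

(** An arrival at t is an arrival in (t - D, t], which has probability O(D). The left end moves with
    D, so the uniformity in t of the expansions is essential here. *)
Lemma ae_epoch_neq t : 0 < t -> {ae P, forall w, forall i, tau i w != t}.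
Proof.
move=> t0; pose N i := [set w | tau i w = t].
have mN i : measurable (N i).
  by rewrite -[N i]setTI; exact: (measurable_epoch Q i measurableT (measurable_set1 t)).
apply: (@negligibleS _ _ _ _ (\bigcup_i N i)).
  by move=> w /= /existsNP[i /negP/negPn/eqP h]; exists i.
apply: negligible_bigcup => i; apply/negligibleP; first exact: mN.
have [D0 D00 hD] := stop_bound (ltW t0).
have c0 : 0 <= 1 + Ex P (bound t).
  by rewrite addr_ge0// Ex_ge0// => w; exact: bound_ge0.
have key D : 0 < D -> D <= D0 -> D <= t -> fine (P (N i)) <= (1 + Ex P (bound t)) * D.
  move=> D1 DD Dt; have tD : 0 <= t - D by rewrite subr_ge0.
  apply: le_trans (hD D _ (t - D) _); rewrite ?D1 ?DD// ?tD ?gerBl ?(ltW D1)//.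
  rewrite -Ex_indic//; apply: le_Ex; [exact: Li_indic| |].
    by apply: Li_indic; apply: measurable_stop => //; exact: ltW.
  move=> w; rewrite !indicE; have [|_] := boolP (w \in N i); last by rewrite ler0n.
  rewrite inE /N /= => e; rewrite mem_set// /arrival_within /= subrK.
  apply: (@leq_ltn_trans i); last by rewrite countE ?(ltW t0)// e.
  by rewrite leqNgt countE// e -ltNge ltrBlDr ltrDl.
have P0 : fine (P (N i)) <= 0.
  apply/ler_addgt0Pl => e e0; rewrite addr0.
  pose D := Num.min (Num.min D0 t) (e / (1 + (1 + Ex P (bound t)))).
  have c1 : 0 < 1 + (1 + Ex P (bound t)) by rewrite ltr_pwDl.
  have Dp : 0 < D by rewrite !lt_min D00 t0 divr_gt0.
  have D1 : D <= D0 by rewrite !ge_min lexx.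
  have D2 : D <= t by rewrite !ge_min lexx orbT.
  apply: le_trans (key D Dp D1 D2) _.
  have : D <= e / (1 + (1 + Ex P (bound t))) by rewrite ge_min lexx orbT.
  rewrite ler_pdivlMr// => h; apply: le_trans h.
  by rewrite [leLHS]mulrC [leRHS]mulrDr mulr1 lerDr ltW.
have e : P (N i) = 0%E; last exact: e.
apply/eqP; rewrite -[P (N i)]fineK ?fin_num_measure// eqe eq_le P0/=.
by rewrite fine_ge0.
Qed.

Lemma ae_intensity_mass t : 0 <= t -> {ae P, forall w, Lam t w = lambda + mass t w}.
Proof.
rewrite le_eqVlt => /predU1P[<-|t0].
  apply: aeW => w; rewrite /hawkes_intensity /mass; congr (_ + _).
  by rewrite !big1// => -[i /= ]; rewrite count0.
apply: filterS2 (ae_epoch_neq t0) (ae_mark) => w ne e; congr (_ + _).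
rewrite (eq_bigl xpredT); last first.
  move=> i /=; rewrite lt_neqAle ne/= -(@countE _ _ _ _ _ _ _ _ Q) ?ltW//.
  by rewrite ltn_ord.
by apply: eq_bigr => i _; rewrite e.
Qed.

(** Obtained by complement from the no-arrival expansion, because [arrival_within] also contains the
    multiple arrivals. *)
Lemma stop_rate H eps : 0 <= H -> 0 < eps -> exists2 D0, 0 < D0 &
  forall D, 0 < D <= D0 -> forall t, 0 <= t <= H ->
  forall U, sigma_measurable (history Q t) U -> (forall w, 0 <= U w <= 1) ->
  `|Ex P (fun w => U w * \1_(arrival_within t D) w) -
    D * Ex P (fun w => U w * (lambda + mass t w))| <= eps * D.
Proof.
move=> H0 e0.
have [D0 D00 hD] := expansion_prob H (hq_no_arrival Q) measurable_rate measurable_still e0.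
exists D0 => // D DD t tH U mU U01; have [ib hU] := hD D DD t tH.
have t0 : 0 <= t by case/andP : tH.
have D1 : 0 < D by case/andP : DD.
have mU' : measurable_fun setT U by exact: sigma_measurable_fun (history_sub t0) mU.
have U1 w : `|U w| <= 1 by have /andP[? ?] := U01 w; rewrite ger0_norm.
have iU : Li P U by apply: Li_bounded U1.
have iUS A : measurable A -> Li P (fun w => U w * \1_A w).
  move=> mA; apply: (@LiM _ _ _ _ _ _ 1) => // w.
  by rewrite indicE; case: (_ \in _); rewrite ?normr1 ?normr0.
have [iL _] := Li_intensity t0.
have iLU : Li P (fun w => Lam t w * U w) by exact: LiM iL.
have aeU : {ae P, forall w, Lam t w * U w = U w * (lambda + mass t w)}.
  by apply: filterS (ae_intensity_mass t0) => w ->; rewrite mulrC.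
have mUw : measurable_fun setT (fun w => U w * (lambda + mass t w)).
  by apply: measurable_funM => //; apply: measurable_funD => //; exact: measurable_mass.
have [_ <-] := Ex_ae iLU mUw aeU.
have := hU U mU U01.
have -> : Ex P (fun w => U w * \1_[set w0 | M (t + D) w0 = M t w0] w) =
    Ex P U - Ex P (fun w => U w * \1_(arrival_within t D) w).
  rewrite -ExB//; last by apply: iUS; apply: measurable_stop => //; exact: ltW.
  by apply: eq_Ex => w; rewrite indic_stop// ?ltW//; rewrite /still; ring.
have -> : Ex P (fun w => (1 - Lam t w * D) * U w) = Ex P U - D * Ex P (fun w => Lam t w * U w).
  rewrite -ExZ// -ExB//; last exact: LiZ.
  by apply: eq_Ex => w; ring.
have key (x y z : R) : `|x - y - (x - z)| = `|y - z|.
  by rewrite -normrN; congr (`|_|); ring.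
by rewrite key.
Qed.

End intensity.

(** * Drift of the exponential functional *)

Section exponential_bounds.
Variable R : realType.
Implicit Types h u v : R.

Lemma expRN_bounds h : 0 <= h ->
  [/\ 1 - h <= expR (- h), 0 < expR (- h), expR (- h) <= 1 &
      expR (- h) * (1 + h) <= 1].
Proof.
move=> h0; split; rewrite ?expR_gt0//.
- exact: expR_ge1Dx.
- by rewrite -expR0 ler_expR oppr_le0.
- rewrite expRN ler_pdivrMl ?expR_gt0// mulr1; exact: expR_ge1Dx.
Qed.

Lemma ler_norm_contract (p x y : R) : 0 <= p -> p <= 1 -> `|x| <= y -> `|p * x| <= y.
Proof.
by move=> p0 p1; apply: le_trans; rewrite normrM (ger0_norm p0) ler_piMl.
Qed.

Lemma expRN_lip u v : 0 <= u -> 0 <= v ->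
  `|expR (- v) - expR (- u)| <= Num.min 1 `|v - u|.
Proof.
wlog uv : u v / u <= v.
  move=> H u0 v0; have [uv|/ltW vu] := leP u v; first exact: H.
  by rewrite distrC (distrC v); exact: H.
move=> u0 v0; have h0 : 0 <= v - u by rewrite subr_ge0.
have [h1 h2 h3 _] := expRN_bounds h0; have [_ u2 u3 _] := expRN_bounds u0.
have -> : expR (- v) - expR (- u) = - (expR (- u) * (1 - expR (- (v - u)))).
  by rewrite mulrBr mulr1 -expRD opprB; congr (expR _ - _); ring.
rewrite normrN (ger0_norm h0) ger0_norm ?mulr_ge0 ?subr_ge0 ?(ltW u2)//.
rewrite le_min; apply/andP; split.
  by apply: mulr_ile1; rewrite ?subr_ge0 ?gerBl ?(ltW u2) ?(ltW h2).
by apply: le_trans (_ : 1 - expR (- (v - u)) <= _); [rewrite ler_piMl ?subr_ge0|lra].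
Qed.

(** The remainder is quadratic near the diagonal but grows only linearly, so that one moment of the
    exponent suffices to integrate it. Factoring out the larger exponential leaves a bound in the
    single variable [|v - u|]. *)
Lemma expRN_taylor u v : 0 <= u -> 0 <= v ->
  `|expR (- v) - expR (- u) + expR (- u) * (v - u)| <= `|v - u| * Num.min 1 `|v - u|.
Proof.
move=> u0 v0; have [uv|/ltW vu] := leP u v.
  have h0 : 0 <= v - u by rewrite subr_ge0.
  have [h1 h2 h3 h4] := expRN_bounds h0; have [_ u2 u3 _] := expRN_bounds u0.
  have -> : expR (- v) = expR (- u) * expR (- (v - u)) by rewrite -expRD; congr expR; ring.
  rewrite (ger0_norm h0); set h := v - u in h0 h1 h2 h3 h4 *; set y := expR (- h) in h1 h2 h3 h4 *.
  have -> : expR (- u) * y - expR (- u) + expR (- u) * h = expR (- u) * (y - 1 + h) by ring.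
  have yh : 0 <= y - 1 + h by lra.
  rewrite normrM (ger0_norm yh) ger0_norm ?(ltW u2)//.
  apply: (@le_trans _ _ (y - 1 + h)); first by rewrite ler_piMl.
  rewrite /Num.min; case: ifP => _; first by rewrite mulr1; lra.
  by have : 0 <= h * h by [rewrite mulr_ge0//]; nra.
have h0 : 0 <= u - v by rewrite subr_ge0.
have [h1 h2 h3 h4] := expRN_bounds h0; have [_ u2 u3 _] := expRN_bounds v0.
have -> : expR (- u) = expR (- v) * expR (- (u - v)) by rewrite -expRD; congr expR; ring.
rewrite (distrC v) (ger0_norm h0) (_ : v - u = - (u - v)); last by ring.
set h := u - v in h0 h1 h2 h3 h4 *; set y := expR (- h) in h1 h2 h3 h4 *.
have -> : expR (- v) - expR (- v) * y + expR (- v) * y * - h = expR (- v) * (1 - y * (1 + h)) by ring.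
have yh : 0 <= 1 - y * (1 + h) by lra.
rewrite normrM (ger0_norm yh) ger0_norm ?(ltW u2)//.
apply: (@le_trans _ _ (1 - y * (1 + h))); first by rewrite ler_piMl.
rewrite /Num.min; case: ifP => _; first by rewrite mulr1; nra.
by nra.
Qed.

End exponential_bounds.

(** A discrete substitute for integrating a derivative: over n steps of length H / n the losses add
    up to a quantity that is arbitrarily small. *)
Lemma le_of_increments (R : realType) (f : R -> R) (H : R) : 0 <= H ->
  (forall e, 0 < e -> exists2 D0, 0 < D0 & forall D, 0 < D <= D0 ->
     forall t, 0 <= t -> t + D <= H -> f t - f (t + D) <= e * D) ->
  f 0 <= f H.
Proof.
rewrite le_eqVlt => /predU1P[<-//|H0] h; apply/ler_addgt0Pl => e e0.
have [D0 D00 hD] := h (e / H) (divr_gt0 e0 H0).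
pose n := (Num.truncn (H / D0)).+1.
have n0 : 0 < n%:R :> R by rewrite ltr0n.
have nb : H / D0 < n%:R by apply: truncnS_gt; rewrite divr_ge0// ltW.
pose D := H / n%:R.
have Dp : 0 < D by rewrite divr_gt0.
have DD : D <= D0.
  by rewrite ler_pdivrMr// mulrC -ler_pdivrMr// ltW.
have key k : (k <= n)%N -> f 0 - f (k%:R * D) <= e / H * (k%:R * D).
  elim: k => [_|k IHk kn]; first by rewrite !mul0r mulr0 subrr.
  have kD : k%:R * D + D = k.+1%:R * D by rewrite -natr1; ring.
  have kH : k%:R * D + D <= H.
    by rewrite kD /D mulrA ler_pdivrMr// mulrC ler_wpM2l ?ler_nat// ltW.
  have := hD D _ (k%:R * D) _ kH; rewrite Dp DD => /(_ isT).
  have := IHk (ltnW kn); rewrite -kD => h1 /(_ (mulr_ge0 (ler0n _ _) (ltW Dp))).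
  by rewrite mulrDr; lra.
have := key n (leqnn n); have -> : n%:R * D = H by rewrite /D; field; rewrite gt_eqF.
by rewrite divfK ?gt_eqF//; lra.
Qed.

Section drift.
Context d (T : measurableType d) (R : realType) (P : probability T R).
Variables (lambda a : R) (nu : probability R R) (sf : R -> R).
Variable Q : hawkes_queue P lambda nu (exp_decay a) sf.
Hypotheses (lambda0 : 0 <= lambda) (a0 : 0 <= a).
Hypothesis nu_gt0 : nu `]0, +oo[%classic = 1%E.
Hypothesis nu_int : Li nu (fun x : R => x).

Local Notation M := (hq_count Q).
Local Notation tau := (hq_epoch Q).
Local Notation pmark := (pmark Q).
Local Notation mass := (mass Q).
Local Notation arrival_within := (arrival_within Q).
Local Notation tilt := (tilt Q).

Definition mark_laplace (x : R) : R := Ex nu (fun b : R => expR (- (x * Num.max 0 b))).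

Lemma mass_still t D w : M (t + D) w = M t w ->
  mass (t + D) w = expR (- (a * D)) * mass t w.
Proof.
move=> e; rewrite /mass e mulr_sumr; apply: eq_bigr => i _.
by rewrite mulrCA -expRD; congr (_ * expR _); ring.
Qed.

Lemma tilt_still t D w c0 c1 g : M (t + D) w = M t w ->
  tilt c0 c1 g (t + D) w = tilt c0 (c1 * expR (- (a * D))) g t w.
Proof.
by move=> e; rewrite /tilt mass_still// mulrA /gprod e.
Qed.

(** The discount of the old marks over [t, t + D] goes into the coefficient of [tilt] at t; the new
    factor involves the age t + D - tau of the new mark. Arrivals are numbered from 0, so the new
    one has index [M t w]. *)
Lemma tilt_one t D w c0 c1 g : M (t + D) w = (M t w).+1 ->
  tilt c0 c1 g (t + D) w = tilt c0 (c1 * expR (- (a * D))) g t w *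
   (g (tau (M t w) w) *
    expR (- (c1 * expR (- (a * (t + D - tau (M t w) w))) * pmark (M t w) w))).
Proof.
move=> e; rewrite /tilt /gprod /mass e !big_ord_recr/=.
set p := \prod_(i < _) _; set s := \sum_(i < _) _; set s' := \sum_(i < _) _.
have -> : s = expR (- (a * D)) * s'.
  rewrite /s /s' mulr_sumr; apply: eq_bigr => i _.
  by rewrite mulrCA -expRD; congr (_ * expR _); ring.
rewrite [RHS]mulrACA mulrC -[RHS]mulrA [RHS]mulrCA [LHS]mulrC.
set x := expR _; set y := expR _; set z := expR _.
have -> : x = y * z by rewrite -expRD; congr expR; ring.
by ring.
Qed.

(** Finite Taylor estimates with one common constant [K] take the place of derivatives. Those for
    [al] carry a discount factor because mass x at time t has become x e^(-a D) at t + D; in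
    [al_lip] the time s is the age at t + D of an arrival in between. *)
Variables (H K : R) (g al C beta : R -> R).
Hypotheses (H0 : 0 <= H) (K1 : 1 <= K).
Hypotheses (mg : measurable_fun setT g) (g01 : forall x, 0 <= g x <= 1).
Hypothesis g_lip : forall x y, 0 <= x -> x <= y -> y <= H -> `|g y - g x| <= K * (y - x).
Hypothesis al0 : forall t, 0 <= t <= H -> 0 <= al t.
Hypothesis C0 : forall t, 0 <= t <= H -> 0 <= C t.
Hypothesis beta_bound : forall t, 0 <= t <= H -> `|beta t| <= K.
Hypothesis al_taylor : forall t D, 0 <= t -> 0 < D <= 1 -> t + D <= H ->
  `|al (t + D) * expR (- (a * D)) - al t - D * beta t| <= K * D ^+ 2.
Hypothesis C_taylor : forall t D, 0 <= t -> 0 < D <= 1 -> t + D <= H ->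
  `|C (t + D) - C t - D * beta t| <= K * D ^+ 2.
Hypothesis al_lip : forall t D s, 0 <= t -> 0 < D <= 1 -> t + D <= H -> 0 <= s <= D ->
  `|al (t + D) * expR (- (a * s)) - al t| <= K * D.

(* Here beta = C' = al' - a al, so that the drift of expZ is psi times the mean of
   expZ * (lambda + mass). *)
Definition expZ t w : R := tilt (lambda * C t) (al t) g t w.

(* The value of expZ at time t + D if there is no arrival in between. *)
Definition expU t D w : R :=
  tilt (lambda * C (t + D)) (al (t + D) * expR (- (a * D))) g t w.

(** The factor due to an arrival in (t, t + D], with its epoch replaced by t so that the new mark
    enters through a deterministic function. *)
Definition jump t w : R := g t * expR (- (al t * pmark (M t w) w)).

Definition several_within t D : set T := [set w | ((M t w).+1 < M (t + D) w)%N].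

Lemma min01 (x : R) : 0 <= x -> 0 <= Num.min 1 x <= 1.
Proof. by move=> x0; rewrite le_min ler01 x0/= ge_min lexx. Qed.

Section pointwise.
Variables (t D : R).
Hypotheses (t0 : 0 <= t) (D0 : 0 < D <= 1) (tDH : t + D <= H).

Let tH : 0 <= t <= H.
Proof. by rewrite t0/=; case/andP: D0 => d1 _; apply: le_trans tDH; rewrite lerDl ltW. Qed.

Let tD : 0 <= t + D <= H.
Proof. by rewrite tDH andbT; case/andP: D0 => d1 _; rewrite addr_ge0// ltW. Qed.

Lemma Zt01 w : 0 <= expZ t w <= 1.
Proof. by apply: tilt01 => //; [rewrite mulr_ge0// C0|exact: al0]. Qed.

Lemma Zt01' w : 0 <= expZ (t + D) w <= 1.
Proof. by apply: tilt01 => //; [rewrite mulr_ge0// C0|exact: al0]. Qed.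

Lemma Ut01 w : 0 <= expU t D w <= 1.
Proof. by apply: tilt01 => //; [rewrite mulr_ge0// C0|rewrite mulr_ge0 ?expR_ge0 ?al0]. Qed.

Lemma jump01 w : 0 <= jump t w <= 1.
Proof.
have /andP[g0 g1] := g01 t.
have h : 0 <= al t * pmark (M t w) w by rewrite mulr_ge0 ?al0 ?pmark_ge0.
have [_ /ltW e0 e1 _] := expRN_bounds h.
by rewrite /jump mulr_ge0//= mulr_ile1.
Qed.

Definition remainder w : R :=
  expZ (t + D) w - (expU t D w - expU t D w * \1_(arrival_within t D) w
                  + expU t D w * \1_(arrival_within t D) w * jump t w).

(** Without arrival the remainder vanishes, with several it is at most 1 in absolute value, and with
    exactly one it is controlled by the Lipschitz estimates for [g] and [al]. The minimum keeps the
    function of the mark in [0, 1], as [Ex_next_mark] requires. *)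
Lemma remainder_bound w : `|remainder w| <= \1_(several_within t D) w +
  (K * D + Num.min 1 (K * D * pmark (M t w) w)) * \1_(arrival_within t D) w.
Proof.
have /andP[d0 d1] := D0.
have KD : 0 <= K * D by rewrite mulr_ge0 ?ltW// (lt_le_trans ltr01).
have /andP[m0 m1] : 0 <= Num.min 1 (K * D * pmark (M t w) w) <= 1.
  by apply: min01; rewrite mulr_ge0// pmark_ge0.
have /andP[z0 z1] := Zt01' w; have /andP[u0 u1] := Ut01 w.
have /andP[j0 j1] := jump01 w.
have mono : (M t w <= M (t + D) w)%N by rewrite count_le// lerDl ltW.
rewrite /remainder !indic_bool.
move: mono; rewrite leq_eqVlt => /predU1P[e|lt].
  rewrite -e ltnn ltnNge leqnSn /= !mulr0 mul0r subr0 !addr0.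
  by rewrite /expZ tilt_still// subrr normr0.
rewrite lt /= !mulr1 subrr add0r.
move: (lt); rewrite leq_eqVlt => /predU1P[e|lt2]; last first.
  rewrite lt2 /= ler_norml; apply/andP; split.
    have : expU t D w * jump t w <= 1 by rewrite mulr_ile1.
    lra.
  have : 0 <= expU t D w * jump t w by rewrite mulr_ge0.
  lra.
rewrite -e ltnn /= add0r /expZ tilt_one// -/(expU t D w).
set k := M t w in e lt m0 m1 j0 j1 *.
set x := al (t + D) * _; rewrite -mulrBr normrM (ger0_norm u0).
have tk : t < tau k w by rewrite ltNge -countE// ltnn.
have tk' : tau k w <= t + D by rewrite -countE ?(andP tD).1.
have sD : 0 <= t + D - tau k w <= D by rewrite subr_ge0 tk'/= lerBlDr addrC lerD2l ltW.
have x0 : 0 <= x by rewrite mulr_ge0 ?expR_ge0 ?al0.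
have pk := pmark_ge0 Q k w.
apply: (@le_trans _ _ `|g (tau k w) * expR (- (x * pmark k w)) - jump t w|).
  by rewrite ler_piMl.
rewrite /jump -/k.
have -> : g (tau k w) * expR (- (x * pmark k w)) - g t * expR (- (al t * pmark k w)) =
  (g (tau k w) - g t) * expR (- (x * pmark k w)) +
  g t * (expR (- (x * pmark k w)) - expR (- (al t * pmark k w))) by ring.
apply: le_trans (ler_normD _ _) _; apply: lerD.
  have xp : 0 <= x * pmark k w by rewrite mulr_ge0.
  have [_ /ltW e0 e1 _] := expRN_bounds xp.
  rewrite normrM (ger0_norm e0); apply: (@le_trans _ _ `|g (tau k w) - g t|).
    by rewrite ler_piMr.
  apply: le_trans (g_lip t0 (ltW tk) (le_trans tk' tDH)) _.
  by rewrite ler_wpM2l ?(le_trans ler01)// lerBlDr addrC.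
have /andP[g0 g1] := g01 t.
rewrite normrM (ger0_norm g0).
apply: (@le_trans _ _ `|expR (- (x * pmark k w)) - expR (- (al t * pmark k w))|).
  by rewrite ler_piMl.
apply: le_trans (expRN_lip _ _) _; rewrite ?mulr_ge0 ?al0//.
rewrite le_min !ge_min lexx /=; apply/orP; right.
by rewrite -mulrBl normrM (ger0_norm pk) ler_wpM2r// al_lip.
Qed.

(** [C] and the discounted [al] have the same first-order coefficient [beta], so the background rate
    and the mass combine into the single factor lambda + mass, the intensity. *)
Lemma exponent_bounds w : let u := lambda * C t + al t * mass t w in
  let v := lambda * C (t + D) + al (t + D) * expR (- (a * D)) * mass t w in
  [/\ 0 <= u, 0 <= v,
   `|v - u - D * beta t * (lambda + mass t w)| <= K * D ^+ 2 * bound Q H w &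
   `|v - u| <= 2 * K * D * bound Q H w].
Proof.
move=> u v; have /andP[d0 d1] := D0; have m0 := mass_ge0 Q t w.
have K0 : 0 <= K by rewrite (le_trans ler01).
have wV : lambda + mass t w <= bound Q H w.
  by apply: mass_le_bound => //; case/andP : tH.
have u0 : 0 <= u by rewrite addr_ge0// mulr_ge0 ?al0 ?C0.
have v0 : 0 <= v by rewrite addr_ge0// !mulr_ge0 ?expR_ge0 ?al0 ?C0.
have w0 : 0 <= lambda + mass t w by rewrite addr_ge0.
have h : `|v - u - D * beta t * (lambda + mass t w)| <= K * D ^+ 2 * bound Q H w.
  have -> : v - u - D * beta t * (lambda + mass t w) =
     lambda * (C (t + D) - C t - D * beta t) +
     mass t w * (al (t + D) * expR (- (a * D)) - al t - D * beta t).
    by rewrite /u /v; ring.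
  apply: le_trans (ler_normD _ _) _; rewrite !normrM (ger0_norm lambda0) (ger0_norm m0).
  apply: (@le_trans _ _ (K * D ^+ 2 * (lambda + mass t w))).
    rewrite mulrDr lerD// mulrC ler_wpM2r//; [exact: C_taylor|exact: al_taylor].
  by rewrite ler_wpM2l// mulr_ge0// sqr_ge0.
split=> //.
have -> : v - u = v - u - D * beta t * (lambda + mass t w) + D * beta t * (lambda + mass t w) by ring.
apply: le_trans (ler_normD _ _) _.
have h2 : `|D * beta t * (lambda + mass t w)| <= K * D * bound Q H w.
  rewrite !normrM (ger0_norm w0) (gtr0_norm d0); apply: ler_pM => //.
    by rewrite mulr_ge0// ltW.
  by rewrite mulrC; apply: ler_wpM2r; [exact: ltW|exact: beta_bound].
have V0 : 0 <= bound Q H w by exact: bound_ge0.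
have h3 : K * D ^+ 2 * bound Q H w <= K * D * bound Q H w.
  by rewrite ler_wpM2r// ler_wpM2l// expr2 ler_piMr// ltW.
by move: h h2 h3; lra.
Qed.

Lemma Ut_Zt w : `|expU t D w - expZ t w + expZ t w * (D * beta t * (lambda + mass t w))| <=
  K * D ^+ 2 * bound Q H w + 2 * K * D * (bound Q H w * Num.min 1 (2 * K * D * bound Q H w)).
Proof.
have /= [u0 v0 h1 h2] := exponent_bounds w.
rewrite /expU /expZ /tilt; set u := lambda * C t + _ in u0 h1 h2 *.
set v := lambda * C (t + D) + _ in v0 h1 h2 *.
have /andP[p0 p1] := gprod01 Q t g01 w.
set x := D * beta t * (lambda + mass t w) in h1 *; set G := gprod Q g t w in p0 p1 *.
have -> : expR (- v) * G - expR (- u) * G + expR (- u) * G * x =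
  G * (- (expR (- u) * (v - u - x)) + (expR (- v) - expR (- u) + expR (- u) * (v - u))) by ring.
have [_ /ltW eu0 eu1 _] := expRN_bounds u0.
apply: ler_norm_contract => //.
apply: le_trans (ler_normD _ _) _; apply: lerD.
  rewrite normrN normrM (ger0_norm eu0); apply: le_trans h1.
  by rewrite ler_piMl.
apply: le_trans (expRN_taylor u0 v0) _.
rewrite mulrA; apply: ler_pM => //.
by rewrite le_min !ge_min lexx h2 orbT.
Qed.

Lemma Ut_Zt_lip w : `|expU t D w - expZ t w| <= Num.min 1 (2 * K * D * bound Q H w).
Proof.
have /= [u0 v0 h1 h2] := exponent_bounds w.
have /andP[p0 p1] := gprod01 Q t g01 w.
rewrite /expU /expZ /tilt -mulrBl mulrC.
apply: ler_norm_contract => //.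
apply: le_trans (expRN_lip u0 v0) _.
by rewrite le_min !ge_min lexx h2 orbT.
Qed.

End pointwise.

Lemma several_rate eps : 0 < eps -> exists2 D0, 0 < D0 & forall D, 0 < D <= D0 ->
  forall t, 0 <= t <= H -> Ex P (\1_(several_within t D)) <= eps * D.
Proof.
move=> e0.
have mb (t D : R) : 0 <= t -> 0 < D -> measurable_fun (setT : set T) (fun=> 0 : R).
  by move=> *; exact: measurable_cst.
have mE t D : 0 <= t -> 0 < D -> measurable (several_within t D).
  move=> t0 D0; rewrite -[several_within _ _]setTI.
  have tD : 0 <= t + D by rewrite addr_ge0// ltW.
  have m1 : measurable_fun setT (fun w => (M t w).+1).
    exact: (@measurableT_comp _ _ _ _ _ _ S _ _ _ (measurable_count Q t0)).
  exact: measurable_fun_ltn m1 (measurable_count Q tD) measurableT [set true] _.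
have [D0 D00 hD] := expansion_prob H (hq_several_arrivals Q) mb mE e0.
exists D0 => // D DD t tH; have [ib hU] := hD D DD t tH.
have : sigma_measurable (history Q t) (fun=> 1 : R) by exact: measurable_cst.
have h01 (w : T) : 0 <= (1 : R) <= 1 by rewrite ler01 lexx.
move=> /hU /(_ h01).
rewrite [X in _ - X](_ : _ = 0); last first.
  by rewrite -[RHS](Ex_cst P); apply: eq_Ex => w; rewrite mul0r.
rewrite subr0 => h; apply: le_trans h; apply: le_trans (ler_norm _).
by rewrite [X in _ <= X](_ : _ = Ex P (\1_(several_within t D)))//; apply: eq_Ex => w; rewrite mul1r.
Qed.

Lemma Ex_next_mark_1 (phi : R -> R) t D : measurable_fun setT phi ->
  (forall x, 0 <= phi x <= 1) -> 0 <= t -> 0 <= D ->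
  Ex P (fun w => \1_(arrival_within t D) w * phi (pmark (M t w) w)) =
  Ex P (\1_(arrival_within t D)) * Ex nu (fun x : R => phi (Num.max 0 x)).
Proof.
move=> mphi phi01 t0 D0.
have tilt1 w : tilt 0 0 (fun=> 1) t w = 1.
  by rewrite /tilt mul0r addr0 oppr0 expR0 mul1r /gprod big1.
have g1 (x : R) : 0 <= (1 : R) <= 1 by rewrite ler01 lexx.
have := @Ex_next_mark _ _ _ _ _ _ _ _ Q 0 0 (fun=> 1) phi t D (lexx 0) (lexx 0)
  (measurable_cst _) g1 mphi phi01 t0 D0.
rewrite (@eq_Ex _ _ _ _ _ (fun w => \1_(arrival_within t D) w * phi (pmark (M t w) w))); last first.
  by move=> w; rewrite tilt1 mul1r.
rewrite (_ : Ex P (fun w => tilt 0 0 (fun=> 1) t w * _) = Ex P (\1_(arrival_within t D)))//.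
by apply: eq_Ex => w; rewrite tilt1 mul1r.
Qed.

Lemma Li_indicM (X : T -> R) A : measurable A -> Li P X -> Li P (fun w => X w * \1_A w).
Proof.
move=> mA iX; apply: (@LiM _ _ _ _ _ _ 1) => // w.
by rewrite indicE; case: (_ \in _); rewrite ?normr1 ?normr0.
Qed.

(** A mark with a random index is the difference of two consecutive random sums, to which
    [measurable_rand_sum] applies. *)
Lemma measurable_next_mark t : 0 <= t -> measurable_fun setT (fun w => pmark (M t w) w).
Proof.
move=> t0; have mp i : measurable_fun setT (pmark i) by exact: measurable_pmark.
rewrite (_ : (fun w => _) = fun w => \sum_(i < (M t w).+1) pmark i w - \sum_(i < M t w) pmark i w).
  apply: measurable_funB.
    apply: (@measurable_rand_sum _ T R (fun w => (M t w).+1) pmark) => i.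
    apply: (@measurable_guard _ T R (fun w => (M t w).+1)) => [[|j]||//].
    - by rewrite (_ : [set w | _] = setT)//; apply/seteqP; split.
    - exact: measurable_count_lt.
    - exact: mp.
  apply: (@measurable_rand_sum _ T R (M t) pmark) => i.
  apply: measurable_guard => [j||//]; [exact: measurable_count_lt|exact: mp].
by apply/funext => w; rewrite big_ord_recr/= [X in X - _]addrC addrK.
Qed.

Definition psi t : R := g t * mark_laplace (al t) - 1 - beta t.

Lemma measurable_Zt t : 0 <= t -> measurable_fun setT (expZ t).
Proof. by move=> t0; exact: measurable_tilt. Qed.

(** By independence of the next mark, the one-arrival error is at most K D (1 + E max(0, B)) times
    the probability of an arrival, itself O(D): this is the D^2 term. *)
Lemma Ex_remainder t D eps : 0 <= t -> 0 < D <= 1 -> t + D <= H ->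
  Ex P (\1_(several_within t D)) <= eps * D ->
  Ex P (\1_(arrival_within t D)) <= (1 + Ex P (bound Q H)) * D ->
  Li P (remainder t D) /\ `|Ex P (remainder t D)| <= eps * D +
    K * (1 + Ex nu (fun b : R => Num.max 0 b)) * (1 + Ex P (bound Q H)) * D ^+ 2.
Proof.
move=> t0 DD tDH h1 h2; have /andP[D0 D1] := DD.
have tD : 0 <= t + D by rewrite addr_ge0// ltW.
have KD : 0 <= K * D by rewrite mulr_ge0 ?ltW// (lt_le_trans ltr01).
have mS : measurable (arrival_within t D) by apply: measurable_stop => //; exact: ltW.
have mV : measurable (several_within t D).
  rewrite -[several_within _ _]setTI.
  have m1 : measurable_fun setT (fun w => (M t w).+1).
    exact: (@measurableT_comp _ _ _ _ _ _ S _ _ _ (measurable_count Q t0)).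
  exact: measurable_fun_ltn m1 (measurable_count Q tD) measurableT [set true] _.
have mR : measurable_fun setT (remainder t D).
  have mU : measurable_fun setT (expU t D) by exact: measurable_tilt.
  have mUS : measurable_fun setT (fun w => expU t D w * \1_(arrival_within t D) w).
    by apply: measurable_funM.
  apply: measurable_funB; first exact: measurable_Zt.
  apply: measurable_funD; first exact: measurable_funB.
  apply: measurable_funM => //; apply: measurable_funM => //.
  apply: measurableT_comp; first exact: measurable_expR.
  apply: measurableT_comp => //; apply: measurable_funM => //; exact: measurable_next_mark.
pose phi x := Num.min 1 (K * D * Num.max 0 x).
have mphi : measurable_fun setT phi.
  apply: measurable_minr => //; apply: measurable_funM => //.
  exact: measurable_maxr.
have phi01 x : 0 <= phi x <= 1 by apply: min01; rewrite mulr_ge0// le_max lexx.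
have iphi : Li P (fun w => phi (pmark (M t w) w)).
  apply: (@Li_bounded _ _ _ _ _ 1).
    by apply: measurableT_comp => //; exact: measurable_next_mark.
  by move=> w; have /andP[? ?] := phi01 (pmark (M t w) w); rewrite ger0_norm.
have phiE w : Num.min 1 (K * D * pmark (M t w) w) = phi (pmark (M t w) w).
  by rewrite /phi (max_r (pmark_ge0 Q _ _)).
have iSphi : Li P (fun w => \1_(arrival_within t D) w * phi (pmark (M t w) w)).
  have := Li_indicM mS iphi; congr (Li P _); by apply/funext => w; rewrite mulrC.
have iB : Li P (fun w => \1_(several_within t D) w + (K * D * \1_(arrival_within t D) w +
    \1_(arrival_within t D) w * phi (pmark (M t w) w))).
  by apply: LiD; [exact: Li_indic|apply: LiD => //; apply: LiZ; exact: Li_indic].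
have bR w : `|remainder t D w| <= \1_(several_within t D) w + (K * D * \1_(arrival_within t D) w +
    \1_(arrival_within t D) w * phi (pmark (M t w) w)).
  by have := remainder_bound t0 DD tDH w; rewrite phiE mulrDl [_ * \1_(arrival_within t D) w]mulrC
    [phi _ * _]mulrC [\1_(arrival_within t D) w * (K * D)]mulrC.
have iR : Li P (remainder t D) by exact: Li_dom iB bR.
split=> //; apply: le_trans (ler_norm_Ex iR) _.
apply: le_trans (le_Ex (Li_norm iR) iB bR) _.
rewrite ExD//; last by apply: LiD => //; apply: LiZ; exact: Li_indic.
  rewrite ExD//; last by apply: LiZ; exact: Li_indic.
  rewrite ExZ; last exact: Li_indic.
  rewrite Ex_next_mark_1//; last exact: ltW.
  have inu : Li nu (fun b : R => Num.max 0 b).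
    apply: (@Li_dom _ _ _ _ _ (fun b : R => `|b|)); [exact: measurable_maxr|exact: Li_norm|].
    by move=> b; rewrite ger0_norm ?le_max ?lexx// ge_max normr_ge0 ler_norm.
  have hphi : Ex nu (fun x : R => phi (Num.max 0 x)) <= K * D * Ex nu (fun b : R => Num.max 0 b).
    rewrite -ExZ//; apply: le_Ex; last by move=> x; rewrite /phi ge_min maxA maxxx lexx orbT.
      apply: (@Li_bounded _ _ _ _ _ 1).
        by apply: measurableT_comp => //; exact: measurable_maxr.
      by move=> w; have /andP[? ?] := phi01 (Num.max 0 w); rewrite ger0_norm.
    exact: LiZ.
  have m0 : 0 <= Ex nu (fun b : R => Num.max 0 b).
    by apply: Ex_ge0 => b; rewrite le_max lexx.
  have S0 : 0 <= Ex P (\1_(arrival_within t D)) by apply: Ex_ge0 => w; rewrite indicE ler0n.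
  set s := Ex P (\1_(arrival_within t D)) in h2 S0 *; set f := Ex nu (fun x : R => phi (Num.max 0 x)) in hphi *.
  set m1 := Ex nu (fun b : R => Num.max 0 b) in hphi m0 *; set V := Ex P (bound Q H) in h2 *.
  rewrite lerD//; apply: (@le_trans _ _ (K * D * (1 + m1) * s)).
    have := ler_wpM2l S0 hphi; rewrite mulrDr mulr1 mulrDl [K * D * m1 * s]mulrC.
    by move=> h; rewrite lerD2l.
  have c0 : 0 <= K * D * (1 + m1) by rewrite mulr_ge0// addr_ge0.
  apply: le_trans (ler_wpM2l c0 h2) _.
  by rewrite le_eqVlt; apply/orP; left; apply/eqP; ring.
exact: Li_indic.
Qed.

Lemma drift_increment eps : 0 < eps -> exists2 D0, 0 < D0 & forall D, 0 < D <= D0 ->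
  forall t, 0 <= t -> t + D <= H ->
  `|Ex P (expZ (t + D)) - Ex P (expZ t) -
    D * (psi t * Ex P (fun w => expZ t w * (lambda + mass t w)))| <= eps * D.
Proof.
move=> e0.
have K0 : 0 < K by exact: lt_le_trans K1.
pose V := Ex P (bound Q H).
pose m1 := Ex nu (fun b : R => Num.max 0 b).
have V0 : 0 <= V by apply: Ex_ge0 => w; exact: bound_ge0.
have m0 : 0 <= m1 by apply: Ex_ge0 => b; rewrite le_max lexx.
have iV : Li P (bound Q H) by exact: Li_bound.
pose c := K * V + K * (1 + m1) * (1 + V) + 1.
have c0 : 0 < c by rewrite ltr_wpDl// addr_ge0// !mulr_ge0 ?addr_ge0// ltW.
have e8 : 0 < eps / 8 by rewrite divr_gt0.
have K2 : 0 < 2 * K + 1 by rewrite addr_gt0// mulr_gt0.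
have eK : 0 < eps / (4 * (2 * K + 1)) by rewrite divr_gt0// mulr_gt0.
have [D1 D10 h1] := stop_rate Q lambda0 a0 nu_gt0 H0 e8.
have [D2 D20 h2] := several_rate e8.
have [D3 D30 h3] := Ex_mul_min iV (bound_ge0 Q lambda0 H) eK.
have [D4 D40 h4] := stop_bound Q lambda0 a0 nu_gt0 H0.
exists (Num.min (Num.min (Num.min D1 D2) (Num.min (D3 / (2 * K)) D4)) (Num.min 1 (eps / (4 * c)))).
  by rewrite !lt_min D10 D20 D40 ltr01 !divr_gt0// mulr_gt0.
move=> D /andP[Dp]; rewrite !le_min -!andbA => /and5P[DD1 DD2 DD3 DD4 /andP[DD5 DD6]] t t0 tDH.
have DD : 0 < D <= 1 by rewrite Dp.
have tH : 0 <= t <= H by rewrite t0/= (le_trans _ tDH)// lerDl ltW.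
have tD : 0 <= t + D by rewrite addr_ge0// ltW.
have S1 : Ex P (\1_(arrival_within t D)) <= (1 + V) * D by apply: h4 => //; rewrite Dp.
have S2 : Ex P (\1_(several_within t D)) <= eps / 8 * D by apply: h2 => //; rewrite Dp.
have [iR bR] := Ex_remainder t0 DD tDH S2 S1.
pose m w := Num.min 1 (2 * K * D * bound Q H w).
pose om := Ex P (fun w => bound Q H w * m w).
have om_le : om <= eps / (4 * (2 * K + 1)).
  apply: h3; rewrite !mulr_gt0//=.
  by rewrite mulrC -ler_pdivlMr ?mulr_gt0.
have mm : measurable_fun setT m.
  apply: measurable_minr => //; apply: measurable_funM => //; exact: Li_meas iV.
have KD0 : 0 <= 2 * K * D by rewrite !mulr_ge0 ?ltW.
have m01 w : 0 <= m w <= 1 by apply: min01; rewrite mulr_ge0// bound_ge0.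
have iVm : Li P (fun w => bound Q H w * m w).
  by apply: (@LiM _ _ _ _ _ _ 1) => // w; have /andP[? ?] := m01 w; rewrite ger0_norm.
pose U := expU t D.
have U01 w : 0 <= U w <= 1 by exact: Ut01.
have Z01 w : 0 <= expZ t w <= 1 by exact: (Zt01 t0 DD tDH).
have mU : measurable_fun setT U by exact: measurable_tilt.
have mZ : measurable_fun setT (expZ t) by exact: measurable_Zt.
have U1 w : `|U w| <= 1 by have /andP[? ?] := U01 w; rewrite ger0_norm.
have Z1 w : `|expZ t w| <= 1 by have /andP[? ?] := Z01 w; rewrite ger0_norm.
have iU : Li P U by exact: Li_bounded U1.
have iZ : Li P (expZ t) by exact: Li_bounded Z1.
have mS : measurable (arrival_within t D) by apply: measurable_stop => //; exact: ltW.
have iUS : Li P (fun w => U w * \1_(arrival_within t D) w) by exact: Li_indicM.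
have wV w : `|lambda + mass t w| <= bound Q H w.
  rewrite ger0_norm; last by rewrite addr_ge0 ?mass_ge0.
  by apply: mass_le_bound => //; case/andP : tH.
have iw : Li P (fun w => lambda + mass t w).
  by apply: Li_dom iV wV; apply: measurable_funD => //; exact: measurable_mass.
have comm X : (fun w => X w * (lambda + mass t w)) = (fun w => (lambda + mass t w) * X w).
  by apply/funext => w; rewrite mulrC.
have iZw : Li P (fun w => expZ t w * (lambda + mass t w)) by rewrite comm; exact: LiM Z1 iw.
have iUw : Li P (fun w => U w * (lambda + mass t w)) by rewrite comm; exact: LiM U1 iw.
(* The new mark is independent of [U] and of the arrival; averaging over it produces the factor g
   phi(al) of the drift. *)
have gphi : Ex P (fun w => U w * \1_(arrival_within t D) w * jump t w) =
    g t * mark_laplace (al t) * Ex P (fun w => U w * \1_(arrival_within t D) w).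
  pose phi x := expR (- (al t * Num.max 0 x)).
  have mphi : measurable_fun setT phi.
    apply: measurableT_comp; first exact: measurable_expR.
    apply: measurableT_comp => //; apply: measurable_funM => //; exact: measurable_maxr.
  have phi01 x : 0 <= phi x <= 1.
    have h : 0 <= al t * Num.max 0 x by rewrite mulr_ge0 ?al0// le_max lexx.
    by have [_ /ltW ? ? _] := expRN_bounds h; apply/andP.
  have iUSp : Li P (fun w => U w * \1_(arrival_within t D) w * phi (pmark (M t w) w)).
    apply: (@LiM _ _ _ _ _ _ 1) => //.
      by apply: measurableT_comp => //; exact: measurable_next_mark.
    by move=> w; have /andP[? ?] := phi01 (pmark (M t w) w); rewrite ger0_norm.
  have cc0 : 0 <= lambda * C (t + D) by rewrite mulr_ge0// C0// tD tDH.
  have cc1 : 0 <= al (t + D) * expR (- (a * D)) by rewrite mulr_ge0 ?expR_ge0// al0// tD tDH.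
  have := Ex_next_mark Q cc0 cc1 mg g01 mphi phi01 t0 (ltW Dp).
  rewrite -/(expU t D) -/U.
  have -> : Ex nu (fun x : R => phi (Num.max 0 x)) = mark_laplace (al t).
    by apply: eq_Ex => x; rewrite /phi maxA maxxx.
  move=> e; transitivity (Ex P (fun w => g t * (U w * \1_(arrival_within t D) w * phi (pmark (M t w) w)))).
    by apply: eq_Ex => w; rewrite /jump /phi (max_r (pmark_ge0 Q _ _)); ring.
  by rewrite ExZ// e; ring.
have iUSj : Li P (fun w => U w * \1_(arrival_within t D) w * jump t w).
  apply: (@LiM _ _ _ _ _ _ 1) => //.
    apply: measurable_funM => //; apply: measurableT_comp; first exact: measurable_expR.
    apply: measurableT_comp => //; apply: measurable_funM => //; exact: measurable_next_mark.
  by move=> w; have /andP[? ?] := jump01 t0 DD tDH w; rewrite ger0_norm.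
have EZ : Ex P (expZ (t + D)) = Ex P (remainder t D) + (Ex P U +
    (g t * mark_laplace (al t) - 1) * Ex P (fun w => U w * \1_(arrival_within t D) w)).
  transitivity (Ex P (fun w => remainder t D w + (U w - U w * \1_(arrival_within t D) w
                  + U w * \1_(arrival_within t D) w * jump t w))).
    by apply: eq_Ex => w; rewrite /remainder /U; ring.
  have iUB : Li P (fun w => U w - U w * \1_(arrival_within t D) w) by exact: LiB.
  rewrite ExD//; last exact: LiD.
  by rewrite ExD// ExB// gphi; ring.
have EU : `|Ex P U - Ex P (expZ t) + D * beta t * Ex P (fun w => expZ t w * (lambda + mass t w))|
    <= K * D ^+ 2 * V + 2 * K * D * om.
  have iUZ : Li P (fun w => U w - expZ t w) by exact: LiB.
  have -> : Ex P U - Ex P (expZ t) + D * beta t * Ex P (fun w => expZ t w * (lambda + mass t w)) =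
      Ex P (fun w => U w - expZ t w + D * beta t * (expZ t w * (lambda + mass t w))).
    by rewrite ExD// ?ExB// ?ExZ//; exact: LiZ.
  have iX : Li P (fun w => U w - expZ t w + D * beta t * (expZ t w * (lambda + mass t w))).
    by apply: LiD => //; exact: LiZ.
  apply: le_trans (ler_norm_Ex iX) _.
  rewrite /V /om -!ExZ// -ExD; [|exact: LiZ|exact: LiZ].
  apply: le_Ex; [exact: Li_norm|by apply: LiD; exact: LiZ|] => w.
  apply: le_trans (Ut_Zt t0 DD tDH w).
  by rewrite le_eqVlt; apply/orP; left; apply/eqP; congr (`|_ + _|); ring.
have EUw : `|Ex P (fun w => U w * (lambda + mass t w)) - Ex P (fun w => expZ t w * (lambda + mass t w))| <= om.
  rewrite -ExB//; have iX := LiB iUw iZw; apply: le_trans (ler_norm_Ex iX) _.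
  apply: le_Ex; [exact: Li_norm|exact: iVm|] => w.
  rewrite -mulrBl normrM mulrC; apply: ler_pM => //; exact: Ut_Zt_lip.
have ES : `|Ex P (fun w => U w * \1_(arrival_within t D) w) - D * Ex P (fun w => U w * (lambda + mass t w))|
    <= eps / 8 * D.
  apply: h1 => //; first by rewrite Dp.
  by apply: history_tilt.
rewrite EZ /psi.
set A := Ex P (remainder t D) in bR *; set B := Ex P U in EU *.
set Z := Ex P (expZ t) in EU *; set Zw := Ex P (fun w => expZ t w * _) in EU EUw *.
set Uw := Ex P (fun w => U w * (lambda + _)) in EUw ES *.
set S := Ex P (fun w => U w * \1_(arrival_within t D) w) in ES *.
set p := g t * mark_laplace (al t).
have p01 : 0 <= 1 - p <= 1.
  have L01 : 0 <= mark_laplace (al t) <= 1.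
    rewrite /mark_laplace; have h x : 0 <= al t * Num.max 0 x.
      by rewrite mulr_ge0 ?al0// le_max lexx.
    have L1 x : 0 <= expR (- (al t * Num.max 0 x)) <= 1.
      by have [_ /ltW ? ? _] := expRN_bounds (h x); apply/andP.
    rewrite Ex_ge0 /=; last by move=> x; exact: expR_ge0.
    rewrite -[leRHS](Ex_cst nu); apply: le_Ex; [|exact: Li_cst|by move=> x; have /andP[] := L1 x].
    apply: (@Li_bounded _ _ _ _ _ 1).
      apply: measurableT_comp; first exact: measurable_expR.
      apply: measurableT_comp => //; apply: measurable_funM => //; exact: measurable_maxr.
    by move=> x; have /andP[? ?] := L1 x; rewrite ger0_norm.
  have /andP[L0 L1] := L01; have /andP[g0 g1] := g01 t.
  by rewrite subr_ge0 gerBl mulr_ile1//= mulr_ge0.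
(* The arrival term is compared in two stages: the probability with its rate, at the functional [U],
   and then [U] with [expZ]. Both errors carry the factor 1 - p, which lies in [0, 1]. *)
have -> : A + (B + (p - 1) * S) - Z - D * ((p - 1 - beta t) * Zw) =
  A + (B - Z + D * beta t * Zw) - (1 - p) * (S - D * Uw) - (1 - p) * (D * (Uw - Zw)) by ring.
have /andP[p0 p1] := p01.
have E1 := ler_norm_contract p0 p1 ES.
have E2 : `|(1 - p) * (D * (Uw - Zw))| <= D * om.
  by apply: ler_norm_contract => //; rewrite normrM gtr0_norm// ler_wpM2l// ltW.
apply: le_trans (ler_normB _ _) _; apply: le_trans (lerD (ler_normB _ _) E2) _.
apply: le_trans (lerD (lerD (ler_normD _ _) E1) (lexx _)) _.
apply: le_trans (lerD (lerD (lerD bR EU) (lexx _)) (lexx _)) _.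
have f1 : D * om + 2 * K * D * om <= eps / 4 * D.
  have : om * (4 * (2 * K + 1)) <= eps by rewrite -ler_pdivlMr// mulr_gt0.
  by nra.
have f2 : c * D ^+ 2 <= eps / 4 * D.
  have : D * (4 * c) <= eps by rewrite -ler_pdivlMr// mulr_gt0.
  by nra.
have f3 : K * (1 + m1) * (1 + V) * D ^+ 2 + K * D ^+ 2 * V <= c * D ^+ 2.
  have -> : K * (1 + m1) * (1 + V) * D ^+ 2 + K * D ^+ 2 * V = (c - 1) * D ^+ 2 by rewrite /c; ring.
  by rewrite ler_wpM2r ?sqr_ge0// gerBl.
have f4 : 0 < eps * D by rewrite mulr_gt0.
rewrite -/V -/m1; lra.
Qed.

Lemma Ex_Zw_ge0 t : 0 <= Ex P (fun w => expZ t w * (lambda + mass t w)).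
Proof.
apply: Ex_ge0 => w; rewrite mulr_ge0 ?addr_ge0 ?mass_ge0//.
rewrite /expZ /tilt mulr_ge0 ?expR_ge0//.
by have /andP[] := gprod01 Q t g01 w.
Qed.

(** The mean of expZ (lambda + mass) is nonnegative, so the sign of [psi] alone decides the
    direction of all increments. *)
Lemma drift_submartingale : (forall t, 0 <= t <= H -> 0 <= psi t) ->
  Ex P (expZ 0) <= Ex P (expZ H).
Proof.
move=> psi0; apply: (@le_of_increments _ (fun t => Ex P (expZ t)) _ H0) => e e0.
have [D0 D00 hD] := drift_increment e0; exists D0 => // D DD t t0 tDH.
have := hD D DD t t0 tDH; have /andP[D1 _] := DD.
have : 0 <= D * (psi t * Ex P (fun w => expZ t w * (lambda + mass t w))).
  rewrite !mulr_ge0 ?Ex_Zw_ge0 ?(ltW D1)//; apply: psi0.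
  by rewrite t0/= (le_trans _ tDH)// lerDl ltW.
by rewrite ler_norml; lra.
Qed.

Lemma drift_supermartingale : (forall t, 0 <= t <= H -> psi t <= 0) ->
  Ex P (expZ H) <= Ex P (expZ 0).
Proof.
move=> psi0; rewrite -lerN2.
apply: (@le_of_increments _ (fun t => - Ex P (expZ t)) _ H0) => e e0.
have [D0 D00 hD] := drift_increment e0; exists D0 => // D DD t t0 tDH.
have := hD D DD t t0 tDH; have /andP[D1 _] := DD.
have : D * (psi t * Ex P (fun w => expZ t w * (lambda + mass t w))) <= 0.
  rewrite pmulr_rle0// mulr_le0_ge0 ?Ex_Zw_ge0//; apply: psi0.
  by rewrite t0/= (le_trans _ tDH)// lerDl ltW.
by rewrite ler_norml; lra.
Qed.

Lemma Ex_Zt0 : Ex P (expZ 0) = expR (- (lambda * C 0)).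
Proof.
rewrite -[RHS](Ex_cst P); apply: eq_Ex => w.
by rewrite /expZ /tilt /mass /gprod count0 !big_ord0 mulr0 addr0 mulr1.
Qed.

Lemma Ex_ZtH : al H = 0 -> C H = 0 -> Ex P (expZ H) = Ex P (gprod Q g H).
Proof.
move=> aH CH; apply: eq_Ex => w.
by rewrite /expZ /tilt aH CH mulr0 mul0r addr0 oppr0 expR0 mul1r.
Qed.

End drift.

(** * Service requirements *)

Section discretization.
Variable R : realType.

(* Replacing the time to the horizon by its upper grid point reduces the averaging
   over a service requirement to independence of finitely many events. *)
Definition grid (m : nat) (v : R) : R := (Num.truncn (m.+1%:R * v)).+1%:R / m.+1%:R.

Lemma grid_gt m v : 0 <= v -> v < grid m v.
Proof.
move=> v0; rewrite /grid ltr_pdivlMr// mulrC.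
by apply: truncnS_gt; rewrite mulr_ge0.
Qed.

Lemma grid_le m v : 0 <= v -> grid m v <= v + m.+1%:R^-1.
Proof.
move=> v0; rewrite /grid ler_pdivrMr// mulrDl mulVf// -natr1 lerD2r mulrC.
by rewrite truncn_le mulr_ge0.
Qed.

Lemma cvg_grid v : 0 <= v -> grid m v @[m --> \oo] --> v.
Proof.
move=> v0; apply: (@squeeze_cvgr _ _ _ _ (fun=> v) (fun m => v + m.+1%:R^-1)).
- by apply: nearW => m; rewrite ltW ?grid_gt//= grid_le.
- exact: cvg_cst.
- rewrite -[X in _ --> X]addr0; apply: cvgD; first exact: cvg_cst.
  exact: cvg_harmonic.
Qed.

Definition cell (m j : nat) (v : R) : bool :=
  (j%:R / m.+1%:R <= v) && (v < j.+1%:R / m.+1%:R).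

Lemma cellE m j v : 0 <= v -> cell m j v = (j == Num.truncn (m.+1%:R * v)).
Proof.
move=> v0; rewrite /cell ler_pdivrMr// ltr_pdivlMr// mulrC [_ * v]mulrC.
rewrite eq_sym; apply/idP/eqP => [h|<-].
  by apply: truncn_def; rewrite mulrC [_ * v]mulrC.
by apply: truncn_itv; rewrite mulr_ge0.
Qed.

Lemma sum_cell m n v (f : R -> R) : 0 <= v -> (Num.truncn (m.+1%:R * v) < n)%N ->
  \sum_(j < n) (cell m j v)%:R * f (j.+1%:R / m.+1%:R) = f (grid m v).
Proof.
move=> v0 vn; rewrite (bigD1 (Ordinal vn))//= cellE// eqxx mul1r.
rewrite big1 ?addr0// => j; rewrite -val_eqE/= => jn.
by rewrite cellE// (negbTE jn) mul0r.
Qed.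

End discretization.

Section services.
Context d (T : measurableType d) (R : realType) (P : probability T R).
Variables (lambda a mu : R) (nu : probability R R).
Variable Q : hawkes_queue P lambda nu (exp_decay a) (exp_decay mu).
Hypothesis mu0 : 0 <= mu.
Variables (H zeta : R).
Hypotheses (H0 : 0 <= H) (zeta01 : 0 <= zeta <= 1).

Local Notation M := (hq_count Q).
Local Notation tau := (hq_epoch Q).
Local Notation B := (hq_mark Q).
Local Notation J := (hq_service Q).

Definition arrivals : set (set T) := sigma_gen setT tau `|` sigma_gen setT B.

Lemma arrivals_sub : arrivals `<=` measurable.
Proof.
have sub (D : set nat) (X : nat -> {RV P >-> R}) : sigma_gen D X `<=` measurable.
  move=> A; apply: smallest_sub; first exact: sigma_algebra_measurable.
  by move=> C [i _ [U mU <-]]; exact: measurable_funPT.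
by move=> A [|]; exact: sub.
Qed.

Lemma arrivals_measurable A : <<s arrivals >> A -> measurable A.
Proof.
apply: smallest_sub; first exact: sigma_algebra_measurable.
exact: arrivals_sub.
Qed.

Lemma arrivals_epoch i U : measurable U -> <<s arrivals >> (tau i @^-1` U).
Proof.
move=> mU; apply: sub_sigma_algebra; left; apply: sub_sigma_algebra.
by exists i => //; exists U => //; rewrite setTI.
Qed.

Lemma service_set i U : measurable U -> sigma_gen [set i] J (J i @^-1` U).
Proof.
move=> mU; apply: sub_sigma_algebra; exists i => //.
by exists U => //; rewrite setTI.
Qed.

Lemma service_measurable i A : sigma_gen [set i] J A -> measurable A.
Proof.
apply: smallest_sub; first exact: sigma_algebra_measurable.
by move=> C [k _ [U mU <-]]; exact: measurable_funPT.
Qed.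

(** The guard makes the factor equal to 1 for customers arriving after [H], so that the generating
    function is eventually a product over a fixed number of indices. *)
Definition busy i w : R := 1 - zeta * ((i < M H w)%N && (H - tau i w < J i w))%:R.

Definition busy_mean i w : R :=
  1 - zeta * ((i < M H w)%N%:R * expR (- (mu * (H - tau i w)))).

Lemma busy01 i w : 0 <= busy i w <= 1.
Proof.
have /andP[z0 z1] := zeta01; rewrite /busy; case: ((i < M H w)%N && _) => /=.
  by rewrite mulr1 subr_ge0 z1 gerBl.
by rewrite mulr0 subr0 ler01 lexx.
Qed.

Lemma busy_mean01 i w : 0 <= busy_mean i w <= 1.
Proof.
have /andP[z0 z1] := zeta01; rewrite /busy_mean countE//.
have [h|_] := leP (tau i w) H; last by rewrite mul0r mulr0 subr0 ler01 lexx.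
have h' : 0 <= mu * (H - tau i w) by rewrite mulr_ge0// subr_ge0.
have [_ /ltW e0 e1 _] := expRN_bounds h'.
by rewrite mul1r subr_ge0 gerBl mulr_ile1// mulr_ge0.
Qed.

Lemma measurable_count_fun i : measurable_fun setT (fun w => (i < M H w)%N%:R : R).
Proof.
rewrite (_ : (fun w => _) = \1_[set w | (i < M H w)%N]).
  by apply: measurable_indic; exact: measurable_count_lt.
by apply/funext => w; rewrite indic_bool.
Qed.

Lemma measurable_wait i : measurable_fun setT (fun w => H - tau i w).
Proof. by apply: measurable_funB => //; exact: measurable_epoch. Qed.

Lemma measurable_busy i : measurable_fun setT (busy i).
Proof.
apply: measurable_funB => //; apply: measurable_funM => //.
rewrite (_ : (fun w => _) = fun w => (i < M H w)%N%:R * \1_[set w | H - tau i w < J i w] w); last first.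
  by apply/funext => w; rewrite indic_bool -natrM mulnb.
apply: measurable_funM; first exact: measurable_count_fun.
apply: measurable_indic; rewrite -[X in measurable X]setTI.
have mJ : measurable_fun setT (J i) by exact: measurable_funPT.
have := measurable_fun_ltr (measurable_wait i) mJ measurableT.
by move=> /(_ [set true] I); congr measurable; apply/seteqP; split.
Qed.

Lemma measurable_busy_mean i : measurable_fun setT (busy_mean i).
Proof.
apply: measurable_funB => //; apply: measurable_funM => //.
apply: measurable_funM; first exact: measurable_count_fun.
apply: measurableT_comp; first exact: measurable_expR.
apply: measurableT_comp => //; apply: measurable_funM => //; exact: measurable_wait.
Qed.

Lemma prod01 (n : nat) (F : nat -> T -> R) : (forall i w, 0 <= F i w <= 1) ->
  forall w, 0 <= \prod_(i < n) F i w <= 1.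
Proof.
move=> F01 w; apply/andP; split; first by apply: prodr_ge0 => i _; have /andP[] := F01 i w.
by apply: prodr_ile1 => i _; exact: F01.
Qed.

Lemma measurable_finprod (n : nat) (F : nat -> T -> R) : (forall i, measurable_fun setT (F i)) ->
  measurable_fun setT (fun w => \prod_(i < n) F i w).
Proof.
move=> mF; elim: n => [|n IHn].
  rewrite (_ : (fun w => _) = cst 1); first exact: measurable_cst.
  by apply/funext => w; rewrite big_ord0.
rewrite (_ : (fun w => _) = fun w => \prod_(i < n) F i w * F n w); first exact: measurable_funM.
by apply/funext => w; rewrite big_ord_recr.
Qed.

Definition events (E : nat -> set T) (K L : nat) w : R := \prod_(i < L) \1_(E (K + i)%N) w.

Lemma indic01 (A : set T) w : 0 <= (\1_A w : R) <= 1.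
Proof. by rewrite indicE; case: (_ \in _); rewrite ler01 lexx. Qed.

Lemma Li_01 (X : T -> R) : measurable_fun setT X -> (forall w, 0 <= X w <= 1) -> Li P X.
Proof.
by move=> mX X01; apply: (@Li_bounded _ _ _ _ _ 1) => // w; have /andP[? ?] := X01 w; rewrite ger0_norm.
Qed.

Lemma service_base A (E : nat -> set T) L : <<s arrivals >> A ->
  (forall i, sigma_gen [set i] J (E i)) ->
  Ex P (fun w => \1_A w * events E 0 L w) = fine (P A) * \prod_(i < L) fine (P (E i)).
Proof.
move=> hA hE.
pose S (k : option nat) : set T := if k is Some i then E i else A.
pose s := None :: map Some (iota 0 L).
have us : uniq s.
  rewrite /s /= map_inj_uniq ?iota_uniq ?andbT; last by move=> x y [].
  by apply/mapP => -[].
have hS k : k \in s -> (if k is Some i then sigma_gen [set i] J else <<s arrivals >>) (S k).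
  by case: k.
have mS k : measurable (S k).
  by case: k => [i|] /=; [exact: service_measurable|exact: arrivals_measurable].
have := @hq_service_indep _ _ _ _ _ _ _ _ Q s S us hS.
rewrite big_cons big_map /= => e.
have -> : fine (P A) * \prod_(i < L) fine (P (E i)) =
   fine (P A * \big[mule/1%E]_(j <- iota 0 L) P (E j)).
  have fin n : \big[mule/1%E]_(j <- iota 0 n) P (E j) = (\prod_(i < n) fine (P (E i)))%:E.
    elim: n => [|n IHn]; first by rewrite big_nil big_ord0.
    rewrite -addn1 iotaD big_cat/= big_seq1 IHn add0n addn1 big_ord_recr/= EFinM fineK//.
    by rewrite fin_num_measure//; exact: service_measurable.
  by rewrite fin fineM// fin_num_measure//; exact: arrivals_measurable.
rewrite -e -Ex_indic; last first.
  by apply: fin_bigcap_measurable => //; exact: finite_seq.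
apply: eq_Ex => w; rewrite !indicE /events.
have -> : \prod_(i < L) \1_(E (0 + i)%N) w = (all (fun i => w \in E i) (iota 0 L))%:R :> R.
  elim: L {s us hS e} => [|L IHL]; first by rewrite big_ord0.
  have -> : iota 0 L.+1 = iota 0 L ++ [:: L] by rewrite -addn1 iotaD.
  by rewrite big_ord_recr/= IHL all_cat /= add0n indicE andbT -natrM mulnb.
rewrite -natrM mulnb; congr (_%:R); congr nat_of_bool.
apply/idP/idP => [/andP[wA /allP wE]|]; rewrite inE /bigcap /=.
  move=> [i|] /=; last by rewrite inE in wA.
  by rewrite inE /= => /mapP[j js [->]]; have := wE j js; rewrite inE.
move=> h; apply/andP; split; first by rewrite inE; apply: (h None); rewrite /= inE.
apply/allP => i ii; rewrite inE; apply: (h (Some i)) => /=.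
by rewrite inE; apply/orP; right; apply: map_f.
Qed.

Definition busy_prod K w : R := \prod_(i < K) busy i w.
Definition busy_mean_prod K w : R := \prod_(i < K) busy_mean i w.

Lemma measurable_events E K L : (forall i, sigma_gen [set i] J (E i)) ->
  measurable_fun setT (events E K L).
Proof.
move=> hE; apply: (@measurable_finprod L (fun i => \1_(E (K + i)%N))) => i.
by apply: measurable_indic; exact: service_measurable (hE _).
Qed.

Lemma events01 E K L w : 0 <= events E K L w <= 1.
Proof. by apply: (@prod01 L (fun i => \1_(E (K + i)%N))) => i x; exact: indic01. Qed.

Lemma mul01 (x y : R) : 0 <= x <= 1 -> 0 <= y <= 1 -> 0 <= x * y <= 1.
Proof. by move=> /andP[? ?] /andP[? ?]; rewrite mulr_ge0// mulr_ile1. Qed.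

Definition wait_cell K m j : set T :=
  [set w | (K < M H w)%N && cell m j (H - tau K w)].

Lemma arrivals_wait_cell K m j : <<s arrivals >> (wait_cell K m j).
Proof.
have -> : wait_cell K m j = tau K @^-1` (`]-oo, H] `&`
    [set x | j%:R / m.+1%:R <= H - x] `&` [set x | H - x < j.+1%:R / m.+1%:R]).
  apply/seteqP; split => w; rewrite /wait_cell /cell /= in_itv/= countE//.
    by move=> /and3P[-> -> ->].
  by move=> [[-> ->] ->].
apply: arrivals_epoch; have mB : measurable_fun setT (fun x : R => H - x).
  by apply: measurable_funB.
apply: measurableI.
  apply: measurableI; first exact: measurable_itv.
  exact: measurable_superlevel.
rewrite (_ : [set x | _] = ~` [set x | j.+1%:R / m.+1%:R <= H - x]).
  by apply: measurableC; exact: measurable_superlevel.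
by apply/seteqP; split => x /=; rewrite ltNge => /negP.
Qed.

Lemma sum_wait_cell K m w (f : R -> R) :
  \sum_(j < (Num.truncn (m.+1%:R * H)).+1)
    \1_(wait_cell K m j) w * f (j.+1%:R / m.+1%:R) =
  (K < M H w)%N%:R * f (grid m (H - tau K w)).
Proof.
have [KM|KM] := ltnP K (M H w); last first.
  rewrite mul0r big1// => j _; rewrite indic_bool ltnNge KM /=.
  by rewrite mul0r.
have v0 : 0 <= H - tau K w by rewrite subr_ge0 -countE.
rewrite mul1r -(@sum_cell _ m (Num.truncn (m.+1%:R * H)).+1 _ f v0); last first.
  by rewrite ltnS; apply: le_truncn; rewrite ler_wpM2l// gerBl ltW// epoch_gt0.
by apply: eq_bigr => j _; rewrite indic_bool KM.
Qed.

(** Service requirements are averaged one at a time. The induction carries events [E] about the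
    services of index at least K: in the step, the event about J_K joins them, and the induction
    hypothesis then averages the first K factors in its presence. *)
Lemma service_prod K A E L : <<s arrivals >> A ->
  (forall i, sigma_gen [set i] J (E i)) ->
  Ex P (fun w => \1_A w * busy_prod K w * events E K L w) =
  Ex P (fun w => \1_A w * busy_mean_prod K w) * \prod_(i < L) fine (P (E (K + i)%N)).
Proof.
elim: K A E L => [|K IHK] A E L hA hE.
  have mA := arrivals_measurable hA.
  rewrite (_ : Ex P (fun w => \1_A w * busy_mean_prod 0 w) = fine (P A)); last first.
    by rewrite -Ex_indic//; apply: eq_Ex => w; rewrite /busy_mean_prod big_ord0 mulr1.
  by rewrite -service_base//; apply: eq_Ex => w; rewrite /busy_prod big_ord0 mulr1.
have mJ i : measurable_fun setT (J i) by exact: measurable_funPT.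
pose p := \prod_(i < L) fine (P (E (K.+1 + i)%N)).
(* An event [F] about the service of index K is put in front of the later events, whose number
   becomes [L.+1]. *)
have IH1 A' F : <<s arrivals >> A' -> sigma_gen [set K] J F ->
    Ex P (fun w => \1_A' w * busy_prod K w * (\1_F w * events E K.+1 L w)) =
    Ex P (fun w => \1_A' w * busy_mean_prod K w) * (fine (P F) * p).
  move=> hA' hF; pose E' i := if i == K then F else E i.
  have hE' i : sigma_gen [set i] J (E' i) by rewrite /E'; case: eqP => [->|_].
  have E'K : E' K = F by rewrite /E' eqxx.
  have E'S (i : 'I_L) : E' (K + lift ord0 i)%N = E (K.+1 + i)%N :> set T.
    by rewrite /E' lift0 addnS -addSn gtn_eqF// addSn ltnS leq_addr.
  have := IHK A' E' L.+1 hA' hE'; rewrite big_ord_recl addn0 E'K.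
  rewrite (eq_bigr (fun i : 'I_L => fine (P (E (K.+1 + i)%N)))); last first.
    by move=> i _; rewrite E'S.
  rewrite -/p => <-; apply: eq_Ex => w; congr (_ * _).
  rewrite [RHS]/events big_ord_recl addn0 E'K; congr (_ * _).
  by apply: eq_bigr => i _; rewrite E'S.
have mA := arrivals_measurable hA.
pose W w := \1_A w * busy_prod K w * events E K.+1 L w.
pose Wm w := \1_A w * busy_mean_prod K w.
have mW : measurable_fun setT W.
  apply: measurable_funM; last exact: measurable_events.
  apply: measurable_funM; first exact: measurable_indic.
  by apply: measurable_finprod => i; exact: measurable_busy.
have mWm : measurable_fun setT Wm.
  apply: measurable_funM; first exact: measurable_indic.
  by apply: measurable_finprod => i; exact: measurable_busy_mean.
have W01 w : 0 <= W w <= 1.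
  apply: mul01 (events01 _ _ _ _); apply: mul01 (indic01 _ _) _.
  by apply: prod01 => i x; exact: busy01.
have Wm01 w : 0 <= Wm w <= 1.
  by apply: mul01 (indic01 _ _) _; apply: prod01 => i x; exact: busy_mean01.
have EW : Ex P W = Ex P Wm * p.
  have := IH1 A setT hA; rewrite probability_setT mul1r => <-.
    by apply: eq_Ex => w; rewrite indicT mul1r.
  by rewrite -(preimage_setT (J K)); exact: service_set.
pose b w : R := ((K < M H w)%N && (H - tau K w < J K w))%:R.
pose bm w : R := (K < M H w)%N%:R * expR (- (mu * (H - tau K w))).
pose n m := (Num.truncn (m.+1%:R * H)).+1.
(* With the remaining time H - tau_K rounded up to the grid, the threshold takes finitely many
   values; on each cell [IH1] applies with a deterministic threshold, and then m tends to
   infinity. *)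
pose X m w := W w * ((K < M H w)%N%:R * (grid m (H - tau K w) < J K w)%R%:R).
pose Y m w := Wm w * ((K < M H w)%N%:R * expR (- (mu * grid m (H - tau K w)))).
have tail_set v : sigma_gen [set K] J [set w | v < J K w].
  have := @service_set K `]v, +oo[%classic (measurable_itv _).
  by congr (sigma_gen _ _ _); apply/seteqP; split => w /=; rewrite in_itv/= andbT.
have cellA m j : <<s arrivals >> (A `&` wait_cell K m j).
  apply: (@measurableI _ (g_sigma_algebraType arrivals)); first exact: hA.
  exact: arrivals_wait_cell.
have XE m : X m = fun w => \sum_(j < n m) \1_(A `&` wait_cell K m j) w * busy_prod K w *
    (\1_[set w | j.+1%:R / m.+1%:R < J K w] w * events E K.+1 L w).
  apply/funext => w; rewrite /X -(sum_wait_cell K m w (fun v => (v < J K w)%R%:R)) mulr_sumr.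
  apply: eq_bigr => j _; rewrite indicI/= [\1_[set _ | _ < _] w]indic_bool /W; ring.
have YE m : Y m = fun w => \sum_(j < n m) expR (- (mu * (j.+1%:R / m.+1%:R))) *
    (\1_(A `&` wait_cell K m j) w * busy_mean_prod K w).
  apply/funext => w; rewrite /Y -(sum_wait_cell K m w (fun v => expR (- (mu * v)))) mulr_sumr.
  by apply: eq_bigr => j _; rewrite indicI/= /Wm; ring.
have iX m j : Li P (fun w => \1_(A `&` wait_cell K m j) w * busy_prod K w *
    (\1_[set w | j.+1%:R / m.+1%:R < J K w] w * events E K.+1 L w)).
  apply: Li_01 => [|w].
    apply: measurable_funM.
      apply: measurable_funM; first by apply: measurable_indic; exact: arrivals_measurable.
      by apply: measurable_finprod => i; exact: measurable_busy.
    apply: measurable_funM; last exact: measurable_events.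
    by apply: measurable_indic; exact: service_measurable (tail_set _).
  apply: mul01; last by apply: mul01 (indic01 _ _) (events01 _ _ _ _).
  by apply: mul01 (indic01 _ _) _; apply: prod01 => i x; exact: busy01.
have iY m j : Li P (fun w => \1_(A `&` wait_cell K m j) w * busy_mean_prod K w).
  apply: Li_01 => [|w].
    apply: measurable_funM; first by apply: measurable_indic; exact: arrivals_measurable.
    by apply: measurable_finprod => i; exact: measurable_busy_mean.
  by apply: mul01 (indic01 _ _) _; apply: prod01 => i x; exact: busy_mean01.
have XY m : Ex P (X m) = Ex P (Y m) * p.
  rewrite XE YE.
  rewrite (@Ex_sum _ _ _ _ _ (fun j w => \1_(A `&` wait_cell K m j) w * busy_prod K w *
    (\1_[set w | j.+1%:R / m.+1%:R < J K w] w * events E K.+1 L w)))//.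
  rewrite (@Ex_sum _ _ _ _ _ (fun j w => expR (- (mu * (j.+1%:R / m.+1%:R))) *
    (\1_(A `&` wait_cell K m j) w * busy_mean_prod K w))); last by move=> j; exact: LiZ.
  rewrite mulr_suml; apply: eq_bigr => j _; rewrite IH1// ExZ//.
  rewrite (hq_service_law Q); last by rewrite divr_ge0.
  by rewrite /exp_decay /=; ring.
have mcount := measurable_count_fun K.
have mb : measurable_fun setT b.
  have -> : b = fun w => (K < M H w)%N%:R * \1_[set w | H - tau K w < J K w] w.
    by apply/funext => w; rewrite indic_bool -natrM mulnb.
  apply: measurable_funM => //; apply: measurable_indic; rewrite -[X in measurable X]setTI.
  have := measurable_fun_ltr (measurable_wait K) (mJ K) measurableT.
  by move=> /(_ [set true] I); congr measurable; apply/seteqP; split.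
have mbm : measurable_fun setT bm.
  apply: measurable_funM => //; apply: measurableT_comp; first exact: measurable_expR.
  apply: measurableT_comp => //; apply: measurable_funM => //; exact: measurable_wait.
have b01 w : 0 <= b w <= 1 by rewrite /b; case: ((K < _)%N && _); rewrite ler01 lexx.
have c01 w : 0 <= ((K < M H w)%N%:R : R) <= 1 by case: (K < _)%N; rewrite ler01 lexx.
have bmE w : 1 - zeta * bm w = busy_mean K w by [].
have gg m w : (K < M H w)%N -> 0 <= grid m (H - tau K w).
  move=> KM; have v0 : 0 <= H - tau K w by rewrite subr_ge0 -countE.
  by rewrite ltW// (le_lt_trans v0)// grid_gt.
have exp01 v : 0 <= v -> 0 <= expR (- (mu * v)) <= 1.
  by move=> v0; have [_ /ltW ? ? _] := expRN_bounds (mulr_ge0 mu0 v0); apply/andP.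
have bm01 w : 0 <= bm w <= 1.
  rewrite /bm countE//; have [h|_] := leP (tau K w) H; last by rewrite mul0r ler01 lexx.
  by rewrite mul1r exp01// subr_ge0.
have limX : Ex P (X m) @[m --> \oo] --> Ex P (fun w => W w * b w).
  apply: (@Ex_dct _ _ _ _ X _ (fun=> 1)) => //.
  - move=> m; apply: Li_meas; rewrite XE.
    exact: (@Li_sum _ _ _ P _ (fun j w => \1_(A `&` wait_cell K m j) w * busy_prod K w *
    (\1_[set w | j.+1%:R / m.+1%:R < J K w] w * events E K.+1 L w))).
  - exact: measurable_funM.
  - exact: Li_cst.
  - move=> m w; have : 0 <= X m w <= 1.
      apply: mul01 => //; apply: mul01 => //.
      by case: (_ < _)%R; rewrite ler01 lexx.
    by move=> /andP[? ?]; rewrite ger0_norm.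
  - move=> w; apply: cvgM; first exact: cvg_cst.
    rewrite /b; have [KM|KM] := ltnP K (M H w); last first.
      by rewrite /= (_ : (fun m => _) = fun=> 0) ?mul0r; [exact: cvg_cst|apply/funext => m; rewrite mul0r].
    have v0 : 0 <= H - tau K w by rewrite subr_ge0 -countE.
    (* Grid points lie strictly above H - tau_K. So if J_K exceeds it the indicators are eventually
       1, and if J_K is at most it, equality included, they are all 0. *)
    rewrite /=; apply: cvg_near_cst; have [lt|ge] := ltP (H - tau K w) (J K w).
      have ev : \forall m \near \oo, grid m (H - tau K w) < J K w by exact: cvgr_lt (cvg_grid v0) _ lt.
      by apply: filterS ev => m h; rewrite h mul1r.
    apply: nearW => m; rewrite ltNge (le_trans ge) ?ltW ?grid_gt//=.
    by rewrite mulr0.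
have limY : Ex P (Y m) @[m --> \oo] --> Ex P (fun w => Wm w * bm w).
  apply: (@Ex_dct _ _ _ _ Y _ (fun=> 1)) => //.
  - move=> m; apply: Li_meas; rewrite YE.
    apply: (@Li_sum _ _ _ P _ (fun j w => expR (- (mu * (j.+1%:R / m.+1%:R))) *
      (\1_(A `&` wait_cell K m j) w * busy_mean_prod K w))) => j; exact: LiZ.
  - exact: measurable_funM.
  - exact: Li_cst.
  - move=> m w; have : 0 <= Y m w <= 1.
      apply: mul01 => //; have [KM|KM] := ltnP K (M H w); last by rewrite mul0r ler01 lexx.
      by rewrite mul1r exp01// gg.
    by move=> /andP[? ?]; rewrite ger0_norm.
  - move=> w; apply: cvgM; first exact: cvg_cst.
    rewrite /bm; have [KM|KM] := ltnP K (M H w); last first.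
      by rewrite mul0r (_ : (fun m => _) = fun=> 0); [exact: cvg_cst|apply/funext => m; rewrite mul0r].
    have v0 : 0 <= H - tau K w by rewrite subr_ge0 -countE.
    apply: cvgM; first exact: cvg_cst.
    apply: continuous_cvg; first exact: continuous_expR.
    by apply: cvgN; apply: cvgM; [exact: cvg_cst|exact: cvg_grid].
have EXY : Ex P (fun w => W w * b w) = Ex P (fun w => Wm w * bm w) * p.
  have := cvgM limY (cvg_cst p).
  rewrite (_ : _ \* _ = fun m => Ex P (X m)); last by apply/funext => m; rewrite XY.
  by move=> /(_ _ _) L3; rewrite -(cvg_lim (@Rhausdorff R) limX) -(cvg_lim (@Rhausdorff R) L3).
have iWb : Li P (fun w => W w * b w).
  by apply: Li_01 => [|w]; [exact: measurable_funM|exact: mul01].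
have iWmb : Li P (fun w => Wm w * bm w).
  by apply: Li_01 => [|w]; [exact: measurable_funM|exact: mul01].
rewrite -/p.
transitivity (Ex P (fun w => W w - zeta * (W w * b w))).
  by apply: eq_Ex => w; rewrite /busy_prod big_ord_recr/= /busy -/(b w) /W /busy_prod; ring.
transitivity (Ex P (fun w => Wm w - zeta * (Wm w * bm w)) * p); last first.
  congr (_ * _); apply: eq_Ex => w.
  by rewrite /busy_mean_prod big_ord_recr/= -bmE /Wm /busy_mean_prod; ring.
rewrite ExB; [|exact: Li_01|exact: LiZ]; rewrite ExB; [|exact: Li_01|exact: LiZ].
by rewrite !ExZ// EW EXY; ring.
Qed.

(** [busy_mean] as a function of the epoch; the maximum extends it beyond [H] with values still in
    [0, 1], as the drift estimates require of [g]. *)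
Definition survivor (x : R) : R := 1 - zeta * expR (- (mu * Num.max 0 (H - x))).

Lemma measurable_survivor : measurable_fun setT survivor.
Proof.
apply: measurable_funB => //; apply: measurable_funM => //.
apply: measurableT_comp; first exact: measurable_expR.
apply: measurableT_comp => //; apply: measurable_funM => //.
by apply: measurable_maxr => //; exact: measurable_funB.
Qed.

Lemma survivor01 x : 0 <= survivor x <= 1.
Proof.
have /andP[z0 z1] := zeta01.
have h : 0 <= mu * Num.max 0 (H - x) by rewrite mulr_ge0// le_max lexx.
have [_ /ltW e0 e1 _] := expRN_bounds h.
by rewrite subr_ge0 gerBl mulr_ile1// mulr_ge0.
Qed.

Lemma busy_prodE K w : (M H w <= K)%N ->
  busy_prod K w = (1 - zeta) ^+ number_in_system M tau J H w.
Proof.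
move=> MK; rewrite /number_in_system expr_sum /busy_prod.
rewrite -(big_ord_guard _ (fun i => (1 - zeta) ^+ (H < tau i w + J i w)%R) MK).
apply: eq_bigr => i _; rewrite /busy; case: ifP => _ /=; last by rewrite mulr0 subr0.
by rewrite ltrBlDl; case: (_ < _); rewrite ?mulr1 ?mulr0 ?expr1 ?expr0 ?subr0.
Qed.

Lemma busy_mean_prodE K w : (M H w <= K)%N ->
  busy_mean_prod K w = gprod Q survivor H w.
Proof.
move=> MK; rewrite /gprod /busy_mean_prod.
rewrite -(big_ord_guard _ (fun i => survivor (tau i w)) MK).
apply: eq_bigr => i _; rewrite /busy_mean; case: ifP => iM; last by rewrite mul0r mulr0 subr0.
by rewrite mul1r /survivor max_r// subr_ge0 -countE.
Qed.

Lemma measurable_number : measurable_fun setT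
  (fun w => (number_in_system M tau J H w)%:R : R).
Proof.
rewrite (_ : (fun w => _) = fun w => \sum_(i < M H w) \1_[set w | H < tau i w + J i w] w).
  apply: (@measurable_rand_sum _ T R (M H) (fun i => \1_[set w | H < tau i w + J i w])) => i.
  apply: measurable_guard => [j||]; [exact: measurable_count_lt| |exact: measurable_cst].
  apply: measurable_indic; rewrite -[X in measurable X]setTI.
  have mS : measurable_fun setT (fun w => tau i w + J i w).
    by apply: measurable_funD; exact: measurable_funPT.
  have := measurable_fun_ltr (measurable_cst H) mS measurableT.
  by move=> /(_ [set true] I); congr measurable; apply/seteqP; split.
apply/funext => w; rewrite /number_in_system natr_sum.
by apply: eq_bigr => i _; rewrite indic_bool.
Qed.

Lemma customers_gf :
  Ex P (fun w => (1 - zeta) ^+ number_in_system M tau J H w) = Ex P (gprod Q survivor H).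
Proof.
have mb K : measurable_fun setT (busy_prod K).
  by apply: measurable_finprod => i; exact: measurable_busy.
have mbm K : measurable_fun setT (busy_mean_prod K).
  by apply: measurable_finprod => i; exact: measurable_busy_mean.
have b01 K w : 0 <= busy_prod K w <= 1 by apply: prod01 => i x; exact: busy01.
have bm01 K w : 0 <= busy_mean_prod K w <= 1.
  by apply: prod01 => i x; exact: busy_mean01.
have cvb w : busy_prod K w @[K --> \oo] --> (1 - zeta) ^+ number_in_system M tau J H w.
  by apply: cvg_near_cst; exists (M H w) => // K /= MK; exact: busy_prodE.
have cvbm w : busy_mean_prod K w @[K --> \oo] --> gprod Q survivor H w.
  by apply: cvg_near_cst; exists (M H w) => // K /= MK; exact: busy_mean_prodE.
have L1 : Ex P (busy_prod K) @[K --> \oo] --> Ex P (fun w => (1 - zeta) ^+ number_in_system M tau J H w).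
  apply: (@Ex_dct _ _ _ _ busy_prod _ (fun=> 1)) => //; last first.
  - by move=> K w; have /andP[? ?] := b01 K w; rewrite ger0_norm.
  - exact: Li_cst.
  - by apply: measurable_fun_cvg => //.
have L2 : Ex P (busy_mean_prod K) @[K --> \oo] --> Ex P (gprod Q survivor H).
  apply: (@Ex_dct _ _ _ _ busy_mean_prod _ (fun=> 1)) => //; last first.
  - by move=> K w; have /andP[? ?] := bm01 K w; rewrite ger0_norm.
  - exact: Li_cst.
  - by apply: measurable_gprod => //; exact: measurable_survivor.
rewrite -(cvg_lim (@Rhausdorff R) L1) -(cvg_lim (@Rhausdorff R) L2).
suff -> : (fun K => Ex P (busy_prod K)) = (fun K => Ex P (busy_mean_prod K)) by [].
apply/funext => K.
have e0 i : sigma_gen [set i] J setT by rewrite -(preimage_setT (J i)); exact: service_set.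
have := @service_prod K setT (fun=> setT) 0 (@measurableT _ (g_sigma_algebraType arrivals)) e0.
rewrite big_ord0 mulr1 => h; transitivity (Ex P (fun w => \1_setT w * busy_mean_prod K w)).
  by rewrite -h; apply: eq_Ex => w; rewrite /events big_ord0 mulr1 indicT mul1r.
by apply: eq_Ex => w; rewrite indicT mul1r.
Qed.

End services.

(** * Mean value estimates *)

Lemma MVT_is_derive (R : realType) (F f : R -> R) (x y : R) : x <= y ->
  (forall s, x <= s <= y -> is_derive s 1 F (f s)) ->
  exists2 c, x <= c <= y & F y - F x = f c * (y - x).
Proof.
rewrite le_eqVlt => /predU1P[<-|xy] h.
  by exists x; rewrite ?lexx// !subrr mulr0.
have [||c] := @MVT R F f x y xy.
- by move=> s; rewrite in_itv/= => /andP[/ltW ? /ltW ?]; apply: h; apply/andP.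
- apply: derivable_within_continuous => s; rewrite in_itv/= => hs.
  by have [] := h s hs.
- by rewrite in_itv/= => /andP[/ltW ? /ltW ?] e; exists c => //; apply/andP.
Qed.

Lemma derive_lip (R : realType) (F f : R -> R) (L x y : R) : x <= y ->
  (forall s, x <= s <= y -> is_derive s 1 F (f s)) ->
  (forall s, x <= s <= y -> `|f s| <= L) -> `|F y - F x| <= L * (y - x).
Proof.
move=> xy hF hf; have [c hc ->] := MVT_is_derive xy hF.
by rewrite normrM [X in _ * X]ger0_norm ?subr_ge0// ler_wpM2r ?subr_ge0// hf.
Qed.

(** Expansion at the right endpoint: the coefficients of the functional depend on the remaining time
    H - t, which decreases when t increases. *)
Lemma taylor_backward (R : realType) (F f : R -> R) (L x y : R) : x <= y ->
  (forall s, x <= s <= y -> is_derive s 1 F (f s)) ->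
  (forall s, x <= s <= y -> `|f s - f y| <= L * (y - s)) -> 0 <= L ->
  `|F x - F y + (y - x) * f y| <= L * (y - x) ^+ 2.
Proof.
move=> xy hF hf L0; have [c hc e] := MVT_is_derive xy hF.
have /andP[xc cy] := hc.
have -> : F x - F y + (y - x) * f y = - ((f c - f y) * (y - x)).
  by rewrite -[F x - F y]opprB e; ring.
rewrite normrN normrM [X in _ * X]ger0_norm ?subr_ge0// expr2 mulrA.
rewrite ler_wpM2r ?subr_ge0//; apply: le_trans (hf c hc) _.
by rewrite ler_wpM2l// lerD2l lerN2.
Qed.

(** * Generating function bounds *)

Section logistic.
Variable R : realType.
Variables (delta kappa q mu : R).
Hypotheses (delta0 : 0 < delta) (kappa0 : 0 < kappa) (q0 : 0 < q) (mu0 : 0 < mu).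
Hypothesis rates : delta + kappa * q <= mu.

(* logi solves y' = - delta y - kappa y^2, y(0) = q. *)
Definition logi_den (s : R) : R := (delta + kappa * q) * expR (delta * s) - kappa * q.
Definition logi (s : R) : R := delta * q / logi_den s.
(** The derivative of [logi_den] is delta (logi_den + kappa q), so its logarithmic derivative is
    delta + kappa [logi]; the constant [ln delta] makes the primitive vanish at 0. *)
Definition logi_primitive (s : R) : R :=
  (ln (logi_den s) - ln delta - delta * s) / kappa.

Let kq0 : 0 < kappa * q. Proof. exact: mulr_gt0. Qed.
Let delta_ge0 : 0 <= delta. Proof. exact: ltW. Qed.
Let kappa_ge0 : 0 <= kappa. Proof. exact: ltW. Qed.
Let q_ge0 : 0 <= q. Proof. exact: ltW. Qed.
Let mu_ge0 : 0 <= mu. Proof. exact: ltW. Qed.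

Lemma logi_den_ge s : 0 <= s -> delta <= logi_den s.
Proof.
move=> s0; have : 1 <= expR (delta * s) by rewrite -expR0 ler_expR mulr_ge0// ltW.
by rewrite /logi_den; have := kq0; have := delta0; nra.
Qed.

Lemma logi_den_gt0 s : 0 <= s -> 0 < logi_den s.
Proof. by move=> s0; apply: lt_le_trans delta0 _; exact: logi_den_ge. Qed.

Lemma is_derive_logi_den (s : R) :
  is_derive s 1 logi_den (delta * (logi_den s + kappa * q)).
Proof.
rewrite /logi_den subrK.
apply: is_derive_eq; rewrite /GRing.scale /= ?mulr1 ?mulr0 ?addr0 ?add0r ?subr0; ring.
Qed.

Lemma is_derive_logi (s : R) : 0 <= s ->
  is_derive s 1 logi (- (delta * logi s) - kappa * logi s ^+ 2).
Proof.
move=> s0; have d0 := logi_den_gt0 s0; have dn0 : logi_den s != 0 by rewrite gt_eqF.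
have hd := is_derive_logi_den s.
have h : is_derive s 1 logi _ := is_deriveZ (delta * q) (is_deriveV dn0 hd).
apply: (is_derive_eq h); rewrite /logi /GRing.scale /=.
by field.
Qed.

Lemma is_derive_logi_primitive (s : R) : 0 <= s -> is_derive s 1 logi_primitive (logi s).
Proof.
move=> s0; have d0 := logi_den_gt0 s0; have dn0 : logi_den s != 0 by rewrite gt_eqF.
have hd := is_derive_logi_den s.
have hl := is_derive1_comp (is_derive1_ln d0) hd.
have h1 : is_derive s 1 (fun x => delta * x) delta.
  by apply: is_derive_eq; rewrite /GRing.scale /= ?mulr1.
have h2 := is_deriveB (is_deriveB hl (is_derive_cst (ln delta) s 1)) h1.
have h := is_deriveZ kappa^-1 h2.
have -> : logi_primitive = kappa^-1 \*: ((@ln R \o logi_den) - cst (ln delta) - (fun x => delta * x)).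
  by apply/funext => x; rewrite /logi_primitive mulrC.
apply: (is_derive_eq h); rewrite /logi /GRing.scale /= subr0.
by field; rewrite dn0 gt_eqF.
Qed.

Lemma logi_bounds s : 0 <= s -> 0 < logi s <= q.
Proof.
move=> s0; have d0 := logi_den_gt0 s0; rewrite /logi divr_gt0//=; last exact: mulr_gt0.
by rewrite ler_pdivrMr// mulrC ler_wpM2l ?(ltW q0)// logi_den_ge.
Qed.

(** The logarithmic derivative of y is -(delta + kappa y) >= -(delta + kappa q) >= -mu, so y decays
    no faster than q e^(-mu s). This makes [dual] nonnegative and is the purpose of [rates]. The
    proof checks it on the explicit solution, using only 1 + x <= e^x. *)
Lemma logi_ge s : 0 <= s -> q * expR (- (mu * s)) <= logi s.
Proof.
move=> s0; have d0 := logi_den_gt0 s0.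
rewrite /logi ler_pdivlMr// expRN mulrAC ler_pdivrMr ?expR_gt0//.
rewrite (mulrC delta) -!mulrA ler_wpM2l ?(ltW q0)//.
have e1 : expR (- (delta * s)) * expR (delta * s) = 1 by rewrite -expRD addNr expR0.
have E0 := expR_gt0 (delta * s); have En0 := expR_gt0 (- (delta * s)).
rewrite -(ler_pM2l En0).
have -> : expR (- (delta * s)) * logi_den s = delta + kappa * q * (1 - expR (- (delta * s))).
  by rewrite /logi_den mulrBr mulrCA e1; ring.
have h1 : 1 - delta * s <= expR (- (delta * s)) by exact: expR_ge1Dx.
have h2 : 1 + kappa * q * s <= expR (- (delta * s)) * expR (mu * s).
  apply: le_trans (expR_ge1Dx (kappa * q * s)) _; rewrite -expRD ler_expR.
  by have := ler_wpM2r s0 rates; rewrite mulrDl; lra.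
rewrite mulrCA; apply: le_trans (_ : delta * (1 + kappa * q * s) <= _); last first.
  by rewrite ler_wpM2l ?(ltW delta0).
by have := ler_wpM2l (ltW kq0) h1; nra.
Qed.

Definition dual (s : R) : R := logi s - q * expR (- (mu * s)).
Definition ddual (s : R) : R :=
  - (delta * logi s) - kappa * logi s ^+ 2 + mu * q * expR (- (mu * s)).
Definition dual_primitive (s : R) : R :=
  logi_primitive s - q / mu * (1 - expR (- (mu * s))).

Lemma is_derive_expRN (s : R) : is_derive s 1 (fun x : R => expR (- (mu * x))) (- mu * expR (- (mu * s))).
Proof. by apply: is_derive_eq; rewrite /GRing.scale /= ?mulr1; ring. Qed.

Lemma is_derive_dual (s : R) : 0 <= s -> is_derive s 1 dual (ddual s).
Proof.
move=> s0; have h := is_deriveB (is_derive_logi s0) (is_deriveZ q (is_derive_expRN s)).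
apply: (is_derive_eq h); rewrite /ddual /GRing.scale /=; ring.
Qed.

Lemma is_derive_dual_primitive (s : R) : 0 <= s -> is_derive s 1 dual_primitive (dual s).
Proof.
move=> s0.
have h := is_deriveB (is_derive_logi_primitive s0)
  (is_deriveZ (q / mu) (is_deriveB (is_derive_cst (1 : R) s 1) (is_derive_expRN s))).
apply: (is_derive_eq h); rewrite /dual /GRing.scale /= sub0r.
by field; rewrite gt_eqF.
Qed.

Lemma expRN_mu s : 0 <= s -> 0 < expR (- (mu * s)) <= 1.
Proof.
move=> s0; rewrite expR_gt0 -expR0 ler_expR oppr_le0 mulr_ge0//; exact: ltW.
Qed.

Lemma dual_bounds s : 0 <= s -> 0 <= dual s <= q.
Proof.
move=> s0; have h1 := logi_ge s0; have /andP[h2 h3] := logi_bounds s0.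
have /andP[e0 e1] := expRN_mu s0.
rewrite /dual subr_ge0 h1/= lerBlDr (le_trans h3)// lerDl mulr_ge0 ?ltW//.
Qed.

Lemma dual0 : dual 0 = 0.
Proof.
rewrite /dual /logi /logi_den !mulr0 oppr0 expR0 !mulr1 addrK.
by field; rewrite gt_eqF.
Qed.

Lemma dual_primitive0 : dual_primitive 0 = 0.
Proof.
rewrite /dual_primitive /logi_primitive /logi_den !mulr0 oppr0 expR0 mulr1 addrK.
by rewrite !subrr addr0 mul0r mulr0 subrr.
Qed.

Lemma dual_primitive_ge0 s : 0 <= s -> 0 <= dual_primitive s.
Proof.
move=> s0; have [|c /andP[c0 _]] := @MVT_is_derive R dual_primitive dual 0 s s0.
  by move=> x /andP[x0 _]; exact: is_derive_dual_primitive.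
rewrite dual_primitive0 subr0 subr0 => ->; rewrite mulr_ge0//.
by have /andP[] := dual_bounds c0.
Qed.

Lemma logi_lip x y : 0 <= x -> x <= y -> `|logi y - logi x| <= (delta * q + kappa * q ^+ 2) * (y - x).
Proof.
move=> x0 xy; apply: derive_lip (xy) (fun s hs => is_derive_logi (le_trans x0 (andP hs).1)) _.
move=> s /andP[xs _]; have /andP[/ltW h1 h2] := logi_bounds (le_trans x0 xs).
rewrite -opprD normrN ger0_norm; last first.
  by apply: addr_ge0; apply: mulr_ge0 => //; exact: sqr_ge0.
rewrite lerD// ler_wpM2l //.
by rewrite ler_sqr ?nnegrE.
Qed.

Lemma expRN_mu_lip x y : 0 <= x -> x <= y ->
  `|expR (- (mu * y)) - expR (- (mu * x))| <= mu * (y - x).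
Proof.
move=> x0 xy; have m0 := ltW mu0.
have y0 := le_trans x0 xy.
apply: le_trans (expRN_lip _ _) _; [exact: mulr_ge0|exact: mulr_ge0|].
by rewrite -mulrBr ge_min ger0_norm ?mulr_ge0 ?subr_ge0// lexx orbT.
Qed.

Definition dual_const : R := delta * q + kappa * q ^+ 2 + mu * q.

Lemma dual_const_ge0 : 0 <= dual_const.
Proof. by rewrite /dual_const !addr_ge0 ?mulr_ge0 ?sqr_ge0. Qed.

Lemma ddual_bound s : 0 <= s -> `|ddual s| <= dual_const.
Proof.
move=> s0; have /andP[/ltW h1 h2] := logi_bounds s0; have /andP[/ltW e0 e1] := expRN_mu s0.
rewrite /ddual /dual_const -opprD; apply: le_trans (ler_normD _ _) _.
rewrite normrN ger0_norm; last first.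
  by apply: addr_ge0; apply: mulr_ge0 => //; exact: sqr_ge0.
rewrite lerD//; last by rewrite ger0_norm ?ler_piMr ?mulr_ge0.
rewrite lerD// ler_wpM2l //.
by rewrite ler_sqr ?nnegrE.
Qed.

Lemma dual_lip x y : 0 <= x -> x <= y -> `|dual y - dual x| <= dual_const * (y - x).
Proof.
move=> x0 xy; apply: derive_lip (xy) (fun s hs => is_derive_dual (le_trans x0 (andP hs).1)) _.
by move=> s /andP[xs _]; apply: ddual_bound; exact: le_trans xs.
Qed.

Definition ddual_const : R :=
  (delta + 2 * kappa * q) * (delta * q + kappa * q ^+ 2) + mu ^+ 2 * q.

Lemma ddual_const_ge0 : 0 <= ddual_const.
Proof. by rewrite /ddual_const !addr_ge0 ?mulr_ge0 ?addr_ge0 ?mulr_ge0 ?sqr_ge0. Qed.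

Lemma ddual_lip x y : 0 <= x -> x <= y -> `|ddual x - ddual y| <= ddual_const * (y - x).
Proof.
move=> x0 xy; have y0 := le_trans x0 xy.
have /andP[/ltW a1 a2] := logi_bounds x0; have /andP[/ltW b1 b2] := logi_bounds y0.
have -> : ddual x - ddual y = (delta + kappa * (logi y + logi x)) * (logi y - logi x)
   - mu * q * (expR (- (mu * y)) - expR (- (mu * x))) by rewrite /ddual; ring.
apply: le_trans (ler_normB _ _) _; rewrite /ddual_const [leRHS]mulrDl; apply: lerD.
  rewrite normrM -mulrA; apply: ler_pM => //; last exact: logi_lip.
  rewrite ger0_norm ?addr_ge0 ?mulr_ge0 ?addr_ge0//.
  by rewrite lerD2l [2 * _]mulrC -mulrA ler_wpM2l//; lra.
rewrite normrM ger0_norm ?mulr_ge0//.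
apply: le_trans (ler_wpM2l _ (expRN_mu_lip x0 xy)) _; first by rewrite mulr_ge0.
by rewrite le_eqVlt; apply/orP; left; apply/eqP; ring.
Qed.

End logistic.

(** * Laplace transform of the mark law *)

Section mark_laplace_bounds.
Variables (R : realType) (nu : probability R R).
Hypothesis nu_gt0 : nu `]0, +oo[%classic = 1%E.
Hypothesis nu_int : Li nu (fun x : R => x).
Hypothesis nu_int2 : Li nu (fun x : R => x ^+ 2).

Lemma ae_nu_gt0 : {ae nu, forall x : R, 0 < x}.
Proof.
have mI : measurable (`]0, +oo[%classic : set R) by exact: measurable_itv.
exists (~` `]0, +oo[%classic); split.
- exact: measurableC.
- have e : nu (~` `]0, +oo[%classic) = 0%E; last exact: e.
  by rewrite probability_setC// nu_gt0 subee.
- by move=> x /=; rewrite in_itv/= andbT.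
Qed.

Lemma Ex_nu_pos (f g : R -> R) : Li nu f -> measurable_fun setT g ->
  (forall x, 0 < x -> f x = g x) -> Li nu g /\ Ex nu f = Ex nu g.
Proof.
by move=> iF mg fg; apply: Ex_ae => //; apply: filterS ae_nu_gt0 => x; exact: fg.
Qed.

Lemma mark_mean_pos : Li nu (fun x : R => Num.max 0 x) /\
  mark_mean nu = Ex nu (fun x : R => Num.max 0 x).
Proof.
by apply: Ex_nu_pos nu_int _ _ => [|x x0]; [exact: measurable_maxr|rewrite max_r// ltW].
Qed.

Lemma mark_moment2_pos : Li nu (fun x : R => Num.max 0 x ^+ 2) /\
  mark_moment2 nu = Ex nu (fun x : R => Num.max 0 x ^+ 2).
Proof.
apply: Ex_nu_pos nu_int2 _ _ => [|x x0]; last by rewrite max_r// ltW.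
by apply: measurable_funX; exact: measurable_maxr.
Qed.

Lemma mark_mean_gt0 : 0 < mark_mean nu.
Proof.
have [im ->] := mark_mean_pos.
rewrite lt_neqAle Ex_ge0 ?andbT; last by move=> x; rewrite le_max lexx.
apply/negP => /eqP e.
have h : (\int[nu]_x (Num.max 0 x)%:E = 0)%E by rewrite -ExE// -e.
have mm : measurable_fun setT (fun x : R => (Num.max 0 x)%:E).
  by apply/measurable_EFinP; exact: measurable_maxr.
have h' : (\int[nu]_x `|(Num.max 0 x)%:E| = 0)%E.
  rewrite -h; apply: eq_integral => x _.
  by rewrite gee0_abs// lee_fin le_max lexx.
have /(ae_eq_integral_abs nu measurableT mm) ae0 := h'.
have : {ae nu, forall x : R, False}.
  apply: filterS2 ae0 ae_nu_gt0 => x /(_ I) [] /=.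
  by move=> e0 x0; move: e0; rewrite max_r ?ltW// => e0; rewrite e0 ltxx in x0.
move=> [A [mA A0 hA]].
have : (nu setT <= nu A)%E by apply: le_measure; rewrite ?inE// => x _; exact: hA.
by rewrite [X in (_ <= X)%E]A0 [X in (X <= _)%E]probability_setT lee_fin ler10.
Qed.

Lemma Li_laplace x : 0 <= x -> Li nu (fun b : R => expR (- (x * Num.max 0 b))).
Proof.
move=> x0; apply: (@Li_bounded _ _ _ _ _ 1).
  apply: measurableT_comp; first exact: measurable_expR.
  apply: measurableT_comp => //; apply: measurable_funM => //; exact: measurable_maxr.
move=> b; have h : 0 <= x * Num.max 0 b by rewrite mulr_ge0// le_max lexx.
by have [_ /ltW ? ? _] := expRN_bounds h; rewrite ger0_norm.
Qed.

Lemma mark_laplace_le1 x : 0 <= x -> mark_laplace nu x <= 1.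
Proof.
move=> x0; rewrite -[leRHS](Ex_cst nu); apply: le_Ex; [exact: Li_laplace|exact: Li_cst|] => b.
have h : 0 <= x * Num.max 0 b by rewrite mulr_ge0// le_max lexx.
by have [] := expRN_bounds h.
Qed.

Lemma expRN_le2 (h : R) : 0 <= h -> expR (- h) <= 1 - h + h ^+ 2 / 2.
Proof.
move=> h0.
have [|c /andP[c0 ch] e] := @MVT_is_derive R (fun x => 1 - x + x ^+ 2 / 2 - expR (- x))
   (fun x => - 1 + x + expR (- x)) 0 h h0.
  by move=> s _; apply: is_derive_eq; rewrite /GRing.scale /= ?mulr1; field.
have e0 : 1 - 0 + 0 ^+ 2 / 2 - expR (- 0) = 0 :> R.
  by rewrite subr0 oppr0 expR0 expr0n mul0r addr0 subrr.
rewrite -subr_ge0; move: e; rewrite e0 !subr0 => ->; rewrite mulr_ge0//.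
by have := expR_ge1Dx (- c); lra.
Qed.

(** Valid for all x >= 0 with the exact coefficient b2 / 2; only the lower bound will have to
    perturb it. *)
Lemma mark_laplace_le x : 0 <= x ->
  mark_laplace nu x <= 1 - mark_mean nu * x + mark_moment2 nu / 2 * x ^+ 2.
Proof.
move=> x0; have [im ->] := mark_mean_pos; have [im2 ->] := mark_moment2_pos.
have -> : 1 - Ex nu (fun b : R => Num.max 0 b) * x +
    Ex nu (fun b : R => Num.max 0 b ^+ 2) / 2 * x ^+ 2 =
  Ex nu (fun b : R => (1 - x * Num.max 0 b) + x ^+ 2 / 2 * Num.max 0 b ^+ 2).
  rewrite ExD; [|by apply: LiB; [exact: Li_cst|exact: LiZ]|exact: LiZ].
  rewrite ExB; [|exact: Li_cst|exact: LiZ].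
  by rewrite Ex_cst !ExZ//; ring.
apply: le_Ex; [exact: Li_laplace|apply: LiD; [|exact: LiZ]|].
  by apply: LiB; [exact: Li_cst|exact: LiZ].
move=> b; have h : 0 <= x * Num.max 0 b by rewrite mulr_ge0// le_max lexx.
by apply: le_trans (expRN_le2 h) _; rewrite exprMn lerD2l mulrAC.
Qed.

End mark_laplace_bounds.

Section generating_function_bounds.
Context d (T : measurableType d) (R : realType) (P : probability T R).
Variables (lambda a mu : R) (nu : probability R R).
Variable Q : hawkes_queue P lambda nu (exp_decay a) (exp_decay mu).
Hypotheses (lambda0 : 0 <= lambda) (a0 : 0 < a) (mu0 : 0 < mu).
Hypothesis nu_gt0 : nu `]0, +oo[%classic = 1%E.
Hypothesis nu_int : Li nu (fun x : R => x).
Variables (zeta kappa q : R).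
Let delta : R := a - mark_mean nu.
Hypotheses (zeta01 : 0 <= zeta <= 1) (delta0 : 0 < delta) (kappa0 : 0 < kappa) (q0 : 0 < q).
Hypothesis rates : delta + kappa * q <= mu.
Variable H : R.
Hypothesis H0 : 0 <= H.

Local Notation M := (hq_count Q).
Local Notation tau := (hq_epoch Q).
Local Notation J := (hq_service Q).
Local Notation dual := (dual delta kappa q mu).
Local Notation ddual := (ddual delta kappa q mu).
Local Notation dual_primitive := (dual_primitive delta kappa q mu).
Local Notation dual_const := (dual_const delta kappa q mu).
Local Notation ddual_const := (ddual_const delta kappa q mu).

(** In the remaining time s = H - t the condition C' = al' - a al reads exponent' = dual' + a dual;
    starting from 0 at s = 0 it integrates to this formula. *)
Definition exponent (s : R) : R := dual s + a * dual_primitive s.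

Let al t := dual (H - t).
Let C t := exponent (H - t).
Let beta t := - ddual (H - t) - a * dual (H - t).
Let g := survivor mu H zeta.
(** One constant for all the estimates that the drift requires: a sum of nonnegative terms, of which
    each estimate uses a few. *)
Let K := 1 + ddual_const + q * a ^+ 2 + a * dual_const + q * a + dual_const + zeta * mu.

Let dc0 : 0 <= dual_const. Proof. exact: dual_const_ge0. Qed.
Let ddc0 : 0 <= ddual_const. Proof. exact: ddual_const_ge0. Qed.
Let a_ge0 : 0 <= a. Proof. exact: ltW. Qed.
Let q_ge0 : 0 <= q. Proof. exact: ltW. Qed.
Let mu_ge0 : 0 <= mu. Proof. exact: ltW. Qed.
Let zeta0 : 0 <= zeta. Proof. by case/andP : zeta01. Qed.

Let qa0 : 0 <= q * a. Proof. exact: mulr_ge0. Qed.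
Let qa20 : 0 <= q * a ^+ 2. Proof. by rewrite mulr_ge0// sqr_ge0. Qed.
Let adc0 : 0 <= a * dual_const. Proof. exact: mulr_ge0. Qed.
Let zm0 : 0 <= zeta * mu. Proof. exact: mulr_ge0. Qed.

Let K_parts : [/\ ddual_const + q * a ^+ 2 + a * dual_const <= K,
  q * a + dual_const <= K, zeta * mu <= K & 1 <= K].
Proof.
move: dc0 ddc0 qa0 qa20 adc0 zm0; rewrite /K.
set x1 := ddual_const; set x2 := q * a ^+ 2; set x3 := a * dual_const.
set x4 := q * a; set x5 := dual_const; set x6 := zeta * mu.
by move=> *; split; lra.
Qed.

Lemma K_ge1 : 1 <= K. Proof. by case: K_parts. Qed.

Lemma dual_step t D : 0 <= t -> 0 < D -> t + D <= H ->
  `|al (t + D) - al t| <= dual_const * D.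
Proof.
move=> t0 D0 tD; rewrite distrC /al.
have h1 : 0 <= H - (t + D) by rewrite subr_ge0.
have h2 : H - (t + D) <= H - t by rewrite lerD2l lerN2 lerDl ltW.
apply: le_trans (dual_lip delta0 kappa0 q0 mu0 h1 h2) _.
by rewrite le_eqVlt; apply/orP; left; apply/eqP; ring.
Qed.

Lemma dual_step2 t D : 0 <= t -> 0 < D -> t + D <= H ->
  `|al (t + D) - al t + D * ddual (H - t)| <= ddual_const * D ^+ 2.
Proof.
move=> t0 D0 tD.
have h1 : 0 <= H - (t + D) by rewrite subr_ge0.
have h2 : H - (t + D) <= H - t by rewrite lerD2l lerN2 lerDl ltW.
have := @taylor_backward R dual ddual ddual_const (H - (t + D)) (H - t) h2.
have -> : H - t - (H - (t + D)) = D by ring.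
apply => //.
- by move=> s /andP[hs _]; apply: is_derive_dual => //; exact: le_trans hs.
- by move=> s /andP[hs hs']; apply: ddual_lip => //; exact: le_trans hs.
Qed.

Lemma primitive_step2 t D : 0 <= t -> 0 < D -> t + D <= H ->
  `|dual_primitive (H - (t + D)) - dual_primitive (H - t) + D * al t| <= dual_const * D ^+ 2.
Proof.
move=> t0 D0 tD.
have h1 : 0 <= H - (t + D) by rewrite subr_ge0.
have h2 : H - (t + D) <= H - t by rewrite lerD2l lerN2 lerDl ltW.
have := @taylor_backward R dual_primitive dual dual_const (H - (t + D)) (H - t) h2.
have -> : H - t - (H - (t + D)) = D by ring.
apply => //.
- by move=> s /andP[hs _]; apply: is_derive_dual_primitive => //; exact: le_trans hs.
- move=> s /andP[hs hs']; rewrite distrC; apply: dual_lip => //; exact: le_trans hs.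
Qed.

Lemma al_bounds t : 0 <= t <= H -> 0 <= al t <= q.
Proof. by move=> /andP[t0 tH]; apply: dual_bounds => //; rewrite subr_ge0. Qed.

Lemma expRN_step (s D : R) : 0 <= s <= D -> `|expR (- (a * s)) - 1| <= a * D.
Proof.
move=> /andP[s0 sD]; have h : 0 <= a * s by rewrite mulr_ge0.
have := expRN_lip (lexx 0) h; rewrite oppr0 expR0 addr0 => e; apply: le_trans e _.
by rewrite ge_min ger0_norm// ler_wpM2l ?orbT.
Qed.

Lemma g_lip' x y : 0 <= x -> x <= y -> y <= H -> `|g y - g x| <= K * (y - x).
Proof.
move=> x0 xy yH; have xH := le_trans xy yH.
rewrite /g /survivor !max_r ?subr_ge0//.
have -> : 1 - zeta * expR (- (mu * (H - y))) - (1 - zeta * expR (- (mu * (H - x)))) =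
  zeta * (expR (- (mu * (H - x))) - expR (- (mu * (H - y)))) by ring.
rewrite normrM (ger0_norm zeta0).
have h1 : 0 <= H - y by rewrite subr_ge0.
have h2 : H - y <= H - x by rewrite lerD2l lerN2.
apply: le_trans (ler_wpM2l zeta0 (expRN_mu_lip mu0 h1 h2)) _.
have -> : zeta * (mu * (H - x - (H - y))) = zeta * mu * (y - x) by ring.
by rewrite ler_wpM2r ?subr_ge0//; case: K_parts.
Qed.

Lemma al_lip' t D s : 0 <= t -> 0 < D <= 1 -> t + D <= H -> 0 <= s <= D ->
  `|al (t + D) * expR (- (a * s)) - al t| <= K * D.
Proof.
move=> t0 /andP[D0 D1] tD sD.
have tDH : 0 <= t + D <= H by rewrite tD addr_ge0// ltW.
have /andP[l0 l1] := al_bounds tDH.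
have -> : al (t + D) * expR (- (a * s)) - al t =
  al (t + D) * (expR (- (a * s)) - 1) + (al (t + D) - al t) by ring.
apply: le_trans (ler_normD _ _) _; rewrite normrM (ger0_norm l0).
have h1 : al (t + D) * `|expR (- (a * s)) - 1| <= q * (a * D).
  by apply: ler_pM => //; exact: expRN_step.
have h2 := dual_step t0 D0 tD.
apply: le_trans (lerD h1 h2) _; rewrite mulrA -mulrDl.
by rewrite ler_wpM2r ?(ltW D0)//; case: K_parts.
Qed.

Lemma al_taylor' t D : 0 <= t -> 0 < D <= 1 -> t + D <= H ->
  `|al (t + D) * expR (- (a * D)) - al t - D * beta t| <= K * D ^+ 2.
Proof.
move=> t0 /andP[D0 D1] tD; have D0' := ltW D0.
have tDH : 0 <= t + D <= H by rewrite tD addr_ge0// ltW.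
have /andP[l0 l1] := al_bounds tDH.
have -> : al (t + D) * expR (- (a * D)) - al t - D * beta t =
  (al (t + D) - al t + D * ddual (H - t)) + al (t + D) * (expR (- (a * D)) - 1 + a * D)
  - a * D * (al (t + D) - al t) by rewrite /beta -/(al t); ring.
have h1 := dual_step2 t0 D0 tD.
have h2 : `|al (t + D) * (expR (- (a * D)) - 1 + a * D)| <= q * a ^+ 2 * D ^+ 2.
  rewrite normrM (ger0_norm l0) -mulrA; apply: ler_pM => //.
  have aD : 0 <= a * D by rewrite mulr_ge0.
  have := expRN_taylor (lexx 0) aD; rewrite oppr0 expR0 addr0 mul1r => e.
  apply: le_trans e _; rewrite ger0_norm// -exprMn expr2 ler_wpM2l//.
  by rewrite ge_min lexx orbT.
have h3 : `|a * D * (al (t + D) - al t)| <= a * dual_const * D ^+ 2.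
  rewrite normrM ger0_norm ?mulr_ge0//.
  have aD : 0 <= a * D by rewrite mulr_ge0.
  apply: le_trans (ler_wpM2l aD (dual_step t0 D0 tD)) _.
  by rewrite le_eqVlt; apply/orP; left; apply/eqP; ring.
apply: le_trans (ler_normB _ _) _; apply: le_trans (lerD (ler_normD _ _) (lexx _)) _.
apply: le_trans (lerD (lerD h1 h2) h3) _.
by rewrite -!mulrDl ler_wpM2r ?sqr_ge0//; case: K_parts.
Qed.

Lemma C_taylor' t D : 0 <= t -> 0 < D <= 1 -> t + D <= H ->
  `|C (t + D) - C t - D * beta t| <= K * D ^+ 2.
Proof.
move=> t0 /andP[D0 D1] tD.
have -> : C (t + D) - C t - D * beta t =
  (al (t + D) - al t + D * ddual (H - t)) +
  a * (dual_primitive (H - (t + D)) - dual_primitive (H - t) + D * al t).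
  by rewrite /C /exponent /beta /al; ring.
have h1 := dual_step2 t0 D0 tD.
apply: le_trans (ler_normD _ _) _; rewrite [X in _ + X]normrM (ger0_norm a_ge0).
apply: le_trans (lerD h1 (ler_wpM2l a_ge0 (primitive_step2 t0 D0 tD))) _.
rewrite [a * _]mulrA -mulrDl ler_wpM2r ?sqr_ge0//; case: K_parts => h _ _ _.
by apply: le_trans h; rewrite lerD2r lerDl.
Qed.

Lemma beta_bound' t : 0 <= t <= H -> `|beta t| <= K.
Proof.
move=> tH; have /andP[l0 l1] := al_bounds tH; have /andP[t0 t1] := tH.
rewrite /beta -opprD normrN; apply: le_trans (ler_normD _ _) _.
have h1 : `|ddual (H - t)| <= dual_const by apply: ddual_bound => //; rewrite subr_ge0.
have h2 : `|a * dual (H - t)| <= q * a.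
  by rewrite normrM (ger0_norm a_ge0) (ger0_norm l0) mulrC ler_wpM2r.
by apply: le_trans (lerD h1 h2) _; rewrite addrC; case: K_parts.
Qed.

Lemma al_ge0' t : 0 <= t <= H -> 0 <= al t.
Proof. by move=> /al_bounds/andP[]. Qed.

Lemma C_ge0' t : 0 <= t <= H -> 0 <= C t.
Proof.
move=> tH; rewrite /C /exponent addr_ge0 ?al_ge0'// mulr_ge0//.
by apply: dual_primitive_ge0 => //; rewrite subr_ge0; case/andP : tH.
Qed.

Let psi' := psi nu g al beta.

(** With y = al + q e^(-mu s), s = H - t, and a - delta = b1, the equation for y leaves b1 al -
    kappa y^2 in the drift, which is to cancel the expansion of [mark_laplace]. The part q e^(-mu s)
    of [dual] adds the last term, which is to balance zeta e^(-mu s). *)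
Lemma psiE t : 0 <= t <= H -> psi' t =
  (1 - zeta * expR (- (mu * (H - t)))) * mark_laplace nu (al t) - 1 +
  mark_mean nu * al t - kappa * logi delta kappa q (H - t) ^+ 2 +
  (mu - delta) * q * expR (- (mu * (H - t))).
Proof.
move=> /andP[t0 tH]; rewrite /psi' /psi /beta /g /survivor max_r ?subr_ge0//.
rewrite /al /ddual /dual /delta; ring.
Qed.

Let logiE t : logi delta kappa q (H - t) = al t + q * expR (- (mu * (H - t))).
Proof. by rewrite /al /dual subrK. Qed.

(** After the lower bound on [mark_laplace] every remaining term has the factor e = e^(-mu (H - t)).
    The cross term kappa (y^2 - al^2) = kappa q e (2 al + q e) is at most 2 kappa q^2 e because y <=
    q; the second condition says that (mu - delta) q outweighs it together with zeta. *)
Lemma gf_lower :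
  (forall x, 0 <= x <= q -> 1 - mark_mean nu * x + kappa * x ^+ 2 <= mark_laplace nu x) ->
  zeta + 2 * kappa * q ^+ 2 <= (mu - delta) * q ->
  expR (- (lambda * exponent H)) <=
  Ex P (fun w => (1 - zeta) ^+ number_in_system M tau J H w).
Proof.
move=> hphi hq.
have psi0 t : 0 <= t <= H -> 0 <= psi' t.
  move=> tH; rewrite psiE// logiE; have /andP[l0 l1] := al_bounds tH.
  have /andP[t0 tH'] := tH.
  have Ht : 0 <= H - t by rewrite subr_ge0.
  have /andP[e0 e1] := expRN_mu mu0 Ht.
  have := hphi _ (al_bounds tH); have := mark_laplace_le1 nu l0.
  set x := al t in l0 l1 *; set f := mark_laplace nu x; set y := expR _ in e0 e1 *.
  move=> f1 f2.
  have /andP[lg0 lg1] := logi_bounds delta0 kappa0 q0 Ht.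
  have lq : x + q * y <= q by have := lg1; rewrite logiE.
  have h1 : zeta * y * f <= zeta * y by rewrite ler_piMr// mulr_ge0// ltW.
  have h2 : kappa * (q * y) * (2 * x + q * y) <= 2 * kappa * q ^+ 2 * y.
    have -> : 2 * kappa * q ^+ 2 * y = kappa * (q * y) * (2 * q) by ring.
    rewrite ler_wpM2l ?mulr_ge0 ?(ltW kappa0) ?(ltW e0)//.
    by have : 0 <= q * y by [rewrite mulr_ge0// ltW]; lra.
  have h3 : (zeta + 2 * kappa * q ^+ 2) * y <= (mu - delta) * q * y.
    by rewrite ler_wpM2r// ltW.
  nra.
have := @drift_submartingale _ _ _ _ _ _ _ _ Q lambda0 a_ge0 nu_gt0 nu_int H K g al C beta
  H0 K_ge1 (measurable_survivor _ _ _) (survivor01 mu_ge0 H zeta01) g_lip'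
  al_ge0' C_ge0' beta_bound' al_taylor' C_taylor' al_lip' psi0.
rewrite Ex_Zt0 Ex_ZtH; [|by rewrite /al subrr dual0|].
  by rewrite /C subr0 (customers_gf Q mu_ge0 H0 zeta01).
by rewrite /C subrr /exponent dual0// dual_primitive0// mulr0 addr0.
Qed.

(** The cross terms now have the favourable sign and are dropped, except zeta e b1 al <= zeta e b1
    q, which accounts for the middle term of the second condition. *)
Lemma gf_upper :
  (forall x, 0 <= x <= q -> mark_laplace nu x <= 1 - mark_mean nu * x + kappa * x ^+ 2) ->
  (mu - delta) * q + zeta * mark_mean nu * q <= zeta ->
  Ex P (fun w => (1 - zeta) ^+ number_in_system M tau J H w) <=
  expR (- (lambda * exponent H)).
Proof.
move=> hphi hq.
have b0 : 0 <= mark_mean nu by apply: ltW; exact: mark_mean_gt0.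
have psi0 t : 0 <= t <= H -> psi' t <= 0.
  move=> tH; rewrite psiE// logiE; have /andP[l0 l1] := al_bounds tH.
  have /andP[t0 tH'] := tH.
  have Ht : 0 <= H - t by rewrite subr_ge0.
  have /andP[e0 e1] := expRN_mu mu0 Ht.
  have := hphi _ (al_bounds tH).
  set x := al t in l0 l1 *; set f := mark_laplace nu x; set y := expR _ in e0 e1 *.
  move=> f2; set b := mark_mean nu in b0 f2 hq *.
  have zy0 : 0 <= zeta * y by rewrite mulr_ge0// ltW.
  have zy1 : zeta * y <= 1 by case/andP : zeta01 => ? ?; rewrite mulr_ile1// ltW.
  have h1 : (1 - zeta * y) * f <= (1 - zeta * y) * (1 - b * x + kappa * x ^+ 2).
    by rewrite ler_wpM2l// subr_ge0.
  have h2 : 0 <= zeta * y * (kappa * x ^+ 2) by rewrite !mulr_ge0 ?sqr_ge0// ltW.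
  have h3 : ((mu - delta) * q + zeta * b * q) * y <= zeta * y by rewrite ler_wpM2r// ltW.
  have h4 : zeta * y * (b * x) <= zeta * y * (b * q) by rewrite !ler_wpM2l.
  have h5 : 0 <= kappa * (q * y) * (2 * x + q * y).
    have y0 := ltW e0; have k0 := ltW kappa0.
    have qy : 0 <= q * y by exact: mulr_ge0.
    by apply: mulr_ge0; [exact: mulr_ge0|lra].
  nra.
have := @drift_supermartingale _ _ _ _ _ _ _ _ Q lambda0 a_ge0 nu_gt0 nu_int H K g al C beta
  H0 K_ge1 (measurable_survivor _ _ _) (survivor01 mu_ge0 H zeta01) g_lip'
  al_ge0' C_ge0' beta_bound' al_taylor' C_taylor' al_lip' psi0.
rewrite Ex_Zt0 Ex_ZtH; [|by rewrite /al subrr dual0|].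
  by rewrite /C subr0 (customers_gf Q mu_ge0 H0 zeta01).
by rewrite /C subrr /exponent dual0// dual_primitive0// mulr0 addr0.
Qed.

End generating_function_bounds.

(** * Gamma law *)

Section gamma_integral.
Variable R : realType.
Local Notation leb := (@lebesgue_measure R).

Definition gamma_kernel (a c x : R) : R := x `^ (a - 1) * expR (- (c * x)).

Lemma gamma_kernel_ge0 a c x : 0 <= gamma_kernel a c x.
Proof. by rewrite mulr_ge0 ?powR_ge0 ?expR_ge0. Qed.

Lemma measurable_gamma_kernel a c : measurable_fun setT (gamma_kernel a c).
Proof.
apply: measurable_funM; first exact: measurable_powR.
apply: measurableT_comp; first exact: measurable_expR.
by apply: measurableT_comp => //; exact: measurable_funM.
Qed.

Lemma continuous_gamma_kernel a c (x : R) : 0 < x -> {for x, continuous (gamma_kernel a c)}.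
Proof.
move=> x0; apply: continuousM.
  apply: differentiable_continuous; apply/derivable1_diffP.
  by have [] := is_derive1_powR (a - 1) x0.
apply: continuous_comp; last exact: continuous_expR.
by apply: continuousN; apply: continuousM; [exact: cst_continuous|].
Qed.

Lemma within_continuous_gamma_kernel a c (e : R) : 0 < e ->
  {within `[e, +oo[, continuous (gamma_kernel a c)}.
Proof.
move=> e0; apply/continuous_within_itvcyP; split.
  move=> x; rewrite in_itv/= andbT => ex; apply: continuous_gamma_kernel.
  exact: lt_trans ex.
by apply: cvg_at_right_filter; exact: continuous_gamma_kernel.
Qed.

Lemma gamma_kernel_scale a c x : 0 < c -> 0 < x ->
  gamma_kernel a 1 (c * x) * c = c `^ a * gamma_kernel a c x.
Proof.
move=> c0 x0; rewrite /gamma_kernel mul1r powRM ?ltW//.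
have -> : c `^ a = c `^ (a - 1) * c.
  rewrite -[X in _ * X](@powRr1 _ c) ?ltW// -powRD ?subrK//.
  by rewrite (gt_eqF c0) implybT.
ring.
Qed.

(** The kernel is singular at 0 for shapes below 1, so substitution and the fundamental theorem are
    applied on closed half-lines away from 0. The factor c lets the substitution x -> c x match two
    such exhaustions of the half-line. *)
Lemma cvg_integral_at0 (f : R -> R) (c : R) : 0 < c -> measurable_fun setT f ->
  (forall x, 0 <= f x) ->
  (\int[leb]_(x in `[(c * n.+1%:R^-1)%R, +oo[) (f x)%:E @[n --> \oo] -->
   \int[leb]_(x in `]0%R, +oo[) (f x)%:E)%E.
Proof.
move=> c0 mf f0.
have -> : `]0, +oo[%classic = \bigcup_n `[c * n.+1%:R^-1, +oo[%classic :> set R.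
  apply/seteqP; split => x.
    rewrite /= in_itv/= andbT => x0.
    exists (Num.truncn (c / x)) => //=; rewrite in_itv/= andbT ler_pdivrMr// mulrC.
    by rewrite -ler_pdivrMr// ltW// truncnS_gt.
  move=> [n _]; rewrite /= !in_itv/= !andbT; apply: lt_le_trans.
  by rewrite mulr_gt0// invr_gt0.
apply: ge0_nondecreasing_set_cvg_integral => //.
- apply/nondecreasing_seqP => n; apply/subsetPset => x /=; rewrite !in_itv/= !andbT.
  by apply: le_trans; rewrite ler_wpM2l ?(ltW c0)// lef_pV2 ?posrE// ler_nat.
- by move=> i; apply/measurable_EFinP; exact: measurable_funTS.
- by move=> i x _; rewrite lee_fin.
Qed.

Lemma integral_gamma_kernel_scale_tail (a c e : R) : 0 < c -> 0 < e ->
  (\int[leb]_(x in `[(c * e)%R, +oo[) (gamma_kernel a 1 x)%:E =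
   (c `^ a)%:E * \int[leb]_(x in `[e, +oo[) (gamma_kernel a c x)%:E)%E.
Proof.
move=> c0 e0; pose F (x : R) : R := c * x.
have dF (x : R) : is_derive x 1 F c.
  by apply: is_derive_eq; rewrite /GRing.scale /= ?mulr1.
have F' : derive1 F = fun=> c.
  by apply/funext => x; rewrite derive1E; have [_ ->] := dF x.
rewrite (@increasing_ge0_integration_by_substitutiony R F (gamma_kernel a 1) e).
- rewrite -ge0_integralZl//; last 3 first.
  + by apply/measurable_EFinP; apply: measurable_funTS; exact: measurable_gamma_kernel.
  + by move=> x _; rewrite lee_fin gamma_kernel_ge0.
  + by rewrite lee_fin powR_ge0.
  apply: eq_integral => x; rewrite inE /= in_itv/= andbT => ex.
  by rewrite F' -EFinM -gamma_kernel_scale//; exact: lt_le_trans ex.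
- by move=> x y _ _ xy; rewrite /F ltr_pM2l.
- by rewrite F' => x _; exact: cst_continuous.
- by rewrite F'; exact: is_cvg_cst.
- by rewrite F'; exact: is_cvg_cst.
- split; first by move=> x _; have [] := dF x.
  apply: cvg_at_right_filter; apply: differentiable_continuous; apply/derivable1_diffP.
  by have [] := dF e.
- exact: (gt0_cvgMry c0 (@cvg_id _ _)).
- by apply: within_continuous_gamma_kernel; rewrite mulr_gt0.
- by move=> x _; exact: gamma_kernel_ge0.
Qed.

Lemma integral_gamma_kernel_scale a c : 0 < c ->
  (\int[leb]_(x in `]0%R, +oo[) (gamma_kernel a 1 x)%:E =
   (c `^ a)%:E * \int[leb]_(x in `]0%R, +oo[) (gamma_kernel a c x)%:E)%E.
Proof.
move=> c0.
have h1 := cvg_integral_at0 c0 (measurable_gamma_kernel a 1) (gamma_kernel_ge0 a 1).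
have h2 := cvg_integral_at0 ltr01 (measurable_gamma_kernel a c) (gamma_kernel_ge0 a c).
have h3 := cvgeZl (y := (c `^ a)%:E) isT h2.
rewrite -(cvg_lim (@ereal_hausdorff R) h1) -(cvg_lim (@ereal_hausdorff R) h3).
congr (limn _); apply/funext => n.
by rewrite mul1r -integral_gamma_kernel_scale_tail// invr_gt0.
Qed.

(* maj a is the derivative of u^a / a, with u increasing from 0 to 1: an integrable
   majorant of the Gamma kernel up to a factor. *)
Let u (x : R) : R := 1 - (1 + x)^-1.
Let maj (a x : R) : R := u x `^ (a - 1) * (1 + x) ^- 2.

Lemma uE x : 0 < x -> u x * (1 + x) = x.
Proof.
move=> x0; rewrite /u mulrBl mul1r mulVf; last by rewrite gt_eqF// addr_gt0.
by rewrite addrAC subrr add0r.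
Qed.

Lemma u_gt0 x : 0 < x -> 0 < u x < 1.
Proof.
move=> x0; have x1 : 0 < 1 + x by rewrite addr_gt0.
by rewrite subr_gt0 invf_lt1// ltrDl x0/= gtrBl invr_gt0.
Qed.

(** Writing x = u (1 + x), the ratio of the two functions is (1 + x)^p e^(-x) with p = a + 1. Its
    logarithm p ln (1 + x) - x is bounded through ln z <= z - 1 at z = (1 + x) / p, which gives the
    constant 1 - p + p ln p. *)
Lemma gamma_kernel_le_maj a x : 0 < a -> 0 < x ->
  gamma_kernel a 1 x <= expR (1 - (a + 1) + (a + 1) * ln (a + 1)) * maj a x.
Proof.
move=> a0 x0; have x1 : 0 < 1 + x by rewrite addr_gt0.
have /andP[u0 _] := u_gt0 x0; have p0 : 0 < a + 1 by rewrite addr_gt0.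
rewrite /gamma_kernel /maj mul1r -[in X in X `^ _](uE x0) powRM ?(ltW u0) ?(ltW x1)//.
rewrite [leRHS]mulrCA -mulrA ler_wpM2l ?powR_ge0// ler_pdivlMr ?exprn_gt0//.
rewrite -powR_mulrn ?(ltW x1)// mulrAC -powRD; last by rewrite (gt_eqF x1) implybT.
have -> : a - 1 + 2%:R = a + 1 by ring.
rewrite /powR (gt_eqF x1) -expRD ler_expR.
have : ln ((1 + x) / (a + 1)) <= (1 + x) / (a + 1) - 1.
  have h : 0 < (1 + x) / (a + 1) by rewrite divr_gt0.
  by have := @le_ln1Dx R ((1 + x) / (a + 1) - 1); rewrite addrCA subrr addr0; apply; lra.
rewrite lnM ?posrE ?invr_gt0// lnV ?posrE// => h.
have := ler_wpM2l (ltW p0) h.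
have -> : (a + 1) * ((1 + x) / (a + 1) - 1) = 1 + x - (a + 1) by field; rewrite gt_eqF.
lra.
Qed.

Lemma is_derive_maj a (x : R) : 0 < a -> 0 < x ->
  is_derive x 1 (fun x => a^-1 * u x `^ a) (maj a x).
Proof.
move=> a0 x0; have x1 : 1 + x != 0 by rewrite gt_eqF// addr_gt0.
have /andP[u0 _] := u_gt0 x0.
have h1 : is_derive x 1 (fun x : R => 1 + x) 1.
  have h := is_deriveD (is_derive_cst (1 : R) x 1) (is_derive_id x (1 : R)).
  by apply: (is_derive_eq h); rewrite add0r.
have h2 : is_derive x 1 u ((1 + x) ^- 2).
  have h := is_deriveB (is_derive_cst (1 : R) x 1) (is_deriveV x1 h1).
  by apply: (is_derive_eq h); rewrite /GRing.scale /= mulr1 sub0r opprK.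
have h := is_deriveZ a^-1 (is_derive1_comp (is_derive1_powR a u0) h2).
apply: (is_derive_eq h); rewrite /maj /GRing.scale /=.
by field; rewrite x1 gt_eqF.
Qed.

Lemma continuous_u (x : R) : 0 < x -> {for x, continuous u}.
Proof.
move=> x0; apply: continuousB; first exact: cst_continuous.
apply: continuousV; first by rewrite gt_eqF// addr_gt0.
by apply: continuousD; [exact: cst_continuous|].
Qed.

Lemma continuous_powR p (y : R) : 0 < y -> {for y, continuous (fun x => x `^ p)}.
Proof.
move=> y0; apply: differentiable_continuous; apply/derivable1_diffP.
by have [] := is_derive1_powR p y0.
Qed.

Lemma continuous_maj a (x : R) : 0 < x -> {for x, continuous (maj a)}.
Proof.
move=> x0; have /andP[u0 _] := u_gt0 x0; apply: continuousM.
  by apply: (@continuous_comp _ _ _ u (fun y => y `^ (a - 1))); [exact: continuous_u|exact: continuous_powR].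
apply: continuousV; first by rewrite expf_neq0// gt_eqF// addr_gt0.
apply: (@continuous_comp _ _ _ (fun x : R => 1 + x) (fun y => y ^+ 2)); last exact: exprn_continuous.
by apply: continuousD; [exact: cst_continuous|].
Qed.

Lemma cvg_u : u x @[x --> +oo] --> (1 : R).
Proof.
rewrite -[X in _ --> X]subr0; apply: cvgB; first exact: cvg_cst.
apply/cvgrPdist_le => e e0; near=> x.
have ex : e^-1 < x by near: x; apply: nbhs_pinfty_gt; rewrite num_real.
have x0 : 0 < x by apply: lt_trans ex; rewrite invr_gt0.
have x1 : 0 < 1 + x by rewrite addr_gt0.
rewrite sub0r normrN ger0_norm ?invr_ge0 ?(ltW x1)//.
rewrite invf_ple ?posrE//; apply: le_trans (ltW ex) _; by rewrite lerDr.
Unshelve. all: by end_near. Qed.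

Lemma integral_maj a (e : R) : 0 < a -> 0 < e ->
  (\int[leb]_(x in `[e, +oo[) (maj a x)%:E <= (a^-1)%:E)%E.
Proof.
move=> a0 e0.
have pos x : e <= x -> 0 < x by exact: lt_le_trans.
have m0 x : 0 <= maj a x by rewrite mulr_ge0 ?powR_ge0 ?invr_ge0 ?sqr_ge0.
rewrite (@ge0_continuous_FTC2y _ (maj a) (fun x => a^-1 * u x `^ a) e a^-1).
- by rewrite -EFinB lee_fin gerBl mulr_ge0 ?powR_ge0 ?invr_ge0 ?ltW.
- by move=> x _.
- apply/continuous_within_itvcyP; split.
    by move=> x; rewrite in_itv/= andbT => /ltW/pos; exact: continuous_maj.
  by apply: cvg_at_right_filter; exact: continuous_maj.
- rewrite -[X in _ --> X]mulr1; apply: cvgM; first exact: cvg_cst.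
  have -> : 1 = 1 `^ a :> R by rewrite powR1.
  apply: (@cvg_comp _ _ _ u (fun y => y `^ a) _ (nbhs (1 : R)) _ cvg_u).
  exact: continuous_powR.
- by move=> x /ltW/pos x0; have [] := is_derive_maj a0 x0.
- apply: (@cvg_at_right_filter _ _ (fun x => a^-1 * u x `^ a)); apply: cvgM; first exact: cvg_cst.
  have /andP[ue0 _] := u_gt0 e0.
  apply: (@cvg_comp _ _ _ u (fun y => y `^ a) _ (nbhs (u e)) _ (continuous_u e0)).
  exact: continuous_powR.
- by move=> x; rewrite in_itv/= andbT => /ltW/pos x0; rewrite derive1E; have [_ ->] := is_derive_maj a0 x0.
Qed.

Lemma integral_gamma_kernel_lty a : 0 < a ->
  (\int[leb]_(x in `]0%R, +oo[) (gamma_kernel a 1 x)%:E < +oo)%E.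
Proof.
move=> a0; pose K := expR (1 - (a + 1) + (a + 1) * ln (a + 1)).
have h := cvg_integral_at0 ltr01 (measurable_gamma_kernel a 1) (gamma_kernel_ge0 a 1).
apply: (@le_lt_trans _ _ (K * a^-1)%:E); last by rewrite ltry.
rewrite -(cvg_lim (@ereal_hausdorff R) h); apply: lime_le.
  by apply/cvg_ex; eexists; exact: h.
apply: nearW => n; rewrite mul1r; set e := n.+1%:R^-1.
have e0 : 0 < e by rewrite invr_gt0.
have mmaj : measurable_fun `[e, +oo[%classic (maj a).
  apply: subspace_continuous_measurable_fun; first exact: measurable_itv.
  apply/continuous_within_itvcyP; split.
    move=> x; rewrite in_itv/= andbT => ex; apply: continuous_maj; exact: lt_trans ex.
  by apply: cvg_at_right_filter; exact: continuous_maj.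
have m0 x : 0 <= maj a x by rewrite mulr_ge0 ?powR_ge0 ?invr_ge0 ?sqr_ge0.
apply: le_trans (_ : (\int[leb]_(x in `[e, +oo[) (K%:E * (maj a x)%:E) <= _)%E).
  apply: ge0_le_integral => //.
  - by move=> x _; rewrite lee_fin gamma_kernel_ge0.
  - by apply/measurable_EFinP; apply: measurable_funTS; exact: measurable_gamma_kernel.
  - by apply/measurable_EFinP; exact: measurable_funM.
  - move=> x /=; rewrite in_itv/= andbT => ex.
    by rewrite -EFinM lee_fin gamma_kernel_le_maj//; exact: lt_le_trans ex.
rewrite ge0_integralZl//; [|exact/measurable_EFinP|by move=> x _; rewrite lee_fin|by rewrite lee_fin expR_ge0].
by rewrite EFinM lee_wpmul2l ?lee_fin ?expR_ge0// integral_maj.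
Qed.

Lemma integral_gamma_kernel_gt0 a :
  (0 < \int[leb]_(x in `]0%R, +oo[) (gamma_kernel a 1 x)%:E)%E.
Proof.
(* A lower bound of the kernel on [1, 2]: there 0 <= ln x <= 1, so x^(a-1) >= e^(-|a-1|), and e^(-x)
   >= e^(-2). *)
pose m := expR (- `|a - 1|) * expR (- (2 : R)).
have mm : 0 < m by rewrite mulr_gt0 ?expR_gt0.
apply: (@lt_le_trans _ _ (\int[leb]_(x in `[1%R, 2%R]) m%:E)%E).
  rewrite integral_cst//= lebesgue_measure_itv/= lte_fin ltr1n -EFinB -EFinM lte_fin.
  by rewrite mulr_gt0//; lra.
apply: le_trans (_ : (\int[leb]_(x in `[1%R, 2%R]) (gamma_kernel a 1 x)%:E <= _)%E).
  apply: ge0_le_integral => //.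
  - by move=> x _; rewrite lee_fin ltW.
  - by apply/measurable_EFinP; apply: measurable_funTS; exact: measurable_gamma_kernel.
  - move=> x /=; rewrite in_itv/= => /andP[x1 x2]; have x0 : 0 < x by exact: lt_le_trans x1.
    rewrite lee_fin /m /gamma_kernel mul1r ler_pM ?expR_ge0//; last first.
      by rewrite ler_expR lerN2.
    rewrite /powR (gt_eqF x0) ler_expR lerNl.
    have l0 : 0 <= ln x by rewrite ln_ge0.
    have l1 : ln x <= 1.
      by have := @le_ln1Dx R (x - 1); rewrite addrCA subrr addr0 => h; apply: le_trans (h _) _; lra.
    rewrite -mulNr; apply: le_trans (ler_norm _) _.
    by rewrite normrM normrN (ger0_norm l0) ler_piMr.
apply: ge0_subset_integral => //.
- by apply/measurable_EFinP; apply: measurable_funTS; exact: measurable_gamma_kernel.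
- by move=> x _; rewrite lee_fin gamma_kernel_ge0.
- by move=> x /=; rewrite !in_itv/= andbT => /andP[x1 _]; exact: lt_le_trans x1.
Qed.

Lemma Gamma_funE a : 0 < a -> 0 < Gamma_fun a :> R /\
  (\int[leb]_(x in `]0%R, +oo[) (gamma_kernel a 1 x)%:E = (Gamma_fun a)%:E)%E.
Proof.
move=> a0; set I := (\int[leb]_(x in _) _)%E.
have If : I \is a fin_num.
  by rewrite ge0_fin_numE ?integral_gamma_kernel_lty// ltW// integral_gamma_kernel_gt0.
have e : Gamma_fun a = fine I.
  by rewrite /Gamma_fun /Rintegral /I; congr fine; apply: eq_integral => x _; rewrite /gamma_kernel mul1r.
rewrite e fineK//; split=> //.
by rewrite -lte_fin fineK//; exact: integral_gamma_kernel_gt0.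
Qed.

Lemma gamma_pdf_ge0 a b (x : R) : 0 < a -> 0 <= gamma_pdf a b x.
Proof.
move=> a0; rewrite /gamma_pdf; case: ifP => // _.
have [G0 _] := Gamma_funE a0.
by rewrite !mulr_ge0 ?powR_ge0 ?expR_ge0 ?invr_ge0 ?(ltW G0).
Qed.

Lemma gamma_pdfE a b (x : R) :
  gamma_pdf a b x = (b `^ a / Gamma_fun a) * \1_`]0, +oo[%classic x * gamma_kernel a b x.
Proof.
rewrite /gamma_pdf /gamma_kernel indicE.
have -> : (x \in `]0, +oo[%classic) = (0 < x) by apply/idP/idP; rewrite inE /= in_itv/= andbT.
case: ifP => _; rewrite ?mulr1 ?mulr0 ?mul0r//; ring.
Qed.

Lemma measurable_gamma_pdf a b : measurable_fun setT (gamma_pdf a b : R -> R).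
Proof.
rewrite (_ : gamma_pdf a b = fun x => (b `^ a / Gamma_fun a) * \1_`]0, +oo[%classic x * gamma_kernel a b x).
  apply: measurable_funM; last exact: measurable_gamma_kernel.
  by apply: measurable_funM => //; apply: measurable_indic; exact: measurable_itv.
by apply/funext => x; exact: gamma_pdfE.
Qed.

Lemma gamma_laplace a b t : 0 < a -> 0 < b -> 0 <= t ->
  (\int[leb]_x (expR (- (t * x)) * gamma_pdf a b x)%:E = ((b / (b + t)) `^ a)%:E)%E.
Proof.
move=> a0 b0 t0; have [G0 GE] := Gamma_funE a0.
have bt : 0 < b + t by rewrite ltr_wpDr.
have scale := integral_gamma_kernel_scale a bt.
pose c := b `^ a / Gamma_fun a.
have c0 : 0 <= c by rewrite divr_ge0 ?powR_ge0 ?(ltW G0).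
transitivity (c%:E * \int[leb]_(x in `]0%R, +oo[) (gamma_kernel a (b + t) x)%:E)%E.
  rewrite -ge0_integralZl//; last 2 first.
  - by apply/measurable_EFinP; apply: measurable_funTS; exact: measurable_gamma_kernel.
  - by move=> x _; rewrite lee_fin gamma_kernel_ge0.
  rewrite [RHS]integral_mkcond; apply: eq_integral => x _.
  rewrite patchE gamma_pdfE indicE; case: (_ \in _); last by rewrite !(mulr0, mul0r).
  rewrite -EFinM; congr EFin; rewrite /gamma_kernel /c.
  have -> : expR (- ((b + t) * x)) = expR (- (t * x)) * expR (- (b * x)).
    by rewrite -expRD; congr expR; ring.
  by rewrite mulr1; ring.
have -> : (\int[leb]_(x in `]0%R, +oo[) (gamma_kernel a (b + t) x)%:E =
    (Gamma_fun a / (b + t) `^ a)%:E)%E.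
  have p0 : 0 < (b + t) `^ a by exact: powR_gt0.
  rewrite GE in scale; set I := (\int[leb]_(x in _) _)%E in scale *.
  (* The scaling identity has a finite left-hand side and a positive factor, which excludes infinite
     values of the integral. *)
  case: I scale => [i| |] /=; last 2 first.
  - by rewrite mulry gtr0_sg// mul1e.
  - by rewrite mulrNy gtr0_sg// mul1e.
  by rewrite -EFinM => -[->]; congr EFin; field; rewrite gt_eqF.
rewrite -EFinM; congr EFin; rewrite /c powRM ?invr_ge0 ?(ltW b0) ?(ltW bt)//.
have -> : (b + t)^-1 `^ a = ((b + t) `^ a)^-1.
  have p0 : (b + t) `^ a != 0 by rewrite gt_eqF// powR_gt0.
  have e : (b + t)^-1 `^ a * (b + t) `^ a = 1.
    by rewrite -powRM ?invr_ge0 ?(ltW bt)// mulVf ?gt_eqF// powR1.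
  by rewrite -[LHS]mulr1 -(mulfV p0) mulrA e mul1r.
by field; rewrite !gt_eqF// powR_gt0.
Qed.

End gamma_integral.

(** * Polynomial approximation of step functions *)

Section bernstein.
Variable R : realType.

(** At y the value is the mean of f(S), with S binomial of parameters m and y; the recursion
    conditions on one trial. The argument of f is the number of successes, not divided by m. *)
Fixpoint bernstein (m : nat) (f : nat -> R) : {poly R} :=
  if m is m'.+1 then
    'X * bernstein m' (fun k => f k.+1) + (1 - 'X) * bernstein m' f
  else (f 0%N)%:P.

Lemma bernstein_horner m f y : (bernstein m.+1 f).[y] =
  y * (bernstein m (fun k => f k.+1)).[y] + (1 - y) * (bernstein m f).[y].
Proof. by rewrite /= !hornerE. Qed.

Lemma bernstein_cst m c y : (bernstein m (fun=> c)).[y] = c.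
Proof.
elim: m => [|m IHm]; first by rewrite /= hornerC.
by rewrite bernstein_horner !IHm; ring.
Qed.

Lemma le_bernstein m f g y : 0 <= y <= 1 -> (forall k, f k <= g k) ->
  (bernstein m f).[y] <= (bernstein m g).[y].
Proof.
move=> /andP[y0 y1]; elim: m f g => [|m IHm] f g fg; first by rewrite /= !hornerC.
by rewrite !bernstein_horner lerD// ler_wpM2l ?subr_ge0// IHm.
Qed.

(** Squared bias plus variance. The centre c is arbitrary because conditioning on a success shifts
    it to c - 1. *)
Lemma bernstein_moment2 m c y :
  (bernstein m (fun k => (k%:R - c) ^+ 2)).[y] = (m%:R * y - c) ^+ 2 + m%:R * y * (1 - y).
Proof.
elim: m c => [|m IHm] c; first by rewrite /= hornerC; ring.
rewrite bernstein_horner IHm.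
have -> : (bernstein m (fun k => (k.+1%:R - c) ^+ 2)).[y] =
    (bernstein m (fun k => (k%:R - (c - 1)) ^+ 2)).[y].
  by congr (_.[y]); congr bernstein; apply/funext => k; rewrite -natr1; congr (_ ^+ _); ring.
by rewrite IHm -natr1; ring.
Qed.

Lemma bernsteinZ m c f y : (bernstein m (fun k => c * f k)).[y] = c * (bernstein m f).[y].
Proof.
elim: m f => [|m IHm] f; first by rewrite /= !hornerC.
by rewrite !bernstein_horner !IHm; ring.
Qed.

Lemma bernsteinB m f g y :
  (bernstein m (fun k => f k - g k)).[y] = (bernstein m f).[y] - (bernstein m g).[y].
Proof.
elim: m f g => [|m IHm] f g; first by rewrite /= !hornerC.
by rewrite !bernstein_horner !IHm; ring.
Qed.

(* Chebyshev's inequality for a binomial variable of parameters m and y. *)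
Lemma step_poly (q e eta : R) : 0 < e -> 0 < eta ->
  exists p : {poly R}, forall y, 0 <= y <= 1 ->
    [/\ 0 <= p.[y] <= 1, q + e <= y -> 1 - eta <= p.[y] & y <= q - e -> p.[y] <= eta].
Proof.
move=> e0 eta0; pose m := (Num.truncn ((eta * e ^+ 2)^-1)).+1.
have m0 : 0 < m%:R :> R by rewrite ltr0n.
have mb : (eta * e ^+ 2)^-1 < m%:R by apply: truncnS_gt; rewrite invr_ge0 mulr_ge0 ?sqr_ge0// ltW.
pose st (k : nat) : R := (q * m%:R <= k%:R)%R%:R.
have st01 k : 0 <= st k <= 1 by rewrite /st ler0n lern1 leq_b1.
exists (bernstein m st) => y y01; have /andP[y0 y1] := y01.
(* The weight c (k - m y)^2 is at least 1 once k is at distance m e from m y, and its binomial mean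
   is at most 1 / (m e^2), which is below eta by the choice of m. *)
pose c := (m%:R * e) ^- 2.
have c0 : 0 <= c by rewrite invr_ge0 sqr_ge0.
have key (f : nat -> R) : (forall k, f k <= c * (k%:R - m%:R * y) ^+ 2) ->
    (bernstein m f).[y] <= eta.
  move=> hf; apply: le_trans (le_bernstein m y01 hf) _.
  rewrite bernsteinZ bernstein_moment2 subrr expr0n add0r.
  have h1 : m%:R * y * (1 - y) <= m%:R.
    by rewrite -mulrA ler_piMr ?(ltW m0)// mulr_ile1 ?subr_ge0// gerBl.
  apply: le_trans (ler_wpM2l c0 h1) _.
  rewrite /c exprMn -(ler_pM2l m0).
  have -> : m%:R * ((m%:R ^+ 2 * e ^+ 2)^-1 * m%:R) = (e ^+ 2)^-1 by field; rewrite !gt_eqF.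
  have e2 : 0 < e ^+ 2 by rewrite exprn_gt0.
  rewrite -[leLHS]mul1r ler_pdivrMr// -mulrA -ler_pdivrMr ?mulr_gt0// mul1r.
  exact: ltW.
have big (k : nat) : m%:R * e <= `|k%:R - m%:R * y| -> 1 <= c * (k%:R - m%:R * y) ^+ 2.
  move=> h; have me : 0 < m%:R * e by rewrite mulr_gt0.
  rewrite /c mulrC ler_pdivlMr ?exprn_gt0// mul1r -[leRHS]real_normK ?num_real//.
  by rewrite ler_sqr ?nnegrE// ltW.
have pos (k : nat) : 0 <= c * (k%:R - m%:R * y) ^+ 2 by rewrite mulr_ge0 ?sqr_ge0.
split.
- apply/andP; split.
    have := le_bernstein m y01 (fun k => (andP (st01 k)).1 : (fun=> 0) k <= st k).
    by rewrite bernstein_cst.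
  have := le_bernstein m y01 (fun k => (andP (st01 k)).2 : st k <= (fun=> 1) k).
  by rewrite bernstein_cst.
- move=> qy; rewrite lerBlDl -lerBlDr -[X in X - _](bernstein_cst m 1 y) -bernsteinB.
  apply: key => k; rewrite /st; case: (leP (q * m%:R) k%:R) => h; first by rewrite subrr.
  rewrite subr0; apply: big; rewrite distrC; apply: le_trans (ler_norm _).
  have := ler_wpM2l (ltW m0) qy; rewrite mulrDr; move: h; rewrite mulrC; lra.
- move=> yq; apply: key => k; rewrite /st; case: (leP (q * m%:R) k%:R) => h; last exact: pos.
  apply: big; apply: le_trans (ler_norm _).
  have := ler_wpM2l (ltW m0) yq; rewrite mulrBr; move: h; rewrite mulrC; lra.
Qed.

(** The step in X is a step in e^(-X) with the order reversed; taking the midpoint and the half-gap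
    of e^(-x') and e^(-x) confines the uncontrolled transition to X between x and x'. *)
Lemma step_poly_exp (x x' eta : R) : x < x' -> 0 < eta ->
  exists p : {poly R}, forall X, 0 <= X ->
    (X <= x)%R%:R - eta <= p.[expR (- X)] <= (X <= x')%R%:R + eta.
Proof.
move=> xx eta0; have ex : expR (- x') < expR (- x) by rewrite ltr_expR ltrN2.
pose e := (expR (- x) - expR (- x')) / 2.
have e0 : 0 < e by rewrite divr_gt0// subr_gt0.
have [p hp] := step_poly ((expR (- x) + expR (- x')) / 2) e0 eta0.
exists p => X X0; have y01 : 0 <= expR (- X) <= 1.
  by rewrite expR_ge0 -expR0 ler_expR oppr_le0.
have [/andP[p0 p1] h1 h2] := hp _ y01; apply/andP; split.
  case: (leP X x) => Xx.
    apply: h1; have : expR (- x) <= expR (- X) by rewrite ler_expR lerN2.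
    by rewrite /e; lra.
  by rewrite sub0r; apply: le_trans p0; rewrite oppr_le0 ltW.
case: (leP X x') => Xx; first by apply: le_trans p1 _; rewrite lerDl ltW.
rewrite add0r; apply: h2; have : expR (- X) <= expR (- x') by rewrite ler_expR lerN2 ltW.
by rewrite /e; lra.
Qed.

End bernstein.

(** * Heavy traffic *)

Section exponent_limit.
Variable R : realType.
Variables (delta kappa q mu : R).
Hypotheses (delta0 : 0 < delta) (kappa0 : 0 < kappa) (q0 : 0 < q) (mu0 : 0 < mu).

Lemma cvg_expRN_pinfty (c : R) : 0 < c -> expR (- (c * s)) @[s --> +oo] --> (0 : R).
Proof.
move=> c0; apply: (@cvg_comp _ _ _ (fun s : R => c * s) (fun x => expR (- x)) _ (+oo%R) _).
  by apply: gt0_cvgMry => //; exact: cvg_id.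
exact: cvgr_expR.
Qed.

Lemma cvg_logi : logi delta kappa q s @[s --> +oo] --> (0 : R).
Proof.
apply: (@squeeze_cvgr _ _ _ _ (fun=> 0) (fun s => q * expR (- (delta * s)))).
- near=> s; have s0 : 0 <= s by near: s; apply: nbhs_pinfty_ge; rewrite num_real.
  have d0 := logi_den_gt0 delta0 kappa0 q0 s0.
  have /andP[/ltW -> _] /= := logi_bounds delta0 kappa0 q0 s0.
  rewrite /logi expRN ler_pdivrMr// mulrAC ler_pdivlMr ?expR_gt0//.
  rewrite [leLHS](_ : _ = q * (delta * expR (delta * s))); last by ring.
  rewrite ler_wpM2l ?(ltW q0)// /logi_den.
  have : 1 <= expR (delta * s) by rewrite -expR0 ler_expR mulr_ge0// ltW.
  by have := mulr_gt0 kappa0 q0; nra.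
- exact: cvg_cst.
- rewrite -[X in _ --> X](mulr0 q); apply: cvgM; first exact: cvg_cst.
  exact: cvg_expRN_pinfty.
Unshelve. all: by end_near. Qed.

Lemma cvg_dual : dual delta kappa q mu s @[s --> +oo] --> (0 : R).
Proof.
have -> : 0 = 0 - q * 0 :> R by rewrite mulr0 subr0.
apply: cvgB; first exact: cvg_logi.
by apply: cvgM; [exact: cvg_cst|exact: cvg_expRN_pinfty].
Qed.

(** The defining formula is a difference of two terms that tend to infinity; absorbing e^(-delta s)
    into the logarithm gives a form whose limit can be read off. *)
Lemma logi_primitiveE s : 0 <= s -> logi_primitive delta kappa q s =
  ln (1 + kappa * q / delta * (1 - expR (- (delta * s)))) / kappa.
Proof.
move=> s0; have d0 := logi_den_gt0 delta0 kappa0 q0 s0.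
rewrite /logi_primitive; congr (_ / _).
have -> : 1 + kappa * q / delta * (1 - expR (- (delta * s))) =
    expR (- (delta * s)) * (logi_den delta kappa q s / delta).
  have e1 : expR (- (delta * s)) * expR (delta * s) = 1 by rewrite -expRD addNr expR0.
  rewrite [RHS](_ : _ = ((delta + kappa * q) * (expR (- (delta * s)) * expR (delta * s))
    - kappa * q * expR (- (delta * s))) / delta); last by rewrite /logi_den; ring.
  by rewrite e1; field; rewrite gt_eqF.
rewrite lnM ?posrE ?expR_gt0 ?divr_gt0// expRK lnM ?posrE ?invr_gt0// lnV ?posrE//.
by rewrite addrC.
Qed.

Lemma cvg_dual_primitive : dual_primitive delta kappa q mu s @[s --> +oo] -->
  (ln (1 + kappa * q / delta) / kappa - q / mu : R).
Proof.
have kq0 : 0 < kappa * q / delta by rewrite divr_gt0// mulr_gt0.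
have h : 0 < 1 + kappa * q / delta by rewrite addr_gt0.
apply: cvgB; last first.
  rewrite -[X in _ --> X]mulr1; apply: cvgM; first exact: cvg_cst.
  by rewrite -[X in _ --> X]subr0; apply: cvgB; [exact: cvg_cst|exact: cvg_expRN_pinfty].
have cv : ln (1 + kappa * q / delta * (1 - expR (- (delta * s)))) / kappa @[s --> +oo] -->
    ln (1 + kappa * q / delta) / kappa.
  apply: cvgM; last exact: cvg_cst.
  apply: (@cvg_comp _ _ _ (fun s => 1 + kappa * q / delta * (1 - expR (- (delta * s))))
    (@ln R) _ (nbhs (1 + kappa * q / delta)) _); last exact: continuous_ln.
  apply: cvgD; first exact: cvg_cst.
  rewrite -[X in _ --> X]mulr1; apply: cvgM; first exact: cvg_cst.
  by rewrite -[X in _ --> X]subr0; apply: cvgB; [exact: cvg_cst|exact: cvg_expRN_pinfty].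
apply: cvg_trans cv; apply: near_eq_cvg; near=> s.
by rewrite logi_primitiveE//; near: s; apply: nbhs_pinfty_ge; rewrite num_real.
Unshelve. all: by end_near. Qed.

End exponent_limit.

(** The limit of [exponent] as the horizon tends to infinity, where [dual] itself vanishes. *)
Definition limit_exponent (R : realType) (a delta kappa q mu : R) : R :=
  a * (ln (1 + kappa * q / delta) / kappa - q / mu).

Lemma cvg_exponent (R : realType) (a mu kappa q : R) (nu : probability R R) :
  0 < a - mark_mean nu -> 0 < kappa -> 0 < q -> 0 < mu ->
  exponent a mu nu kappa q s @[s --> +oo] -->
  limit_exponent a (a - mark_mean nu) kappa q mu.
Proof.
move=> d0 k0 q0 mu0; rewrite /limit_exponent -[X in _ --> X]add0r; apply: cvgD.
  exact: cvg_dual.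
by apply: cvgM; [exact: cvg_cst|exact: cvg_dual_primitive].
Qed.

(** The term q / mu disappears with q, while q / delta keeps a limit: the logarithm is the only
    trace of the service mechanism and of criticality. *)
Lemma cvg_limit_exponent (R : realType) (a delta kappa q : nat -> R) (mu r k c : R) :
  0 < k -> 0 <= c -> a n @[n --> \oo] --> r -> kappa n @[n --> \oo] --> k ->
  q n @[n --> \oo] --> (0 : R) -> q n / delta n @[n --> \oo] --> c ->
  limit_exponent (a n) (delta n) (kappa n) (q n) mu @[n --> \oo] -->
  r * (ln (1 + k * c) / k).
Proof.
move=> k0 c0 ha hk hq hc; apply: cvgM => //.
rewrite -[X in _ --> X]subr0; apply: cvgB; last first.
  by rewrite -[X in _ --> X](mul0r mu^-1); apply: cvgM => //; exact: cvg_cst.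
apply: cvgM; last by apply: cvgV => //; rewrite gt_eqF.
apply: (@cvg_comp _ _ _ (fun n => 1 + kappa n * q n / delta n)
    (@ln R) _ (nbhs (1 + k * c)) _).
  apply: cvgD; first exact: cvg_cst.
  rewrite (_ : (fun n => _) = fun n => kappa n * (q n / delta n)); first exact: cvgM.
  by apply/funext => n; rewrite mulrA.
by apply: continuous_ln; rewrite ltr_pwDl// mulr_ge0// ltW.
Qed.

Lemma branching_ratioE (R : realType) (nu : probability R R) (a : R) : 0 < a ->
  branching_ratio nu (exp_decay a) = mark_mean nu / a.
Proof.
move=> a0; rewrite /branching_ratio; congr (_ * _).
pose F u : R := - (a^-1 * expR (- (a * u))).
have dF (x : R) : is_derive x 1 F (exp_decay a x).
  have h : is_derive x 1 F (- (a^-1 * (- a * expR (- (a * x))))).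
    by apply: is_derive_eq; rewrite /GRing.scale /= ?mulr1; field; rewrite gt_eqF.
  by apply: (is_derive_eq h); rewrite /exp_decay; field; rewrite gt_eqF.
have cE (x : R) : {for x, continuous (exp_decay a)}.
  apply: differentiable_continuous; apply/derivable1_diffP.
  by rewrite /exp_decay; apply: ex_derive.
have cF (x : R) : {for x, continuous F}.
  by apply: differentiable_continuous; apply/derivable1_diffP; exact: ex_derive.
rewrite (@Rintegral_ge0_continuous_FTC2y _ (exp_decay a) F 0 0).
- by rewrite /F mulr0 oppr0 expR0 mulr1 opprK add0r.
- by move=> x _; exact: expR_ge0.
- by apply: continuous_subspaceT => x; exact: cE.
- rewrite -[X in _ --> X]oppr0 -[X in _ --> - X](mulr0 a^-1); apply: cvgN; apply: cvgM.
    exact: cvg_cst.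
  exact: cvg_expRN_pinfty.
- by move=> x _; exact: ex_derive.
- by apply: cvg_at_right_filter; exact: cF.
- by move=> x _; rewrite derive1E derive_val.
Qed.

(** The cubic Taylor bound for small h and 1 - h <= e^(-h) for large h, joined so that the error is
    at most h^2: two moments of the mark suffice to take its mean. *)
Lemma expRN_ge3 (R : realType) (h : R) : 0 <= h ->
  1 - h + h ^+ 2 / 2 - h ^+ 2 * Num.min 1 h <= expR (- h).
Proof.
move=> h0; rewrite /Num.min; case: ifP => _.
  have [h1 _ _ _] := expRN_bounds h0; apply: le_trans h1.
  by rewrite mulr1; have := sqr_ge0 h; lra.
have [|c /andP[c0 ch] e] := @MVT_is_derive R
   (fun x => expR (- x) - (1 - x + x ^+ 2 / 2 - x ^+ 3 / 6))
   (fun x => 1 - x + x ^+ 2 / 2 - expR (- x)) 0 h h0.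
  by move=> s _; apply: is_derive_eq; rewrite /GRing.scale /= ?mulr1; field.
have e0 : expR (- 0) - (1 - 0 + 0 ^+ 2 / 2 - 0 ^+ 3 / 6) = 0 :> R.
  by rewrite subr0 oppr0 expR0 !expr0n !mul0r addr0 subr0 subrr.
have h3 : 0 <= h ^+ 3 by rewrite exprn_ge0.
have : 0 <= expR (- h) - (1 - h + h ^+ 2 / 2 - h ^+ 3 / 6).
  move: e; rewrite e0 !subr0 => ->; rewrite mulr_ge0// subr_ge0.
  exact: expRN_le2.
have -> : h ^+ 2 * h = h ^+ 3 by ring.
lra.
Qed.

(** * Lower bound for the Laplace transforms, uniform in the mark law *)

Section uniform_integrability.
Variables (R : realType) (nu : nat -> probability R R) (b2 : R).
Hypothesis nu_gt0 : forall n, nu n `]0, +oo[%classic = 1%E.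
Hypothesis nu_int : forall n, Li (nu n) (fun x : R => x).
Hypothesis nu_int2 : forall n, Li (nu n) (fun x : R => x ^+ 2).
Hypothesis b2_cvg : mark_moment2 (nu n) @[n --> \oo] --> b2.
Hypothesis nu_ui : forall eps : R, 0 < eps -> exists K : R, forall n,
  (\int[nu n]_(x in `[K, +oo[) (x ^+ 2)%:E <= eps%:E)%E.

(* Uniform integrability makes the second-order expansion uniform in n. *)
Lemma mark_laplace_ge_uniform (eta : R) : 0 < eta -> exists2 x0, 0 < x0 &
  \forall n \near \oo, forall x, 0 <= x <= x0 ->
  1 - mark_mean (nu n) * x + (b2 / 2 - eta) * x ^+ 2 <= mark_laplace (nu n) x.
Proof.
move=> eta0; have eta4 : 0 < eta / 4 by rewrite divr_gt0.
have [K hK] := nu_ui eta4.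
have b20 : 0 <= b2.
  rewrite -(cvg_lim (@Rhausdorff R) b2_cvg); apply: limr_ge.
    by apply/cvg_ex; eexists; exact: b2_cvg.
  by apply: nearW => n; apply: Ex_ge0 => x; exact: sqr_ge0.
(* Chosen so that x |K| E B^2 <= x c <= eta / 4 for x <= eta / (4 c), since eventually E B^2 < b2 +
   1. With eta / 4 from the tail and eta / 2 from E B^2 > b2 - eta, the total loss is eta. *)
pose c := (`|K| + 1) * (b2 + 1).
have c0 : 0 < c by rewrite mulr_gt0// ltr_wpDl.
exists (eta / (4 * c)); first by rewrite divr_gt0// mulr_gt0.
have ev1 : \forall n \near \oo, mark_moment2 (nu n) < b2 + 1.
  by apply: cvgr_lt b2_cvg _ _; rewrite ltrDl.
have ev2 : \forall n \near \oo, b2 - eta < mark_moment2 (nu n).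
  by apply: cvgr_gt b2_cvg _ _; rewrite gtrBl.
near=> n => x /andP[x0 xx].
have m1 : mark_moment2 (nu n) < b2 + 1 by near: n.
have m2 : b2 - eta < mark_moment2 (nu n) by near: n.
have [im imE] := mark_mean_pos (nu_gt0 n) (nu_int n).
have [im2 im2E] := mark_moment2_pos (nu_gt0 n) (nu_int2 n).
pose pos b : R := Num.max 0 b.
have mpos : measurable_fun setT pos by exact: measurable_maxr.
have pos0 b : 0 <= pos b by rewrite le_max lexx.
have imin : Li (nu n) (fun b => pos b ^+ 2 * Num.min 1 (x * pos b)).
  apply: (@LiM _ _ _ _ _ _ 1) => //.
    by apply: measurable_minr => //; exact: measurable_funM.
  by move=> b; have /andP[? ?] := min01 (mulr_ge0 x0 (pos0 b)); rewrite ger0_norm.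
have itail : Li (nu n) (fun b => b ^+ 2 * \1_`[K, +oo[%classic b).
  by apply: Li_indicM => //; exact: measurable_itv.
have tail : Ex (nu n) (fun b => b ^+ 2 * \1_`[K, +oo[%classic b) <= eta / 4.
  rewrite -lee_fin ExE//; apply: le_trans (hK n).
  rewrite [leRHS]integral_mkcond le_eqVlt; apply/orP; left; apply/eqP.
  apply: eq_integral => b _; rewrite patchE indicE.
  by case: (_ \in _); rewrite ?mulr1 ?mulr0.
(* Marks above K contribute at most their tail second moment, the minimum being at most 1; below K
   the minimum is at most x |K|. *)
have bmin : Ex (nu n) (fun b => pos b ^+ 2 * Num.min 1 (x * pos b)) <=
    eta / 4 + x * `|K| * mark_moment2 (nu n).
  apply: le_trans (lerD tail (lexx _)); rewrite /mark_moment2.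
  have -> : \int[nu n]_x (x ^+ 2) = Ex (nu n) (fun b : R => b ^+ 2) by [].
  rewrite -ExZ// -ExD//; last exact: LiZ.
  apply: le_Ex => //; first by apply: LiD => //; exact: LiZ.
  move=> b; rewrite indicE; have [b0|b0] := leP b 0.
    have -> : pos b = 0 by rewrite /pos max_l.
    by rewrite expr2 mul0r mul0r addr_ge0// mulr_ge0// ?sqr_ge0 ?mulr_ge0.
  have -> : pos b = b by rewrite /pos max_r// ltW.
  have b20' := sqr_ge0 b.
  have [bK|bK] := boolP (b \in _).
    rewrite mulr1 -[leLHS]addr0 lerD//.
      by rewrite ler_piMr// ge_min lexx.
    exact: mulr_ge0 (mulr_ge0 x0 (normr_ge0 K)) b20'.
  rewrite mulr0 add0r mulrC ler_wpM2r// ge_min; apply/orP; right.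
  rewrite ler_wpM2l//; apply: le_trans (ler_norm K).
  move: bK; rewrite notin_setE /= in_itv/= andbT => /negP; rewrite -ltNge; exact: ltW.
have -> : mark_laplace (nu n) x = Ex (nu n) (fun b : R => expR (- (x * pos b))) by [].
have xm : x * `|K| * mark_moment2 (nu n) <= eta / 4.
  have h1 : x * c <= eta / 4.
    have c4 : 0 < 4 * c by rewrite pmulr_rgt0.
    move: xx; rewrite ler_pdivlMr// => h; rewrite ler_pdivlMr//.
    by apply: le_trans h; rewrite le_eqVlt; apply/orP; left; apply/eqP; ring.
  apply: le_trans h1; rewrite -mulrA ler_wpM2l//; apply: ler_pM => //.
  - by apply: Ex_ge0 => b; exact: sqr_ge0.
  - by rewrite lerDl.
  - exact: ltW.
apply: (@le_trans _ _ (Ex (nu n) (fun b : R => 1 - x * pos b + x ^+ 2 / 2 * pos b ^+ 2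
   - x ^+ 2 * (pos b ^+ 2 * Num.min 1 (x * pos b))))); last first.
  apply: le_Ex; [|exact: Li_laplace|].
    apply: LiB; last exact: LiZ.
    by apply: LiD; [apply: LiB; [exact: Li_cst|exact: LiZ]|exact: LiZ].
  move=> b; have h := mulr_ge0 x0 (pos0 b); apply: le_trans (expRN_ge3 h).
  by rewrite le_eqVlt; apply/orP; left; apply/eqP; rewrite exprMn; ring.
rewrite ExB; [|by apply: LiD; [apply: LiB; [exact: Li_cst|exact: LiZ]|exact: LiZ]|exact: LiZ].
rewrite ExD; [|by apply: LiB; [exact: Li_cst|exact: LiZ]|exact: LiZ].
rewrite ExB; [|exact: Li_cst|exact: LiZ].
rewrite Ex_cst ExZ// ExZ// ExZ// -imE -im2E.
have x2 := sqr_ge0 x.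
have := ler_wpM2l x2 bmin; have := ler_wpM2l x2 xm; have := ler_wpM2l x2 (ltW m2).
set E := Ex _ _; set m := mark_moment2 _; nra.
Unshelve. all: by end_near. Qed.

End uniform_integrability.

(** * Heavy-traffic limit of the Laplace transforms *)

Section heavy_traffic_laplace.
Variables (R : realType) (lambda mu r b2 : R) (a : nat -> R) (nu : nat -> probability R R).
Variables (d : nat -> measure_display) (T : forall n, measurableType (d n)).
Variable P : forall n, probability (T n) R.
Variable Q : forall n, hawkes_queue (P n) lambda (nu n) (exp_decay (a n)) (exp_decay mu).
Hypotheses (lambda_gt0 : 0 < lambda) (mu_gt0 : 0 < mu) (r_gt0 : 0 < r).
Hypotheses (a_gt0 : forall n, 0 < a n) (a_cvg : a n @[n --> \oo] --> r).
Hypothesis nu_gt0 : forall n, nu n `]0, +oo[%classic = 1%E.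
Hypothesis nu_int : forall n, Li (nu n) (fun x : R => x).
Hypothesis nu_int2 : forall n, Li (nu n) (fun x : R => x ^+ 2).
Hypothesis b2_cvg : mark_moment2 (nu n) @[n --> \oo] --> b2.
Hypothesis nu_ui : forall eps : R, 0 < eps -> exists K : R, forall n,
  (\int[nu n]_(x in `[K, +oo[) (x ^+ 2)%:E <= eps%:E)%E.
Let rho n := branching_ratio (nu n) (exp_decay (a n)).
Hypotheses (rho_lt1 : forall n, rho n < 1) (rho_cvg : rho n @[n --> \oo] --> (1 : R)).

Let eps n : R := 1 - rho n.
Let Nq n t w := number_in_system (hq_count (Q n)) (hq_epoch (Q n)) (hq_service (Q n)) t w.

Let eps_gt0 n : 0 < eps n. Proof. by rewrite subr_gt0. Qed.

Let eps_cvg : eps n @[n --> \oo] --> (0 : R).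
Proof.
by rewrite -[X in _ --> X](subrr (1 : R)); apply: cvgB => //; exact: cvg_cst.
Qed.

Let mark_meanE n : mark_mean (nu n) = rho n * a n.
Proof. by rewrite /rho branching_ratioE// divfK// gt_eqF. Qed.

Let deltaE n : a n - mark_mean (nu n) = eps n * a n.
Proof. by rewrite mark_meanE /eps mulrBl mul1r. Qed.

Let delta_gt0 n : 0 < a n - mark_mean (nu n).
Proof. by rewrite deltaE mulr_gt0. Qed.

Let delta_cvg : a n - mark_mean (nu n) @[n --> \oo] --> (0 : R).
Proof.
rewrite (_ : (fun n => _) = fun n => eps n * a n); last by apply/funext => n.
by rewrite -[X in _ --> X](mul0r r); exact: cvgM.
Qed.

Let mean_cvg : mark_mean (nu n) @[n --> \oo] --> r.
Proof.
rewrite (_ : (fun n => _) = fun n => rho n * a n); last by apply/funext => n.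
by rewrite -[X in _ --> X](mul1r r); exact: cvgM.
Qed.

Lemma mark_mean_sqr_le n : mark_mean (nu n) ^+ 2 <= mark_moment2 (nu n).
Proof.
have iB : Li (nu n) (fun x : R => mark_mean (nu n) * x) by exact: LiZ.
have : 0 <= Ex (nu n) (fun x : R => x ^+ 2 - 2 * (mark_mean (nu n) * x) + mark_mean (nu n) ^+ 2).
  apply: Ex_ge0 => x; rewrite (_ : _ + _ = (x - mark_mean (nu n)) ^+ 2) ?sqr_ge0//.
  by ring.
rewrite ExD; [|by apply: LiB => //; exact: LiZ|exact: Li_cst].
rewrite ExB//; last exact: LiZ.
rewrite Ex_cst ExZ// ExZ//.
rewrite (_ : Ex (nu n) (fun x => x) = mark_mean (nu n))//.
rewrite (_ : Ex (nu n) (fun x => x ^+ 2) = mark_moment2 (nu n))//.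
set m := mark_mean _; set m2 := mark_moment2 _; lra.
Qed.

(** The means tend to r because rho n -> 1 and a n -> r, so nonnegativity of variances gives b2 >=
    r^2 in the limit. *)
Lemma moment2_limit_gt0 : 0 < b2.
Proof.
apply: (@lt_le_trans _ _ (r ^+ 2)); first by rewrite exprn_gt0.
have h : mark_mean (nu n) ^+ 2 @[n --> \oo] --> r ^+ 2.
  by rewrite expr2; under eq_fun do rewrite expr2; exact: cvgM.
have h' : mark_moment2 (nu n) - mark_mean (nu n) ^+ 2 @[n --> \oo] --> b2 - r ^+ 2.
  exact: cvgB.
rewrite -subr_ge0 -(cvg_lim (@Rhausdorff R) h'); apply: limr_ge.
  by apply/cvg_ex; eexists; exact: h'.
by apply: nearW => n; rewrite /= subr_ge0; exact: mark_mean_sqr_le.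
Qed.

Variable theta : R.
Hypothesis theta_gt0 : 0 < theta.

Let zeta n := 1 - expR (- (theta * eps n)).

Let te_gt0 n : 0 < theta * eps n. Proof. by rewrite mulr_gt0. Qed.

Let zeta_bounds n : theta * eps n - (theta * eps n) ^+ 2 / 2 <= zeta n <= theta * eps n.
Proof.
have h := expRN_le2 (ltW (te_gt0 n)); have h' := expR_ge1Dx (- (theta * eps n)).
by rewrite /zeta; move: h h'; set e := expR _; set x := _ * _; lra.
Qed.

Let zeta_gt0 n : 0 < zeta n.
Proof. by rewrite subr_gt0 expR_lt1 oppr_lt0. Qed.

Let zeta_le1 n : zeta n <= 1.
Proof. by rewrite gerBl expR_ge0. Qed.

Let zeta_cvg : zeta n @[n --> \oo] --> (0 : R).
Proof.
apply: (@squeeze_cvgr _ _ _ _ (fun=> 0) (fun n => theta * eps n)).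
- by apply: nearW => n; have /andP[_ ->] := zeta_bounds n; rewrite (ltW (zeta_gt0 n)).
- exact: cvg_cst.
- by rewrite -[X in _ --> X](mulr0 theta); apply: cvgM => //; exact: cvg_cst.
Qed.

(** zeta is theta eps up to O(eps^2) and delta is eps a, so eps cancels: this ratio keeps the
    argument of the logarithm nondegenerate. *)
Let zeta_delta_cvg : zeta n / (a n - mark_mean (nu n)) @[n --> \oo] --> theta / r.
Proof.
rewrite (_ : (fun n => _) = fun n => (zeta n / eps n) / a n); last first.
  by apply/funext => n; rewrite deltaE invfM mulrA.
apply: cvgM; last by apply: cvgV => //; rewrite gt_eqF.
apply: (@squeeze_cvgr _ _ _ _ (fun n => theta - theta ^+ 2 / 2 * eps n) (fun=> theta)).
- apply: nearW => n; have /andP[h1 h2] := zeta_bounds n.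
  rewrite ler_pdivlMr// ler_pdivrMr// h2 andbT; apply: le_trans h1.
  by rewrite le_eqVlt; apply/orP; left; apply/eqP; ring.
- rewrite -[X in _ --> X]subr0 -[X in _ --> _ - X](mulr0 (theta ^+ 2 / 2)).
  by apply: cvgB; [exact: cvg_cst|apply: cvgM => //; exact: cvg_cst].
- exact: cvg_cst.
Qed.

Let laplace n t := Ex (P n) (fun w => expR (- (theta * (eps n * (@Nq n t w)%:R)))).

Let laplaceE n t : laplace n t = Ex (P n) (fun w => (1 - zeta n) ^+ @Nq n t w).
Proof.
apply: eq_Ex => w; rewrite /zeta subKr -expRM_natl; congr expR.
by rewrite mulrN; congr (- _); ring.
Qed.

Definition laplace_limit (k c : R) : R := expR (- (lambda * (r * (ln (1 + k * c) / k)))).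

Let q_delta_cvg (c : R) (q : nat -> R) : (forall n, q n = c * zeta n) ->
  q n @[n --> \oo] --> (0 : R) /\
  q n / (a n - mark_mean (nu n)) @[n --> \oo] --> c * (theta / r).
Proof.
move=> qE; split.
  rewrite (_ : q = fun n => c * zeta n); last exact/funext.
  by rewrite -[X in _ --> X](mulr0 c); apply: cvgM => //; exact: cvg_cst.
rewrite (_ : (fun n => _) = fun n => c * (zeta n / (a n - mark_mean (nu n)))); last first.
  by apply/funext => n; rewrite qE mulrA.
by apply: cvgM => //; exact: cvg_cst.
Qed.

Let limit_laplace_cvg (kappa q : nat -> R) (k c : R) : 0 < k -> 0 <= c ->
  kappa n @[n --> \oo] --> k -> q n @[n --> \oo] --> (0 : R) ->
  q n / (a n - mark_mean (nu n)) @[n --> \oo] --> c ->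
  expR (- (lambda * limit_exponent (a n) (a n - mark_mean (nu n)) (kappa n) (q n) mu))
    @[n --> \oo] --> laplace_limit k c.
Proof.
move=> k0 c0 hk hq hc.
apply: (@cvg_comp _ _ _ (fun n => lambda * limit_exponent (a n)
  (a n - mark_mean (nu n)) (kappa n) (q n) mu) (fun x => expR (- x)) _
  (nbhs (lambda * (r * (ln (1 + k * c) / k)))) _); last first.
  apply: (@cvg_comp _ _ _ -%R expR _ (nbhs (- (lambda * (r * (ln (1 + k * c) / k))))) _).
    by apply: cvgN; exact: cvg_id.
  exact: continuous_expR.
apply: cvgM; first exact: cvg_cst.
exact: cvg_limit_exponent.
Qed.

Let exponent_laplace_cvg n (kappa q : R) : 0 < kappa -> 0 < q ->
  expR (- (lambda * exponent (a n) mu (nu n) kappa q t)) @[t --> +oo] -->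
  expR (- (lambda * limit_exponent (a n) (a n - mark_mean (nu n)) kappa q mu)).
Proof.
move=> k0 q0.
apply: (@cvg_comp _ _ _ (fun t => lambda * exponent (a n) mu (nu n) kappa q t)
  (fun x => expR (- x)) _
  (nbhs (lambda * limit_exponent (a n) (a n - mark_mean (nu n)) kappa q mu)) _); last first.
  apply: (@cvg_comp _ _ _ -%R expR _ (nbhs (- (lambda * limit_exponent (a n)
      (a n - mark_mean (nu n)) kappa q mu))) _).
    by apply: cvgN; exact: cvg_id.
  exact: continuous_expR.
by apply: cvgM; [exact: cvg_cst|exact: cvg_exponent].
Qed.

Let L := laplace_limit (b2 / 2) (theta / (mu * r)).

Lemma laplace_le_near (eta : R) : 0 < eta -> \forall n \near \oo, \forall t \near +oo,
  laplace n t <= L + eta.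
Proof.
move=> eta0; have b20 := moment2_limit_gt0.
pose kappa n := mark_moment2 (nu n) / 2.
(* Solves mu q + zeta b1 q = zeta, hence satisfies the condition of [gf_upper] with the margin delta
   q. *)
pose q n := zeta n / (mu + zeta n * mark_mean (nu n)).
have mean0 n : 0 < mark_mean (nu n) by exact: mark_mean_gt0.
have kappa0 n : 0 < kappa n.
  rewrite divr_gt0//; apply: lt_le_trans (mark_mean_sqr_le n).
  by rewrite exprn_gt0.
have den0 n : 0 < mu + zeta n * mark_mean (nu n) by rewrite addr_gt0// mulr_gt0.
have q0 n : 0 < q n by rewrite divr_gt0.
have den_cvg : mu + zeta n * mark_mean (nu n) @[n --> \oo] --> mu.
  rewrite -[X in _ --> X]addr0 -[X in _ --> _ + X](mul0r r).
  by apply: cvgD; [exact: cvg_cst|exact: cvgM].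
have kcvg : kappa n @[n --> \oo] --> b2 / 2 by apply: cvgM => //; exact: cvg_cst.
have qcvg : q n @[n --> \oo] --> (0 : R).
  rewrite -[X in _ --> X](mul0r mu^-1); apply: cvgM => //.
  by apply: cvgV => //; rewrite gt_eqF.
have qdcvg : q n / (a n - mark_mean (nu n)) @[n --> \oo] --> theta / (mu * r).
  rewrite (_ : (fun n => _) = fun n =>
      zeta n / (a n - mark_mean (nu n)) / (mu + zeta n * mark_mean (nu n))); last first.
    by apply/funext => n; rewrite /q mulrAC.
  rewrite (_ : theta / (mu * r) = theta / r / mu); last by rewrite invfM; ring.
  by apply: cvgM => //; apply: cvgV => //; rewrite gt_eqF.
have c0 : 0 <= theta / (mu * r) by rewrite ltW// divr_gt0// mulr_gt0.
have k0 : 0 < b2 / 2 by rewrite divr_gt0.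
have lcvg := limit_laplace_cvg k0 c0 kcvg qcvg qdcvg.
have rcvg : a n - mark_mean (nu n) + kappa n * q n @[n --> \oo] --> (0 : R).
  rewrite -[X in _ --> X]addr0 -[X in _ --> _ + X](mulr0 (b2 / 2)).
  by apply: cvgD => //; exact: cvgM.
have ev1 : \forall n \near \oo, a n - mark_mean (nu n) + kappa n * q n < mu.
  exact: cvgr_lt rcvg _ mu_gt0.
have ev2 : \forall n \near \oo, expR (- (lambda * limit_exponent (a n)
    (a n - mark_mean (nu n)) (kappa n) (q n) mu)) < L + eta.
  by apply: cvgr_lt lcvg _ _; rewrite ltrDl.
near=> n.
have n1 : a n - mark_mean (nu n) + kappa n * q n < mu by near: n.
have n2 : expR (- (lambda * limit_exponent (a n)
    (a n - mark_mean (nu n)) (kappa n) (q n) mu)) < L + eta by near: n.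
have ecvg := exponent_laplace_cvg (n := n) (kappa0 n) (q0 n).
have ev3 : \forall t \near +oo,
    expR (- (lambda * exponent (a n) mu (nu n) (kappa n) (q n) t)) < L + eta.
  by apply: cvgr_lt ecvg _ _.
near=> t.
have t0 : 0 <= t by near: t; apply: nbhs_pinfty_ge; rewrite num_real.
rewrite laplaceE.
apply: (@le_trans _ _ (expR (- (lambda * exponent (a n) mu (nu n) (kappa n) (q n) t)))); last first.
  by apply: ltW; near: t.
apply: (gf_upper (Q n) (ltW lambda_gt0)) => //.
- by rewrite (ltW (zeta_gt0 n)) zeta_le1.
- exact: ltW.
- by move=> x /andP[x0 _]; exact: mark_laplace_le.
- rewrite [leRHS](_ : _ = q n * (mu + zeta n * mark_mean (nu n))); last first.
    by rewrite divfK// gt_eqF.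
  have := mulr_gt0 (delta_gt0 n) (q0 n).
  set dd := a n - _; set m := mark_mean _; set qq := q n; set z := zeta n; lra.
Unshelve. all: by end_near. Qed.

Lemma laplace_ge_near_perturbed (eta eta' : R) : 0 < eta -> 0 < eta' -> eta' < b2 / 2 ->
  \forall n \near \oo, \forall t \near +oo,
  laplace_limit (b2 / 2 - eta') ((1 + eta') * theta / (mu * r)) - eta <= laplace n t.
Proof.
move=> eta0 eta'0 eta'b2.
pose kappa : R := b2 / 2 - eta'.
(* For q = c zeta the term (mu - delta) q equals zeta (1 + eta' - delta c), so the condition of
   [gf_lower] reduces to 2 kappa c q + delta c <= eta', true for large n. *)
pose c := (1 + eta') / mu.
pose q n := c * zeta n.
have k0 : 0 < kappa by rewrite subr_gt0.
have c0 : 0 < c by rewrite divr_gt0// addr_gt0.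
have q0 n : 0 < q n by rewrite mulr_gt0.
have [qcvg qdcvg] := @q_delta_cvg c q (fun=> erefl).
have kcvg : (fun=> kappa) n @[n --> \oo] --> kappa by exact: cvg_cst.
have [x0 x00 hx0] := mark_laplace_ge_uniform nu_gt0 nu_int nu_int2 b2_cvg nu_ui eta'0.
have cE : c * (theta / r) = (1 + eta') * theta / (mu * r) by rewrite /c invfM; ring.
have c1 : 0 <= (1 + eta') * theta / (mu * r).
  by rewrite -cE ltW// mulr_gt0// divr_gt0.
rewrite cE in qdcvg.
have lcvg := limit_laplace_cvg k0 c1 kcvg qcvg qdcvg.
have rcvg : a n - mark_mean (nu n) + kappa * q n @[n --> \oo] --> (0 : R).
  rewrite -[X in _ --> X]addr0 -[X in _ --> _ + X](mulr0 kappa).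
  by apply: cvgD => //; exact: cvgM.
have ev1 : \forall n \near \oo, a n - mark_mean (nu n) + kappa * q n < mu.
  exact: cvgr_lt rcvg _ mu_gt0.
have ev2 : \forall n \near \oo,
    laplace_limit kappa ((1 + eta') * theta / (mu * r)) - eta <
    expR (- (lambda * limit_exponent (a n) (a n - mark_mean (nu n)) kappa (q n) mu)).
  by apply: cvgr_gt lcvg _ _; rewrite gtrBl.
have ev3 : \forall n \near \oo, q n < x0 by exact: cvgr_lt qcvg _ x00.
have scvg : 2 * kappa * c * q n + (a n - mark_mean (nu n)) * c @[n --> \oo] --> (0 : R).
  rewrite -[X in _ --> X]addr0 -[X in _ --> X + _](mulr0 (2 * kappa * c)).
  rewrite -[X in _ --> _ + X](mul0r c).
  apply: cvgD; first by apply: cvgM => //; exact: cvg_cst.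
  by apply: cvgM => //; exact: cvg_cst.
have ev4 : \forall n \near \oo, 2 * kappa * c * q n + (a n - mark_mean (nu n)) * c < eta'.
  exact: cvgr_lt scvg _ eta'0.
near=> n.
have n1 : a n - mark_mean (nu n) + kappa * q n < mu by near: n.
have n2 : laplace_limit kappa ((1 + eta') * theta / (mu * r)) - eta <
    expR (- (lambda * limit_exponent (a n) (a n - mark_mean (nu n)) kappa (q n) mu)).
  by near: n.
have n3 : q n < x0 by near: n.
have n4 : 2 * kappa * c * q n + (a n - mark_mean (nu n)) * c < eta' by near: n.
have n5 : forall x, 0 <= x <= x0 ->
  1 - mark_mean (nu n) * x + (b2 / 2 - eta') * x ^+ 2 <= mark_laplace (nu n) x by near: n.
have ecvg := exponent_laplace_cvg (n := n) k0 (q0 n).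
have ev5 : \forall t \near +oo,
    laplace_limit kappa ((1 + eta') * theta / (mu * r)) - eta <
    expR (- (lambda * exponent (a n) mu (nu n) kappa (q n) t)).
  by apply: cvgr_gt ecvg _ _.
near=> t.
have t0 : 0 <= t by near: t; apply: nbhs_pinfty_ge; rewrite num_real.
rewrite laplaceE.
apply: (@le_trans _ _ (expR (- (lambda * exponent (a n) mu (nu n) kappa (q n) t)))).
  by apply: ltW; near: t.
apply: (gf_lower (Q n) (ltW lambda_gt0)) => //.
- by rewrite (ltW (zeta_gt0 n)) zeta_le1.
- exact: ltW.
- by move=> x /andP[x0' xq]; apply: n5; rewrite x0' (le_trans xq)// ltW.
- have -> : (mu - (a n - mark_mean (nu n))) * q n =
      zeta n * (1 + eta' - (a n - mark_mean (nu n)) * c).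
    by rewrite /q /c; field; rewrite gt_eqF.
  have -> : zeta n + 2 * kappa * q n ^+ 2 = zeta n * (1 + 2 * kappa * c * q n).
    by rewrite /q; ring.
  by rewrite ler_pM2l//; move: n4; set u := 2 * _ * _ * _; set v := _ * c; lra.
Unshelve. all: by end_near. Qed.

(** The perturbed limit is continuous in the perturbation e at 0; a small e > 0 is fixed at the cost
    of eta / 2 before n tends to infinity. *)
Lemma laplace_ge_near (eta : R) : 0 < eta -> \forall n \near \oo, \forall t \near +oo,
  L - eta <= laplace n t.
Proof.
move=> eta0; have b20 := moment2_limit_gt0; have k0 : 0 < b2 / 2 by rewrite divr_gt0.
have eta2 : 0 < eta / 2 by rewrite divr_gt0.
have pcvg : laplace_limit (b2 / 2 - e) ((1 + e) * theta / (mu * r)) @[e --> (0 : R)] --> L.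
  have kc : b2 / 2 - e @[e --> (0 : R)] --> b2 / 2.
    by rewrite -[X in _ --> X]subr0; apply: cvgB; [exact: cvg_cst|exact: cvg_id].
  have cc : (1 + e) * theta / (mu * r) @[e --> (0 : R)] --> theta / (mu * r).
    rewrite (_ : theta / (mu * r) = (1 + 0) * theta / (mu * r)); last by rewrite addr0 mul1r.
    apply: cvgM; last exact: cvg_cst.
    apply: cvgM; last exact: cvg_cst.
    by apply: cvgD; [exact: cvg_cst|exact: cvg_id].
  apply: (@cvg_comp _ _ _ (fun e => - (lambda * (r * (ln (1 + (b2 / 2 - e) *
     ((1 + e) * theta / (mu * r))) / (b2 / 2 - e))))) expR _
     (nbhs (- (lambda * (r * (ln (1 + b2 / 2 * (theta / (mu * r))) / (b2 / 2)))))) _); last first.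
    exact: continuous_expR.
  apply: cvgN; apply: cvgM; first exact: cvg_cst.
  apply: cvgM; first exact: cvg_cst.
  apply: cvgM; last by apply: cvgV => //; rewrite gt_eqF.
  apply: (@cvg_comp _ _ _ (fun e => 1 + (b2 / 2 - e) * ((1 + e) * theta / (mu * r))) (@ln R) _
     (nbhs (1 + b2 / 2 * (theta / (mu * r)))) _).
    by apply: cvgD; [exact: cvg_cst|exact: cvgM].
  by apply: continuous_ln; rewrite addr_gt0// mulr_gt0// divr_gt0// mulr_gt0.
have := cvg_at_right_filter pcvg => rcvg.
have ev1 : \forall e \near 0^'+, L - eta / 2 <
    laplace_limit (b2 / 2 - e) ((1 + e) * theta / (mu * r)).
  by apply: cvgr_gt rcvg _ _; rewrite gtrBl.
near (0 : R)^'+ => e.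
have e0 : 0 < e by near: e; exact: nbhs_right_gt.
have e1 : e < b2 / 2 by near: e; exact: nbhs_right_lt.
have e2 : L - eta / 2 < laplace_limit (b2 / 2 - e) ((1 + e) * theta / (mu * r)) by near: e.
have h := laplace_ge_near_perturbed eta2 e0 e1.
apply: filterS h => n; apply: filterS => t.
apply: le_trans; rewrite lerBrDr; apply: le_trans (ltW e2).
by rewrite le_eqVlt; apply/orP; left; apply/eqP; field.
Unshelve. all: by end_near. Qed.

End heavy_traffic_laplace.

(** * Expectations under the Gamma law *)

Section gamma_expectation.
Variable R : realType.
Variables a b : R.
Hypotheses (a0 : 0 < a) (b0 : 0 < b).
Local Notation leb := (@lebesgue_measure R).
Local Notation pdf := (@gamma_pdf R a b).

Definition gamma_Ex (f : R -> R) : R := \int[leb]_x (f x * gamma_pdf a b x).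

Definition gamma_Li (f : R -> R) : Prop :=
  leb.-integrable setT (fun x => (f x * gamma_pdf a b x)%:E).

Lemma integrable_gamma_pdf : leb.-integrable setT (EFin \o pdf).
Proof.
apply/integrableP; split; first by apply/measurable_EFinP; exact: measurable_gamma_pdf.
have h := gamma_laplace a0 b0 (lexx 0).
under eq_integral do rewrite /= ger0_norm ?gamma_pdf_ge0//.
have e : (\int[leb]_x (pdf x)%:E = \int[leb]_x (expR (- (0 * x)) * pdf x)%:E)%E.
  by apply: eq_integral => x _; rewrite mul0r oppr0 expR0 mul1r.
by rewrite e h ltry.
Qed.

(** The bound is asked on x >= 0 only, where the density lives: polynomials in e^(-x) are bounded
    there but not on the whole line. *)
Lemma gamma_Li_bounded (f : R -> R) (c : R) : measurable_fun setT f ->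
  (forall x, 0 <= x -> `|f x| <= c) -> gamma_Li f.
Proof.
move=> mf fc; have h : leb.-integrable setT (fun x => (c * pdf x)%:E).
  exact: (integrableZl measurableT _ integrable_gamma_pdf).
apply: (le_integrable measurableT _ _ h).
  by apply/measurable_EFinP; apply: measurable_funM => //; exact: measurable_gamma_pdf.
move=> x _; rewrite !abse_EFin lee_fin !normrM.
have [x0|x0] := ltP 0 x; last first.
  by rewrite /gamma_pdf ltNge x0 /= normr0 !mulr0.
rewrite ler_wpM2r//; apply: le_trans (ler_norm c); exact: fc (ltW x0).
Qed.

Lemma gamma_LiZ c f : gamma_Li f -> gamma_Li (fun x => c * f x).
Proof.
move=> /(integrableZl measurableT c); rewrite /gamma_Li.
by under eq_fun do rewrite -EFinM mulrA.
Qed.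

Lemma gamma_LiD f g : gamma_Li f -> gamma_Li g -> gamma_Li (fun x => f x + g x).
Proof.
move=> iF ig; have := integrableD measurableT iF ig; rewrite /gamma_Li.
by under eq_fun do rewrite -EFinD -mulrDl.
Qed.

Lemma gamma_ExZ c f : gamma_Li f -> gamma_Ex (fun x => c * f x) = c * gamma_Ex f.
Proof.
move=> iF; rewrite /gamma_Ex -RintegralZl//.
by apply: eq_Rintegral => x _; rewrite mulrA.
Qed.

Lemma gamma_ExD f g : gamma_Li f -> gamma_Li g ->
  gamma_Ex (fun x => f x + g x) = gamma_Ex f + gamma_Ex g.
Proof.
move=> iF ig; rewrite /gamma_Ex -RintegralD//.
by apply: eq_Rintegral => x _; rewrite mulrDl.
Qed.

Lemma gamma_Li_sum n (f : nat -> R -> R) : (forall i, gamma_Li (f i)) ->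
  gamma_Li (fun x => \sum_(i < n) f i x) /\
  gamma_Ex (fun x => \sum_(i < n) f i x) = \sum_(i < n) gamma_Ex (f i).
Proof.
move=> iF; elim: n => [|n [IH1 IH2]].
  rewrite big_ord0; under [X in gamma_Li X]eq_fun do rewrite big_ord0.
  under [X in gamma_Ex X]eq_fun do rewrite big_ord0.
  split; first by apply: (@gamma_Li_bounded _ 0) => // x _; rewrite normr0.
  rewrite /gamma_Ex (_ : (fun x => 0 * pdf x) = cst 0); first by rewrite Rintegral_cst// mul0r.
  by apply/funext => x; rewrite mul0r.
rewrite big_ord_recr /= -IH2 -gamma_ExD//.
under [X in gamma_Li X]eq_fun do rewrite big_ord_recr/=.
split; first exact: gamma_LiD.
by congr gamma_Ex; apply/funext => x; rewrite big_ord_recr.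
Qed.

Lemma le_gamma_Ex f g : gamma_Li f -> gamma_Li g ->
  (forall x, 0 <= x -> f x <= g x) -> gamma_Ex f <= gamma_Ex g.
Proof.
move=> iF ig fg; apply: le_Rintegral => // x _.
have [x0|x0] := ltP 0 x; last by rewrite /gamma_pdf ltNge x0 /= !mulr0.
by rewrite ler_wpM2r ?gamma_pdf_ge0// fg// ltW.
Qed.

Lemma gamma_Li_exp (t : R) : 0 <= t -> gamma_Li (fun x => expR (- (t * x))).
Proof.
move=> t0; apply: (@gamma_Li_bounded _ 1).
  by apply: measurableT_comp => //; apply: measurableT_comp.
by move=> x x0; rewrite ger0_norm ?expR_ge0// -expR0 ler_expR oppr_le0 mulr_ge0.
Qed.

Lemma gamma_Ex_exp (t : R) : 0 <= t ->
  gamma_Ex (fun x => expR (- (t * x))) = (b / (b + t)) `^ a.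
Proof. by move=> t0; rewrite /gamma_Ex /Rintegral gamma_laplace. Qed.

Lemma gamma_Li_cst c : gamma_Li (fun=> c).
Proof. exact: (@gamma_Li_bounded _ `|c|). Qed.

Lemma gamma_Ex_cst c : gamma_Ex (fun=> c) = c.
Proof.
have e := gamma_Ex_exp (lexx 0).
rewrite addr0 divff ?gt_eqF// powR1 in e.
rewrite -[RHS]mulr1 -e -gamma_ExZ; last exact: gamma_Li_exp.
by congr gamma_Ex; apply/funext => x; rewrite mul0r oppr0 expR0 mulr1.
Qed.

Lemma gamma_Li_le (x : R) : gamma_Li (fun y => (y <= x)%R%:R).
Proof.
apply: (@gamma_Li_bounded _ 1); last by move=> y _; case: (y <= x); rewrite ?normr1 ?normr0.
rewrite (_ : (fun y => _) = \1_(`]-oo, x]%classic)); first exact: measurable_indic.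
apply/funext => y; rewrite indicE.
by have -> : (y \in `]-oo, x]%classic) = (y <= x) by apply/idP/idP; rewrite inE/= in_itv.
Qed.

Lemma gamma_lawE (x : R) :
  gamma_law a b `]-oo, x]%classic = (gamma_Ex (fun y => (y <= x)%R%:R))%:E.
Proof.
rewrite /gamma_Ex /Rintegral fineK; last first.
  exact: integrable_fin_num (gamma_Li_le x).
rewrite /gamma_law [LHS]integral_mkcond; apply: eq_integral => y _; rewrite patchE.
have -> : (y \in `]-oo, x]%classic) = (y <= x) by apply/idP/idP; rewrite inE/= in_itv.
by case: (y <= x); rewrite ?mul1r ?mul0r.
Qed.

End gamma_expectation.

(* Nonnegative variables are studied through polynomials in e^{-X}: their
   expectations converge by the Laplace transforms at the integers, and they
   approximate steps uniformly by Bernstein's theorem. *)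
Section laplace_continuity.
Variables (R : realType) (a b : R).
Hypotheses (a0 : 0 < a) (b0 : 0 < b).
Context (I : Type) (F : set_system I) {FF : Filter F}.
Variables (d : I -> measure_display) (T : forall i, measurableType (d i)).
Variable P : forall i, probability (T i) R.
Variable X : forall i, T i -> R.
Hypothesis mX : \forall i \near F, measurable_fun setT (@X i).
Hypothesis X0 : forall i w, 0 <= @X i w.
Hypothesis cvg_laplace : forall k : nat,
  Ex (P i) (fun w => expR (- (k%:R * X w))) @[i --> F] --> (b / (b + k%:R)) `^ a.

Lemma Li_exp i (t : R) : 0 <= t -> measurable_fun setT (@X i) ->
  Li (P i) (fun w => expR (- (t * X w))).
Proof.
move=> t0 m; apply: (@Li_bounded _ _ _ _ _ 1).
  apply: measurableT_comp => //; apply: measurableT_comp => //.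
  exact: measurable_funM.
by move=> w; rewrite ger0_norm ?expR_ge0// -expR0 ler_expR oppr_le0 mulr_ge0.
Qed.

Lemma horner_exp (p : {poly R}) (x : R) :
  p.[expR (- x)] = \sum_(k < size p) p`_k * expR (- (k%:R * x)).
Proof.
by rewrite horner_coef; apply: eq_bigr => k _; rewrite -expRM_natl mulrN.
Qed.

Lemma gamma_Li_horner (p : {poly R}) : gamma_Li a b (fun x => p.[expR (- x)]).
Proof.
under [X in gamma_Li _ _ X]eq_fun do rewrite horner_exp.
have iF (k : nat) : gamma_Li a b (fun x => p`_k * expR (- (k%:R * x))).
  by apply: gamma_LiZ; exact: gamma_Li_exp.
exact: (gamma_Li_sum a0 b0 (size p) iF).1.
Qed.

Lemma Li_horner (p : {poly R}) i : measurable_fun setT (@X i) ->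
  Li (P i) (fun w => p.[expR (- X w)]).
Proof.
move=> m; under [X in Li _ X]eq_fun do rewrite horner_exp.
apply: (@Li_sum _ _ _ _ _ (fun k w => p`_k * expR (- (k%:R * X w)))) => k.
by apply: LiZ; exact: Li_exp.
Qed.

Lemma cvg_horner (p : {poly R}) :
  Ex (P i) (fun w => p.[expR (- X w)]) @[i --> F] --> gamma_Ex a b (fun x => p.[expR (- x)]).
Proof.
have -> : gamma_Ex a b (fun x => p.[expR (- x)]) =
    \sum_(k < size p) p`_k * ((b / (b + k%:R)) `^ a).
  under [X in gamma_Ex _ _ X]eq_fun do rewrite horner_exp.
  have iF (k : nat) : gamma_Li a b (fun x => p`_k * expR (- (k%:R * x))).
    by apply: gamma_LiZ; exact: gamma_Li_exp.
  rewrite (gamma_Li_sum a0 b0 (size p) iF).2; apply: eq_bigr => k _.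
  by rewrite gamma_ExZ ?gamma_Ex_exp//; exact: gamma_Li_exp.
have h : \sum_(k < size p) p`_k * Ex (P i) (fun w => expR (- (k%:R * X w))) @[i --> F] -->
    \sum_(k < size p) p`_k * ((b / (b + k%:R)) `^ a).
  apply: cvg_big => [|k _]; first exact: add_continuous.
  by apply: cvgM => //; exact: cvg_cst.
apply: cvg_trans h; apply: near_eq_cvg; near=> i.
have m : measurable_fun setT (@X i) by near: i.
under [X in _ = Ex _ X]eq_fun do rewrite horner_exp.
rewrite (@Ex_sum _ _ _ _ _ (fun k w => p`_k * expR (- (k%:R * X w)))).
  by apply: eq_bigr => k _; rewrite ExZ//; exact: Li_exp.
by move=> k; apply: LiZ; exact: Li_exp.
Unshelve. all: by end_near. Qed.

Lemma Ex_le_indic i (x : R) : measurable_fun setT (@X i) ->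
  Li (P i) (fun w => (X w <= x)%R%:R) /\
  (Ex (P i) (fun w => (X w <= x)%R%:R))%:E = P i [set w | X w <= x].
Proof.
move=> m; have ms : measurable [set w : T i | X w <= x].
  rewrite -[X in measurable X]setTI; have := m measurableT _ (measurable_itv `]-oo, x]).
  by congr measurable; apply/seteqP; split => w /=; rewrite in_itv.
have e : (fun w => (X w <= x)%R%:R) = \1_[set w : T i | X w <= x] :> (T i -> R).
  apply/funext => w; rewrite indicE.
  by have -> : (w \in [set w : T i | X w <= x]) = (X w <= x) by apply/idP/idP; rewrite inE.
rewrite e; split; first exact: Li_indic.
by rewrite Ex_indic// fineK// fin_num_measure.
Qed.

(** One polynomial in e^(-X) serves both laws. The error is eta / 3 for the step under each law and
    eta / 3 for the convergence; the gap between x and x' is where the polynomial makes its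
    transition. *)
Lemma cdf_near_le (x x' eta : R) : x < x' -> 0 < eta -> \forall i \near F,
  (P i [set w | (X w <= x)%R] <= gamma_law a b `]-oo, x']%classic + eta%:E)%E.
Proof.
move=> xx eta0; have e3 : 0 < eta / 3 by rewrite divr_gt0.
have [p hp] := step_poly_exp xx e3.
have ev : \forall i \near F, Ex (P i) (fun w => p.[expR (- X w)]) <
    gamma_Ex a b (fun x => p.[expR (- x)]) + eta / 3.
  by apply: cvgr_lt (@cvg_horner p) _ _; rewrite ltrDl.
near=> i.
have m : measurable_fun setT (@X i) by near: i.
have h : Ex (P i) (fun w => p.[expR (- X w)]) <
    gamma_Ex a b (fun x => p.[expR (- x)]) + eta / 3 by near: i.
have [iI <-] := Ex_le_indic x m; rewrite gamma_lawE// -EFinD lee_fin.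
have h1 : Ex (P i) (fun w => (X w <= x)%R%:R) <=
    Ex (P i) (fun w => p.[expR (- X w)]) + eta / 3.
  rewrite -[X in _ + X](Ex_cst (P i)) -ExD; [|exact: Li_horner|exact: Li_cst].
  apply: le_Ex => //; first by apply: LiD; [exact: Li_horner|exact: Li_cst].
  by move=> w; rewrite -lerBlDr; have /andP[] := hp _ (X0 w).
have h2 : gamma_Ex a b (fun x => p.[expR (- x)]) <=
    gamma_Ex a b (fun y => (y <= x')%R%:R) + eta / 3.
  rewrite -[X in _ + X](gamma_Ex_cst a0 b0) -gamma_ExD; [|exact: gamma_Li_le|exact: gamma_Li_cst].
  apply: le_gamma_Ex => //; first exact: gamma_Li_horner.
    by apply: gamma_LiD; [exact: gamma_Li_le|exact: gamma_Li_cst].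
  by move=> y y0; have /andP[] := hp _ y0.
move: h h1 h2; set u := Ex _ _; set v := Ex _ _; set y := gamma_Ex _ _ _; lra.
Unshelve. all: by end_near. Qed.

Lemma cdf_near_ge (x x' eta : R) : x < x' -> 0 < eta -> \forall i \near F,
  (gamma_law a b `]-oo, x]%classic - eta%:E <= P i [set w | (X w <= x')%R])%E.
Proof.
move=> xx eta0; have e3 : 0 < eta / 3 by rewrite divr_gt0.
have [p hp] := step_poly_exp xx e3.
have ev : \forall i \near F, gamma_Ex a b (fun x => p.[expR (- x)]) - eta / 3 <
    Ex (P i) (fun w => p.[expR (- X w)]).
  by apply: cvgr_gt (@cvg_horner p) _ _; rewrite gtrBl.
near=> i.
have m : measurable_fun setT (@X i) by near: i.
have h : gamma_Ex a b (fun x => p.[expR (- x)]) - eta / 3 <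
    Ex (P i) (fun w => p.[expR (- X w)]) by near: i.
have [iI <-] := Ex_le_indic x' m; rewrite gamma_lawE// -EFinB lee_fin.
have h1 : Ex (P i) (fun w => p.[expR (- X w)]) <=
    Ex (P i) (fun w => (X w <= x')%R%:R) + eta / 3.
  rewrite -[X in _ + X](Ex_cst (P i)) -ExD//; last exact: Li_cst.
  apply: le_Ex => //; [exact: Li_horner|by apply: LiD => //; exact: Li_cst|].
  by move=> w; have /andP[] := hp _ (X0 w).
have h2 : gamma_Ex a b (fun y => (y <= x)%R%:R) <=
    gamma_Ex a b (fun x => p.[expR (- x)]) + eta / 3.
  rewrite -[X in _ + X](gamma_Ex_cst a0 b0) -gamma_ExD; [|exact: gamma_Li_horner|exact: gamma_Li_cst].
  apply: le_gamma_Ex => //; first exact: gamma_Li_le.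
    by apply: gamma_LiD; [exact: gamma_Li_horner|exact: gamma_Li_cst].
  by move=> y y0; rewrite -lerBlDr; have /andP[] := hp _ y0.
move: h h1 h2; set u := Ex _ _; set v := Ex _ _; set y := gamma_Ex _ _ _; lra.
Unshelve. all: by end_near. Qed.

End laplace_continuity.

(** A monotone function has countably many discontinuities, while an interval of positive length is
    not a null set. *)
Lemma dense_continuity_points (R : realType) (G : R -> R) (x x' : R) : x < x' ->
  {homo G : u v / u <= v} -> exists2 y, x < y < x' & {for y, continuous G}.
Proof.
move=> xx ndG; apply: contrapT => nc.
have sub : `]x, x'[%classic `<=` [set y | y \in (`](x - 1), (x' + 1)[) /\ discontinuity G y].
  move=> y /= /[!in_itv]/= /andP[xy yx]; split.
    by rewrite (lt_trans _ xy) ?(lt_trans yx)// ?ltrDl ?gtrBl.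
  have nd : {in `[(y - 1), (y + 1)] &, nondecreasing_fun G} by move=> u v _ _; exact: ndG.
  have yi : y \in `](y - 1), (y + 1)[ by rewrite in_itv/= ltrDl gtrBl ltr01.
  have cl : cvg (G u @[u --> y^'-]).
    apply: nondecreasing_at_left_is_cvgr.
      by near=> u => a b _ _; exact: ndG.
    by near=> u; exists (G y) => _ [v /= /[!in_itv]/= /andP[_ /ltW vy] <-]; exact: ndG.
  have cr : cvg (G u @[u --> y^'+]).
    apply: nondecreasing_at_right_is_cvgr.
      by near=> u => a b _ _; exact: ndG.
    by near=> u; exists (G y) => _ [v /= /[!in_itv]/= /andP[/ltW yv _] <-]; exact: ndG.
  split => //; apply/eqP => e; apply: nc; exists y; first by rewrite xy.
  have l1 : lim (G u @[u --> y^'-]) <= G y.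
    apply: limr_le => //; near=> u; apply: ndG; apply: ltW; near: u.
    exact: nbhs_left_lt.
  have l2 : G y <= lim (G u @[u --> y^'+]).
    apply: limr_ge => //; near=> u; apply: ndG; apply: ltW; near: u.
    exact: nbhs_right_gt.
  have e1 : lim (G u @[u --> y^'-]) = G y by apply/eqP; rewrite eq_le l1 e l2.
  have e2 : lim (G u @[u --> y^'+]) = G y by rewrite -e.
  by apply/left_right_continuousP; split; [rewrite -e1; exact: cl|rewrite -e2; exact: cr].
have ct := sub_countable (subset_card_le sub) (discontinuity_countable (fun u v _ _ => @ndG u v)).
have := countable_lebesgue_measure0 ct.
rewrite lebesgue_measure_itv /= lte_fin xx -EFinB => -[] /eqP.
by rewrite subr_eq0 gt_eqF.
Unshelve. all: by end_near. Qed.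

(** * From the queue at time t to its stationary law *)

Section scaled_limit_law.
Variable R : realType.
Context d (T : measurableType d) (P : probability T R) (X : R -> T -> R).
Context e (S : measurableType e) (P' : probability S R) (N : {RV P' >-> R}).
Hypothesis mX : forall t, 0 <= t -> measurable_fun setT (X t).
Hypothesis XN : cvg_in_distribution (pinfty_nbhs R) (fun t => pushforward P (X t))
  (distribution P' N).
Variable c : R.
Hypothesis c0 : 0 < c.

Lemma measurable_scaled_le d' (T' : measurableType d') (Y : T' -> R) (k x : R) :
  measurable_fun setT Y -> measurable [set w | k * Y w <= x].
Proof.
move=> mY; have mk : measurable_fun setT (fun w => k * Y w) by exact: measurable_funM.
rewrite -[X in measurable X]setTI; have := mk measurableT _ (measurable_itv `]-oo, x]).
by congr measurable; apply/seteqP; split => w /=; rewrite in_itv.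
Qed.

(** Convergence to the law of [N] is known only at continuity points of its distribution function;
    between x and x', after rescaling by c, there is one. The inequalities for [N] therefore lose a
    small gap in the argument. *)
Lemma limit_law_cvg (x x' : R) : x < x' -> exists2 y, x < c * y < x' &
  P [set w | X t w <= y] @[t --> +oo] --> P' [set w | N w <= y].
Proof.
move=> xx; have xc : x / c < x' / c by rewrite ltr_pM2r ?invr_gt0.
have nd : {homo (fun y : R => fine (distribution P' N `]-oo, y]%classic)) : u v / u <= v}.
  move=> u v uv; apply: fine_le; rewrite ?fin_num_measure//.
  by apply: le_measure; rewrite ?inE//; exact: subitvPr.
have [y /andP[xy yx] cy] := dense_continuity_points xc nd.
exists y; first by rewrite mulrC -ltr_pdivrMr// xy -ltr_pdivlMr.
have cy' : {for y, continuous (fun y => distribution P' N `]-oo, y]%classic)}.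
  rewrite (_ : (fun y => _) = EFin \o (fun y => fine (distribution P' N `]-oo, y]%classic))).
    by apply: continuous_comp => //; exact: EFin_continuous.
  by apply/funext => z /=; rewrite fineK// fin_num_measure.
have := XN cy'; rewrite /distribution /pushforward.
have itvE d' (T' : measurableType d') (Y : T' -> R) :
    Y @^-1` `]-oo, y]%classic = [set w | Y w <= y].
  by apply/seteqP; split => w /=; rewrite in_itv.
by under eq_fun do rewrite itvE; rewrite itvE.
Qed.

Lemma limit_law_le (x x' : R) (p : \bar R) : x < x' ->
  (\forall t \near +oo, (P [set w | (c * X t w <= x')%R] <= p)%E) ->
  (P' [set w | (c * N w <= x)%R] <= p)%E.
Proof.
move=> xx h; have [y /andP[xy yx] cv] := limit_law_cvg xx.
have mN : measurable_fun setT N by [].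
have m1 z := measurable_scaled_le 1 z mN.
apply: (@le_trans _ _ (P' [set w | N w <= y])).
  apply: le_measure; rewrite ?inE.
  - exact: measurable_scaled_le.
  - by have := m1 y; under eq_set do rewrite mul1r.
  - by move=> w /= hw; rewrite -(ler_pM2l c0); exact: le_trans hw (ltW xy).
rewrite -(cvg_lim _ cv)//; apply: lime_le; first by apply/cvg_ex; eexists; exact: cv.
near=> t; apply: (@le_trans _ _ (P [set w | c * X t w <= x'])); last by near: t.
have t0 : 0 <= t by near: t; apply: nbhs_pinfty_ge; rewrite num_real.
apply: le_measure; rewrite ?inE.
- by have := measurable_scaled_le 1 y (mX t0); under eq_set do rewrite mul1r.
- by apply: measurable_scaled_le; exact: mX.
- by move=> w /= hw; apply: le_trans (ltW yx); rewrite ler_pM2l.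
Unshelve. all: by end_near. Qed.

Lemma limit_law_ge (x x' : R) (p : \bar R) : x < x' ->
  (\forall t \near +oo, (p <= P [set w | (c * X t w <= x)%R])%E) ->
  (p <= P' [set w | (c * N w <= x')%R])%E.
Proof.
move=> xx h; have [y /andP[xy yx] cv] := limit_law_cvg xx.
have mN : measurable_fun setT N by [].
have m1 z := measurable_scaled_le 1 z mN.
apply: (@le_trans _ _ (P' [set w | N w <= y])); last first.
  apply: le_measure; rewrite ?inE.
  - by have := m1 y; under eq_set do rewrite mul1r.
  - exact: measurable_scaled_le.
  - by move=> w /= hw; apply: le_trans (ltW yx); rewrite ler_pM2l.
rewrite -(cvg_lim _ cv)//; apply: lime_ge; first by apply/cvg_ex; eexists; exact: cv.
near=> t; apply: (@le_trans _ _ (P [set w | c * X t w <= x])); first by near: t.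
have t0 : 0 <= t by near: t; apply: nbhs_pinfty_ge; rewrite num_real.
apply: le_measure; rewrite ?inE.
- by apply: measurable_scaled_le; exact: mX.
- by have := measurable_scaled_le 1 y (mX t0); under eq_set do rewrite mul1r.
- by move=> w /= hw; rewrite -(ler_pM2l c0); exact: le_trans hw (ltW xy).
Unshelve. all: by end_near. Qed.

End scaled_limit_law.

(* First t tends to infinity, then n. *)
Definition near_double (R : realType) : set_system (nat * R) :=
  [set A | \forall n \near \oo, \forall t \near +oo, A (n, t)].

#[local] Instance near_double_filter (R : realType) : Filter (@near_double R).
Proof.
split.
- by apply: nearW => n; exact: nearW.
- by move=> A B; rewrite /near_double /= => hA hB; near=> n; near=> t; split; near: t; near: n.
- by move=> A B AB; rewrite /near_double /= => hA; near=> n; near=> t; apply: AB; near: t; near: n.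
Unshelve. all: by end_near. Qed.

Lemma near_doubleE (R : realType) (A : set (nat * R)) :
  (\forall i \near @near_double R, A i) =
  (\forall n \near \oo, \forall t \near +oo, A (n, t)).
Proof. by []. Qed.

Lemma gamma_laplaceE (R : realType) (lambda mu r b2 theta : R) :
  0 < lambda -> 0 < mu -> 0 < r -> 0 < b2 -> 0 <= theta ->
  laplace_limit lambda r (b2 / 2) (theta / (mu * r)) =
  (2 * r * mu / b2 / (2 * r * mu / b2 + theta)) `^ (2 * r * lambda / b2).
Proof.
move=> l0 m0 r0 b0 t0; rewrite /laplace_limit.
have mr : 0 < mu * r by exact: mulr_gt0.
have c0 : 0 < 1 + b2 / 2 * (theta / (mu * r)).
  by rewrite ltr_pwDl// !mulr_ge0 ?invr_ge0// ltW.
have bt : 0 < 2 * r * mu / b2 + theta by rewrite ltr_pwDl// !mulr_gt0// invr_gt0.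
have -> : 2 * r * mu / b2 / (2 * r * mu / b2 + theta) = (1 + b2 / 2 * (theta / (mu * r)))^-1.
  apply: (mulIf (lt0r_neq0 c0)); rewrite mulVf ?gt_eqF//.
  field; rewrite !gt_eqF//=.
  by rewrite ltr_wpDr// ?mulr_ge0 ?mulr_gt0// ltW.
rewrite /powR gt_eqF ?invr_gt0// lnV ?posrE//; congr expR.
by field; rewrite gt_eqF.
Qed.

(* The limit is taken along a sequence of queues, with fixed lambda and mu, whose
   branching ratios increase to 1 from below; both the mark law nu n and the
   decay rate a n of the excitation function may depend on n, as long as
   a n -> r, the second moments converge to b2 and the squared marks are
   uniformly integrable.  The last condition is automatic when all the marks have
   the same law (a n -> b1 = r), or are rescalings c n * B of one mark B (for
   instance with a n = r for all n). *)
Theorem theorem6p6 (R : realType) (lambda mu r b2 : R)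
    (a : nat -> R) (nu : nat -> probability R R)
    (d : nat -> measure_display) (T : forall n, measurableType (d n))
    (P : forall n, probability (T n) R)
    (Q : forall n, hawkes_queue (P n) lambda (nu n)
                     (exp_decay (a n)) (exp_decay mu))
    (e : nat -> measure_display) (S : forall n, measurableType (e n))
    (P' : forall n, probability (S n) R)
    (N : forall n, {RV (P' n) >-> R})
    (rho := fun n => branching_ratio (nu n) (exp_decay (a n)))
    (lambda_gt0 : 0 < lambda) (mu_gt0 : 0 < mu)
    (r_gt0 : 0 < r) (a_gt0 : forall n, 0 < a n)
    (a_cvg : a n @[n --> \oo] --> r)
    (mark_gt0 : forall n, nu n `]0, +oo[%classic = 1%E)
    (mark_mean_fin : forall n, (nu n).-integrable setT (fun x : R => x%:E))
    (mark_moment2_fin : forall n,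
       (nu n).-integrable setT (fun x : R => (x ^+ 2)%:E))
    (mark_moment2_cvg : mark_moment2 (nu n) @[n --> \oo] --> b2)
    (mark_unif_int : forall eps : R, 0 < eps -> exists K : R, forall n,
       (\int[nu n]_(x in `[K, +oo[) (x ^+ 2)%:E <= eps%:E)%E)
    (rho_lt1 : forall n, rho n < 1)
    (rho_cvg : rho n @[n --> \oo] --> (1 : R))
    (stationary : forall n, is_stationary_number (Q n) (N n)) :
  cvg_in_distribution \oo
    (fun n => pushforward (P' n) (fun w => (1 - rho n) * N n w : R))
    (gamma_law (2 * r * lambda / b2) (2 * r * mu / b2)).

Proof.
have nu_int n : Li (nu n) (fun x : R => x) by exact: mark_mean_fin.
have nu_int2 n : Li (nu n) (fun x : R => x ^+ 2) by exact: mark_moment2_fin.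
have eps0 n : 0 < 1 - rho n by rewrite subr_gt0.
have b20 : 0 < b2 := moment2_limit_gt0 r_gt0 a_gt0 a_cvg nu_int nu_int2
  mark_moment2_cvg rho_cvg.
pose shape := 2 * r * lambda / b2; pose rate := 2 * r * mu / b2.
have shape0 : 0 < shape by rewrite divr_gt0// !mulr_gt0.
have rate0 : 0 < rate by rewrite divr_gt0// !mulr_gt0.
pose Nt n t (w : T n) : R := (number_in_system (hq_count (Q n)) (hq_epoch (Q n))
  (hq_service (Q n)) t w)%:R.
pose X (i : nat * R) (w : T i.1) : R := (1 - rho i.1) * Nt i.1 i.2 w.
have mN n t : 0 <= t -> measurable_fun setT (@Nt n t).
  by move=> t0; exact: measurable_number.
have X0 i w : 0 <= @X i w by rewrite mulr_ge0// ltW.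
have mX : \forall i \near @near_double R, measurable_fun setT (@X i).
  rewrite near_doubleE; apply: nearW => n; near=> t.
  apply: measurable_funM => //; apply: mN.
  by near: t; apply: nbhs_pinfty_ge; rewrite num_real.
have cvg_laplace (k : nat) : Ex (P i.1) (fun w => expR (- (k%:R * @X i w))) @[i --> @near_double R]
    --> (rate / (rate + k%:R)) `^ shape.
  apply/cvgrPdist_le => eta eta0.
  (* For k = 0 both sides are 1; the heavy-traffic bounds require theta > 0. *)
  rewrite near_doubleE; case: k => [|k].
    apply: nearW => n; apply: nearW => t /=.
    rewrite addr0 divff ?gt_eqF// powR1 (_ : Ex _ _ = 1) ?subrr ?normr0 ?ltW//.
    rewrite -[RHS](Ex_cst (P n)); apply: eq_Ex => w.
    by rewrite mul0r oppr0 expR0.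
  have k0 : 0 < k.+1%:R :> R by rewrite ltr0n.
  rewrite -(gamma_laplaceE lambda_gt0 mu_gt0 r_gt0 b20 (ltW k0)).
  have h1 := laplace_le_near Q lambda_gt0 mu_gt0 r_gt0 a_gt0 a_cvg mark_gt0 nu_int nu_int2
    mark_moment2_cvg rho_lt1 rho_cvg k0 eta0.
  have h2 := laplace_ge_near Q lambda_gt0 mu_gt0 r_gt0 a_gt0 a_cvg mark_gt0 nu_int nu_int2
    mark_moment2_cvg mark_unif_int rho_lt1 rho_cvg k0 eta0.
  apply: filterS2 h1 h2 => n; apply: filterS2 => t /= h1 h2.
  by rewrite ler_norml lerBrDl -lerBrDr opprK lerBlDl addrC; apply/andP; split; lra.
move=> x; rewrite -/shape -/rate => cx.
pose G y := gamma_Ex shape rate (fun z => (z <= y)%R%:R).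
have GE y : gamma_law shape rate `]-oo, y]%classic = (G y)%:E by exact: gamma_lawE.
have cG : G y @[y --> x] --> G x.
  have : (G y)%:E @[y --> x] --> (G x)%:E.
    by rewrite -GE; under eq_fun do rewrite -GE; exact: cx.
  by move/fine_cvgP => [].
pose L n := P' n [set w | (1 - rho n) * N n w <= x].
have LE n : pushforward (P' n) (fun w => (1 - rho n) * N n w : R) `]-oo, x]%classic = L n.
  rewrite /pushforward /L; set A := _ @^-1` _; set B := [set w | _].
  suff -> : A = B by [].
  by apply/seteqP; split => w; rewrite /A /B /= in_itv.
under eq_fun do rewrite LE.
have Lfin n : L n \is a fin_num.
  by apply: fin_num_measure; exact: measurable_scaled_le.
rewrite GE; apply/fine_cvgP; split; first exact: nearW.
apply/cvgrPdist_le => eta eta0; have e2 : 0 < eta / 2 by rewrite divr_gt0.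
have stat n : cvg_in_distribution (pinfty_nbhs R) (fun t => pushforward (P n) (@Nt n t))
    (distribution (P' n) (N n)) by exact: stationary.
have upper : \forall n \near \oo, (L n <= (G x + eta)%:E)%E.
  have : \forall y \near x^'+, G y < G x + eta / 2.
    by apply: cvgr_lt (cvg_at_right_filter cG) _ _; rewrite ltrDl.
  (* The point y is close enough to x for the limit to grow by less than eta / 2. The first half of
     the gap is spent on passing from time t to [N], the second on the polynomial approximation of
     the step. *)
  move=> hG; near x^'+ => y.
  have xy : x < y by near: y; exact: nbhs_right_gt.
  have Gy : G y < G x + eta / 2 by near: y.
  have xm : x < (x + y) / 2 by rewrite ltr_pdivlMr//; lra.
  have my : (x + y) / 2 < y by rewrite ltr_pdivrMr//; lra.
  have : \forall i \near @near_double R,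
    (P i.1 [set w | (@X i w <= (x + y) / 2)%R] <= gamma_law shape rate `]-oo, y]%classic + (eta / 2)%:E)%E.
    exact: (cdf_near_le shape0 rate0 mX X0 cvg_laplace my e2 (FF := near_double_filter R)).
  rewrite near_doubleE; apply: filterS => n /= h.
  apply: (limit_law_le (@mN n) (stat n) (eps0 n) xm).
  apply: filterS h => t /= h; apply: (le_trans h).
  by rewrite GE -EFinD lee_fin; lra.
have lower : \forall n \near \oo, ((G x - eta)%:E <= L n)%E.
  have : \forall y \near x^'-, G x - eta / 2 < G y.
    by apply: cvgr_gt (cvg_at_left_filter cG) _ _; rewrite gtrBl.
  move=> hG; near x^'- => y.
  have xy : y < x by near: y; exact: nbhs_left_lt.
  have Gy : G x - eta / 2 < G y by near: y.
  have mx : (x + y) / 2 < x by rewrite ltr_pdivrMr//; lra.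
  have ym : y < (x + y) / 2 by rewrite ltr_pdivlMr//; lra.
  have : \forall i \near @near_double R,
    (gamma_law shape rate `]-oo, y]%classic - (eta / 2)%:E <= P i.1 [set w | (@X i w <= (x + y) / 2)%R])%E.
    exact: (cdf_near_ge shape0 rate0 mX X0 cvg_laplace ym e2 (FF := near_double_filter R)).
  rewrite near_doubleE; apply: filterS => n /= h.
  apply: (limit_law_ge (@mN n) (stat n) (eps0 n) mx).
  apply: filterS h => t /= h; apply: le_trans h.
  by rewrite GE -EFinB lee_fin; lra.
apply: filterS2 upper lower => n.
rewrite -[L n]fineK// !lee_fin => h1 h2.
move: h1 h2; rewrite /= ler_norml; set l := fine _ => h1 h2.
by apply/andP; split; lra.
Unshelve. all: by end_near. Qed.
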